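(* Let $D\ge1$ be an integer, let $\alpha\in\mathbb{R}^D$ be a fixed vector, let $\beta\in\mathbb{R}^D$ be the identity vector $\beta_p=p$, and let $c\in\mathbb{R}$ be such that $c+\alpha_\ell\beta_p\in[0,1]$ for all $\ell,p\in[D]$. Let $f:[0,1]\to\mathbb{R}$ and let $M$ be the $D\times D$ counting matrix $M[\ell,p]=f(c+\alpha_\ell\beta_p)$, and set $$\tau(M)=\max_{0\ne b\in\mathbb{R}^D}\frac{\|M^{-1}b\|_\infty}{\|b\|_\infty}.$$ If $\mathsf{KDE}_f(n,m,\varepsilon)$ can be solved in $T(n,m,\varepsilon)$ time, then $\ell_2$-$\mathsf{BCP}(n,m,D)$ with $m=n^{o(1)}$ and $D=n^{o(1)}$ can be solved in $T(n,m+1,(3n\tau(M))^{-1})\cdot n^{o(1)}+n^{1+o(1)}$ time.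
   Context: $\mathsf{KDE}_f(n,m,\varepsilon)$, for $f:[0,1]\to\mathbb{R}$: given $x^{(1)},\dots,x^{(n)},y^{(1)},\dots,y^{(n)}\in\mathbb{R}^m$ with $\|x^{(i)}-y^{(j)}\|_2^2\le1$ for all $i,j$ and $u\in\mathbb{R}^n$, output $v\in\mathbb{R}^n$ with $\|v-Ku\|_\infty\le\varepsilon\|u\|_1$, where $K[i,j]=f(\|x^{(i)}-y^{(j)}\|_2^2)$. It is assumed $f$ can be evaluated exactly in $O(1)$ time. $\ell_2$-$\mathsf{BCP}(n,m,D)$: given two sets $\{x^{(1)},\dots,x^{(n)}\},\{y^{(1)},\dots,y^{(n)}\}\subset\mathbb{Z}^m$ with $\max_{i,j}\|x^{(i)}-y^{(j)}\|_2^2\le D$, compute $\min_{i,j\in[n]}\|x^{(i)}-y^{(j)}\|_2^2$. The quantity $\tau(M)$ presupposes that $M$ is invertible. *)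

(* Defs.v *)
From HB Require Import structures.
From mathcomp Require Export all_boot all_order all_algebra.
From mathcomp Require Export all_classical all_reals all_analysis.
Set Implicit Arguments.
Unset Strict Implicit.
Unset Printing Implicit Defensive.
Import Order.TTheory GRing.Theory Num.Theory.
Import numFieldNormedType.Exports.
Local Open Scope classical_set_scope.
Local Open Scope ring_scope.

Definition sqnorm (A : pzRingType) (d : nat) (v : 'rV[A]_d) : A :=
  \sum_(k < d) v 0 k ^+ 2.

Definition l1norm (R : realType) (d : nat) (v : 'cV[R]_d) : R :=
  \sum_(i < d) `|v i 0|.

Definition linfnorm (R : realType) (d : nat) (v : 'cV[R]_d) : R :=
  \big[Num.max/0]_(i < d) `|v i 0|.

(* Ordinals start at 0, so the p-th entry of the identity vector is p + 1. *)
Definition idvec (R : realType) (d : nat) : 'rV[R]_d := \row_(p < d) p.+1%:R.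

Definition counting_mx (R : realType) (f : R -> R) (d : nat) (c : R)
    (alpha beta : 'rV[R]_d) : 'M[R]_d :=
  \matrix_(l < d, p < d) f (c + alpha 0 l * beta 0 p).

Definition tau (R : realType) (d : nat) (M : 'M[R]_d) : R :=
  sup [set linfnorm (invmx M *m b) / linfnorm b | b in [set b : 'cV[R]_d | b != 0]].

Definition kernel_mx (R : realType) (f : R -> R) (n m : nat)
    (x y : 'M[R]_(n, m)) : 'M[R]_n :=
  \matrix_(i < n, j < n) f (sqnorm (row i x - row j y)).

(* A sequence of nonnegative quantities is n^{o(1)}. *)
Definition subpolynomial (R : realType) (h : nat -> R) : Prop :=
  exists2 e : nat -> R, e @ \oo --> (0 : R) &
    \forall n \near \oo, h n <= n%:R `^ e n.

(* Real RAM with unit-cost evaluation of f.  There are integer and real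
   registers, and integer and real arrays with indirect addressing; programs
   are finite and do not depend on the input size.  Integers can be cast to
   reals, but there is no rounding of reals, and no integer division, shift or
   bitwise operation.  An array is named by a number fixed in the program and
   indexed by the content of an integer register. *)
Inductive instr (R : realType) : Type :=
| IConst of nat & int
| IAdd of nat & nat & nat
| ISub of nat & nat & nat
| IMul of nat & nat & nat
| ILoad of nat & nat & nat
| IStore of nat & nat & nat
| RConst of nat & R
| ROfInt of nat & nat
| RAdd of nat & nat & nat
| RSub of nat & nat & nat
| RMul of nat & nat & nat
| RDiv of nat & nat & nat
| RSqrt of nat & nat
| REval of nat & nat
| RLoad of nat & nat & nat
| RStore of nat & nat & nat.

Inductive test : Type :=
| ILe of nat & nat
| RLe of nat & nat.

Inductive program (R : realType) : Type :=
| Instr of instr R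
| Seq of program R & program R
| If of test & program R & program R
| While of test & program R.

Record state (R : realType) := State {
  ireg : nat -> int;
  rreg : nat -> R;
  iarr : nat -> int -> int;
  rarr : nat -> int -> R }.

Definition upd (A : eqType) (B : Type) (g : A -> B) (a : A) (b : B) : A -> B :=
  fun a' => if a' == a then b else g a'.

Definition set_ireg (R : realType) (s : state R) (d : nat) (v : int) :=
  State (upd (ireg s) d v) (rreg s) (iarr s) (rarr s).
Definition set_rreg (R : realType) (s : state R) (d : nat) (v : R) :=
  State (ireg s) (upd (rreg s) d v) (iarr s) (rarr s).
Definition set_iarr (R : realType) (s : state R) (A : nat) (a v : int) :=
  State (ireg s) (rreg s) (upd (iarr s) A (upd (iarr s A) a v)) (rarr s).
Definition set_rarr (R : realType) (s : state R) (A : nat) (a : int) (v : R) :=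
  State (ireg s) (rreg s) (iarr s) (upd (rarr s) A (upd (rarr s A) a v)).

(* In the binary operations the first argument is the destination register; in
   loads the arguments are destination, array and index register, in stores
   array, index register and source.  Division by 0 and the square root of a
   negative number give 0.  The function f is only given on [0, 1]: REval
   returns 0 elsewhere, so no other value of f is accessible to a program. *)
Definition step (R : realType) (f : R -> R) (i : instr R) (s : state R) :
    state R :=
  match i with
  | IConst d k => set_ireg s d k
  | IAdd d a b => set_ireg s d (ireg s a + ireg s b)
  | ISub d a b => set_ireg s d (ireg s a - ireg s b)
  | IMul d a b => set_ireg s d (ireg s a * ireg s b)
  | ILoad d A a => set_ireg s d (iarr s A (ireg s a))
  | IStore A a b => set_iarr s A (ireg s a) (ireg s b)
  | RConst d r => set_rreg s d r
  | ROfInt d a => set_rreg s d (ireg s a)%:~R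
  | RAdd d a b => set_rreg s d (rreg s a + rreg s b)
  | RSub d a b => set_rreg s d (rreg s a - rreg s b)
  | RMul d a b => set_rreg s d (rreg s a * rreg s b)
  | RDiv d a b => set_rreg s d (rreg s a / rreg s b)
  | RSqrt d a => set_rreg s d (Num.sqrt (rreg s a))
  | REval d a =>
      set_rreg s d (if 0 <= rreg s a <= 1 then f (rreg s a) else 0)
  | RLoad d A a => set_rreg s d (rarr s A (ireg s a))
  | RStore A a b => set_rarr s A (ireg s a) (rreg s b)
  end.

Definition holds (R : realType) (b : test) (s : state R) : bool :=
  match b with
  | ILe u v => ireg s u <= ireg s v
  | RLe u v => rreg s u <= rreg s v
  end.

(* exec f P s t s': started in s, P halts in s' after t steps, where every
   instruction and every test counts for one step. *)
Inductive exec (R : realType) (f : R -> R) :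
    program R -> state R -> nat -> state R -> Prop :=
| exec_instr i s : exec f (Instr i) s 1 (step f i s)
| exec_seq P Q s t s' u s'' :
    exec f P s t s' -> exec f Q s' u s'' -> exec f (Seq P Q) s (t + u) s''
| exec_if_true b P Q s t s' :
    holds b s -> exec f P s t s' -> exec f (If b P Q) s t.+1 s'
| exec_if_false b P Q s t s' :
    ~~ holds b s -> exec f Q s t s' -> exec f (If b P Q) s t.+1 s'
| exec_while_true b P s t s' u s'' :
    holds b s -> exec f P s t s' -> exec f (While b P) s' u s'' ->
    exec f (While b P) s (t + u).+1 s''
| exec_while_false b P s :
    ~~ holds b s -> exec f (While b P) s 1 s.

(* Matrices are stored by rows.  The predicates *_input below constrain only
   the cells that hold the input; all other cells have arbitrary contents, so
   a program cannot rely on initialised memory. *)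
Definition stored_mx (A : Type) (n m : nat) (a : int -> A) (x : 'M[A]_(n, m)) :
    Prop :=
  forall (i : 'I_n) (k : 'I_m), a (i * m + k)%N%:Z = x i k.

Definition stored_cv (A : Type) (n : nat) (a : int -> A) (v : 'cV[A]_n) : Prop :=
  forall i : 'I_n, a (i : nat)%:Z = v i 0.

Definition stored_rv (A : Type) (n : nat) (a : int -> A) (v : 'rV[A]_n) : Prop :=
  forall i : 'I_n, a (i : nat)%:Z = v 0 i.

Definition KDE_input (R : realType) (n m : nat) (eps : R)
    (x y : 'M[R]_(n, m)) (u : 'cV[R]_n) (s : state R) : Prop :=
  [/\ ireg s 0 = n%:Z, ireg s 1 = m%:Z & rreg s 0 = eps] /\
  [/\ stored_mx (rarr s 0) x, stored_mx (rarr s 1) y & stored_cv (rarr s 2) u].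

Definition KDE_solution (R : realType) (f : R -> R) (n m : nat) (eps : R)
    (x y : 'M[R]_(n, m)) (u v : 'cV[R]_n) : Prop :=
  linfnorm (v - kernel_mx f x y *m u) <= eps * l1norm u.

(* A single program handles all n, m and eps; the answer is left in real
   array 3. *)
Definition KDE_solvable_in (R : realType) (f : R -> R)
    (T : nat -> nat -> R -> R) : Prop :=
  exists P : program R,
    forall (n m : nat) (eps : R) (x y : 'M[R]_(n, m)) (u : 'cV[R]_n)
           (s : state R),
      (0 < n)%N -> (0 < m)%N -> 0 < eps ->
      (forall i j : 'I_n, sqnorm (row i x - row j y) <= 1) ->
      KDE_input eps x y u s ->
      exists (t : nat) (s' : state R) (v : 'cV[R]_n),
        [/\ exec f P s t s', t%:R <= T n m eps, stored_cv (rarr s' 3) v &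
            KDE_solution f eps x y u v].

(* c and alpha are parameters fixed for each input size, not part of the
   problem; they are tabulated in the memory of the machine. *)
Definition BCP_input (R : realType) (n m d : nat) (c : R) (alpha : 'rV[R]_d)
    (x y : 'M[int]_(n, m)) (s : state R) : Prop :=
  [/\ ireg s 0 = n%:Z, ireg s 1 = m%:Z & ireg s 2 = d%:Z] /\
  [/\ stored_mx (iarr s 0) x, stored_mx (iarr s 1) y, rreg s 0 = c &
      stored_rv (rarr s 0) alpha].

Definition BCP_solution (n m : nat) (x y : 'M[int]_(n, m)) (v : int) : Prop :=
  (exists i j : 'I_n, v = sqnorm (row i x - row j y)) /\
  (forall i j : 'I_n, v <= sqnorm (row i x - row j y)).

(* The answer is left in integer register 0.  The program is correct for every
   n; the time bound, being asymptotic, is for all large n. *)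
Definition BCP_solvable_in (R : realType) (f : R -> R) (m D : nat -> nat)
    (c : nat -> R) (alpha : forall n : nat, 'rV[R]_(D n)) (B : nat -> R) :
    Prop :=
  exists (P : program R) (n0 : nat),
    forall (n : nat) (x y : 'M[int]_(n, m n)) (s : state R),
      (0 < n)%N ->
      (forall i j : 'I_n, sqnorm (row i x - row j y) <= (D n)%:Z) ->
      BCP_input (c n) (alpha n) x y s ->
      exists (t : nat) (s' : state R),
        [/\ exec f P s t s', BCP_solution x y (ireg s' 0) &
            (n0 <= n)%N -> t%:R <= B n].

(* Main.v *)
Require Import Defs.
From mathcomp Require Import zify ring lra.
Import Order.TTheory GRing.Theory Num.Theory.
Import numFieldNormedType.Exports.
Set Implicit Arguments.
Unset Strict Implicit.
Unset Printing Implicit Defensive.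
Local Open Scope classical_set_scope.
Local Open Scope ring_scope.

(** Neither c nor the alpha_l need be nonnegative, so in general no embedding
    turns a squared distance d into c + alpha_l d.  Instead, the y-points are
    split by the parity of the distances, which for a fixed x is the parity of
    a quantity attached to y alone.  Within a parity class d is determined by
    its level q, i.e. d / 2 rounded up if D is even and down if D is odd, and q
    takes only K + 1 values with K = D / 2 rounded down.  The entries of row l
    of M, read at K + 1 consecutive positions in the direction in which
    c + alpha_l p increases, have the form b + |alpha_l| q, and one extra
    coordinate suffices to realise these values as squared distances.

    Each such test (l, r), with K starting positions r, gives a linear
    functional of the vector h of the numbers of y-points of level <= q.  The
    tests are stable: the quadratic form
      sum_(r, q) h_r h_q (g (K-1-r+q) - g (K-r+q))
    is a combination of test values of h for every row g of M, increasing or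
    decreasing, and equals sum_r h_r^2 when g is the indicator of p < K, which
    is a combination of the rows of M with coefficients of total size <= K tau.
    Hence max |h| <= K^2 tau max |test h|, and least squares recovers h with a
    loss polynomial in D = n^{o(1)}.  The loss is absorbed by calling KDE on
    2 D^3 blocks of at most n / D^3 points of y, since the error of KDE is
    proportional to the number of points.  If n < D^3, all pairs are tried. *)

(** * Programs and their cost *)

(** Only K counts per group are unknown: a level never exceeds K, so the count for q = K is the size
    of the group, which is known exactly. A block is selected by 0/1 weights u while all points stay
    in the KDE instance; its error is then eps times the size of the block. The constants: decoding
    loses a factor K^2 tau from stability and at most D from least squares over D K tests. With eps
    = 1/(3 n tau) and at most n/D^3 points in a block, the error is at most K^2 D / (3 D^3) <= 1/12,
    since 2K <= D. A true count is 0 or at least 1, so comparing its estimate with 1/2 decides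
    whether it vanishes; this matters because the machine cannot round. Blocks have length n/D^3
    rounded down, which is why 2 D^3 of them are needed to cover all y-points. The machine shapes
    the rest. The precision eps is an input of the KDE program, so tau, and with it the inverse of
    M, has to be computed exactly. The KDE program is arbitrary, so it is relocated to registers and
    arrays that the reduction does not use for its own data. *)

Section Programs.
Variables (R : realType) (f : R -> R).
Implicit Types (P Q : program R) (s : state R).

(** Syntactic over-approximations of the cells a program can change. On concrete programs they
    compute, so most frame conditions below are closed by [isT]. *)
Fixpoint iwr P (r : nat) : bool :=
  match P with
  | Instr (IConst d _) | Instr (IAdd d _ _) | Instr (ISub d _ _)
  | Instr (IMul d _ _) | Instr (ILoad d _ _) => r == d
  | Instr _ => false
  | Seq P Q | If _ P Q => iwr P r || iwr Q r
  | While _ P => iwr P r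
  end.

Fixpoint rwr P (r : nat) : bool :=
  match P with
  | Instr (RConst d _) | Instr (ROfInt d _) | Instr (RAdd d _ _)
  | Instr (RSub d _ _) | Instr (RMul d _ _) | Instr (RDiv d _ _)
  | Instr (RSqrt d _) | Instr (REval d _) | Instr (RLoad d _ _) => r == d
  | Instr _ => false
  | Seq P Q | If _ P Q => rwr P r || rwr Q r
  | While _ P => rwr P r
  end.

Fixpoint iawr P (A : nat) : bool :=
  match P with
  | Instr (IStore B _ _) => A == B
  | Instr _ => false
  | Seq P Q | If _ P Q => iawr P A || iawr Q A
  | While _ P => iawr P A
  end.

Fixpoint rawr P (A : nat) : bool :=
  match P with
  | Instr (RStore B _ _) => A == B
  | Instr _ => false
  | Seq P Q | If _ P Q => rawr P A || rawr Q A
  | While _ P => rawr P A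
  end.

Record agree P s s' : Prop := Agree {
  agree_ireg : forall r, ~~ iwr P r -> ireg s' r = ireg s r;
  agree_rreg : forall r, ~~ rwr P r -> rreg s' r = rreg s r;
  agree_iarr : forall A, ~~ iawr P A -> iarr s' A = iarr s A;
  agree_rarr : forall A, ~~ rawr P A -> rarr s' A = rarr s A }.

Lemma agree_refl P s : agree P s s.
Proof. by []. Qed.

Lemma agree_trans P s1 s2 s3 : agree P s1 s2 -> agree P s2 s3 -> agree P s1 s3.
Proof.
move=> [a b c d] [a' b' c' d']; split=> r h; first by rewrite a' ?a.
- by rewrite b' ?b.
- by rewrite c' ?c.
- by rewrite d' ?d.
Qed.

Lemma agree_sub P Q s s' :
  (forall r, iwr P r -> iwr Q r) -> (forall r, rwr P r -> rwr Q r) ->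
  (forall r, iawr P r -> iawr Q r) -> (forall r, rawr P r -> rawr Q r) ->
  agree P s s' -> agree Q s s'.
Proof.
move=> h1 h2 h3 h4 [a b c d]; split=> r h.
- by apply: a; apply: contra h; apply: h1.
- by apply: b; apply: contra h; apply: h2.
- by apply: c; apply: contra h; apply: h3.
- by apply: d; apply: contra h; apply: h4.
Qed.

Lemma agree_seql P Q s s' : agree P s s' -> agree (Seq P Q) s s'.
Proof. by apply: agree_sub => r /= ->. Qed.

Lemma agree_seqr P Q s s' : agree Q s s' -> agree (Seq P Q) s s'.
Proof. by apply: agree_sub => r /= ->; rewrite orbT. Qed.

Lemma exec_agree P s t s' : exec f P s t s' -> agree P s s'.
Proof.
elim=> {P s t s'}.
- by move=> i s; split=> r; case: i => //= *; rewrite /upd; case: ifP => // h; match goal with H : is_true (~~ _) |- _ => rewrite h in H end.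
- move=> P Q s t s' u s'' _ aP _ aQ.
  exact: agree_trans (agree_seql _ aP) (agree_seqr _ aQ).
- by move=> b P Q s t s' _ _; apply: agree_sub => r /= ->.
- by move=> b P Q s t s' _ _; apply: agree_sub => r /= ->; rewrite orbT.
- by move=> b P s t s' u s'' _ _ aP _; apply: agree_trans; apply: agree_sub aP.
- by move=> b P s _; apply: agree_refl.
Qed.

(** Total correctness with an upper bound on the number of steps, so that branches and loop rounds
    of unequal length compose. *)
Definition runs P s (t : nat) (Post : state R -> Prop) : Prop :=
  exists t' s', [/\ exec f P s t' s', (t' <= t)%N & Post s'].

Lemma runs_agree P s t (Post : state R -> Prop) :
  runs P s t Post -> runs P s t (fun s' => Post s' /\ agree P s s').
Proof.
move=> [t' [s' [ex le_t post]]]; exists t', s'; split=> //; split=> //.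
exact: exec_agree ex.
Qed.

Lemma runs_weaken P s t t' (Post Post' : state R -> Prop) :
  (t <= t')%N -> (forall s', agree P s s' -> Post s' -> Post' s') ->
  runs P s t Post -> runs P s t' Post'.
Proof.
move=> le_tt' imp /runs_agree[u [s' [ex le_ut [post ag]]]].
by exists u, s'; split=> //; [exact: leq_trans le_tt' | exact: imp].
Qed.

Lemma runs_seq P Q s t u (Post : state R -> Prop) :
  runs P s t (fun s' => runs Q s' u Post) -> runs (Seq P Q) s (t + u) Post.
Proof.
move=> [t' [s' [exP leP [u' [s'' [exQ leQ post]]]]]].
by exists (t' + u')%N, s''; split=> //; [apply: exec_seq exP exQ | apply: leq_add].
Qed.

Lemma runs_if b P Q s t (Post : state R -> Prop) :
  (holds b s -> runs P s t Post) -> (~~ holds b s -> runs Q s t Post) ->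
  runs (If b P Q) s t.+1 Post.
Proof.
move=> hP hQ; case: (boolP (holds b s)) => hb.
  have [t' [s' [ex le_t post]]] := hP hb.
  by exists t'.+1, s'; split=> //; apply: exec_if_true.
have [t' [s' [ex le_t post]]] := hQ hb.
by exists t'.+1, s'; split=> //; apply: exec_if_false.
Qed.

Definition blk (i : instr R) (l : seq (instr R)) : program R :=
  foldl (fun P j => Seq P (Instr j)) (Instr i) l.

Lemma runs_blk i l s t (Post : state R -> Prop) :
  (size l < t)%N ->
  Post (foldl (fun s' j => step f j s') (step f i s) l) -> runs (blk i l) s t Post.
Proof.
move=> lt_t post.
exists (size l).+1, (foldl (fun s' j => step f j s') (step f i s) l); split=> //.
have: exec f (Instr i) s 1 (step f i s) by constructor.
rewrite /blk -[(size l).+1]/(1 + size l)%N; move: {post lt_t}(Instr i) => P.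
move: 1%N (step f i s) => u s1.
elim: l P u s1 => [|j l IHl] P u s1 exP /=; first by rewrite addn0.
rewrite addnS -addSn; apply: IHl; rewrite -addn1.
by apply: exec_seq exP _; constructor.
Qed.

(* The limit is kept in the register v + 1 because tests are non-strict
   comparisons of registers. *)
Definition For (v N : nat) (body : program R) : program R :=
  Seq (blk (IConst R v.+2 1) [:: ISub R v.+1 N v.+2; IConst R v 0])
      (While (ILe v v.+1)
         (Seq body (blk (IConst R v.+2 1) [:: IAdd R v v v.+2]))).

(** The loop bookkeeping touches [v], [v + 1] and [v + 2], to which [Inv] must be insensitive. The
    body also receives [agree] with the initial state, so [Inv] need only speak of what the loop
    changes. *)
Lemma runs_for v N body (n T : nat) s (Inv : nat -> state R -> Prop) :
  N != v.+2 -> ireg s N = n%:Z -> ~~ iwr body v -> ~~ iwr body v.+1 ->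
  (forall k s' r x, (v <= r <= v.+2)%N -> Inv k s' -> Inv k (set_ireg s' r x)) ->
  Inv 0%N s ->
  (forall k s', (k < n)%N -> Inv k s' -> agree (For v N body) s s' ->
     ireg s' v = k%:Z -> runs body s' T (Inv k.+1)) ->
  runs (For v N body) s (4 + n * (T + 3)) (Inv n).
Proof.
move=> NNv sN wv wv1 stab inv0 step_inv.
have -> : (4 + n * (T + 3) = 3 + (1 + n * (T + 3)))%N by [].
have neqS a : (a.+1 == a) = false by rewrite gtn_eqF.
have neqSS a : (a == a.+2) = false by rewrite ltn_eqF // ltnW.
apply/runs_seq/(runs_weaken (leqnn _) _ (runs_blk (t := 3) (Post := fun s' =>
   [/\ ireg s' v = 0%:Z, ireg s' v.+1 = n%:Z - 1 & Inv 0%N s']) _ _)) => //.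
  2: { rewrite /= /upd /= !eqxx (negPf NNv) neqS sN .
       by split=> //; do 3!(apply: (stab); first lia). }
move=> s1 /(agree_seql (While (ILe v v.+1)
         (Seq body (blk (IConst R v.+2 1) [:: IAdd R v v v.+2])))).
rewrite -/(For v N body) => ag1 [s1v s1v1 inv1].
(* Induction on the number [j] of rounds left. Each costs the body, one test and two instructions;
   the final 1 is the failing test. *)
have loop j k s2 : (k <= n)%N -> j = (n - k)%N -> agree (For v N body) s s2 ->
    ireg s2 v.+1 = n%:Z - 1 -> ireg s2 v = k%:Z -> Inv k s2 ->
    runs (While (ILe v v.+1) (Seq body (blk (IConst R v.+2 1) [:: IAdd R v v v.+2])))
      s2 (1 + j * (T + 3)) (Inv n); last first.
  by apply: (loop n 0%N) => //; rewrite subn0.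
move=> {s1 ag1 s1v s1v1 inv1}; move: s2 => s1.
elim: j k s1 => [|j IHj] k s1 le_kn def_j ag1 s1v1 s1v inv1.
  have def_k : k = n by apply/eqP; rewrite eqn_leq le_kn -subn_eq0 -def_j.
  exists 1%N, s1; split=> //; last by rewrite -def_k.
  by apply: exec_while_false; rewrite /= s1v s1v1 def_k -ltNge ltrBlDr ltrDl.
have lt_kn : (k < n)%N by rewrite -subn_gt0 -def_j.
have [t [s2 [ex2 le2 inv2]]] := step_inv _ _ lt_kn inv1 ag1 s1v.
have ag2 := exec_agree ex2.
pose B := blk (IConst R v.+2 1) [:: IAdd R v v v.+2].
have [t' [s3 [ex3 le3 [[s3v s3v1 inv3] ag3]]]] : runs B s2 2 (fun s' =>
   [/\ ireg s' v = k.+1%:Z, ireg s' v.+1 = n%:Z - 1 & Inv k.+1 s'] /\ agree B s2 s').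
  apply/runs_agree/runs_blk => //.
  rewrite /= /upd /= !eqxx neqSS neqS [v.+1 == v.+2]ltn_eqF //.
  rewrite (agree_ireg ag2) // (agree_ireg ag2) // s1v s1v1; split=> //.
    by rewrite -addn1 PoszD.
  by do 2!(apply: (stab); first lia).
have ag13 : agree (For v N body) s s3.
  apply: agree_trans ag1 _; apply: agree_seqr; apply: (agree_sub (P := Seq body B)) => //.
  exact: agree_trans (agree_seql _ ag2) (agree_seqr _ ag3).
have [u [s4 [ex4 le4 inv4]]] := IHj k.+1 s3 lt_kn
   (etrans (congr1 predn def_j) (esym (subnS n k))) ag13 s3v1 s3v inv3.
exists (t + t' + u).+1, s4; split=> //.
  apply: exec_while_true (exec_seq ex2 ex3) ex4.
  by rewrite /= s1v s1v1 lerBrDr -PoszD lez_nat addn1.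
by rewrite mulSn; lia.
Qed.

(** Relocation by [k]: a shifted program leaves everything numbered below [k] intact, whatever it
    does, and takes the same number of steps. *)
Definition shift_instr (k : nat) (i : instr R) : instr R :=
  match i with
  | IConst d z => IConst R (k + d) z
  | IAdd d a b => IAdd R (k + d) (k + a) (k + b)
  | ISub d a b => ISub R (k + d) (k + a) (k + b)
  | IMul d a b => IMul R (k + d) (k + a) (k + b)
  | ILoad d A a => ILoad R (k + d) (k + A) (k + a)
  | IStore A a b => IStore R (k + A) (k + a) (k + b)
  | RConst d r => RConst (k + d) r
  | ROfInt d a => ROfInt R (k + d) (k + a)
  | RAdd d a b => RAdd R (k + d) (k + a) (k + b)
  | RSub d a b => RSub R (k + d) (k + a) (k + b)
  | RMul d a b => RMul R (k + d) (k + a) (k + b)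
  | RDiv d a b => RDiv R (k + d) (k + a) (k + b)
  | RSqrt d a => RSqrt R (k + d) (k + a)
  | REval d a => REval R (k + d) (k + a)
  | RLoad d A a => RLoad R (k + d) (k + A) (k + a)
  | RStore A a b => RStore R (k + A) (k + a) (k + b)
  end.

Definition shift_test (k : nat) (b : test) : test :=
  match b with
  | ILe u v => ILe (k + u) (k + v)
  | RLe u v => RLe (k + u) (k + v)
  end.

Fixpoint shift_prog (k : nat) P : program R :=
  match P with
  | Instr i => Instr (shift_instr k i)
  | Seq P Q => Seq (shift_prog k P) (shift_prog k Q)
  | If b P Q => If (shift_test k b) (shift_prog k P) (shift_prog k Q)
  | While b P => While (shift_test k b) (shift_prog k P)
  end.

Definition window (k : nat) s : state R :=
  State (fun r => ireg s (k + r)%N) (fun r => rreg s (k + r)%N)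
        (fun A => iarr s (k + A)%N) (fun A => rarr s (k + A)%N).

Lemma shift_writes k P r : (r < k)%N ->
  [/\ iwr (shift_prog k P) r = false, rwr (shift_prog k P) r = false,
      iawr (shift_prog k P) r = false & rawr (shift_prog k P) r = false].
Proof.
move=> lt_rk; elim: P => [i|P [a b c d] Q [a' b' c' d']|t P [a b c d] Q [a' b' c' d']|//].
- have h d : (r == k + d)%N = false by rewrite ltn_eqF // ltn_addr.
  by case: i => *; split=> //=; apply: h.
- by rewrite /= a b c d.
- by rewrite /= a b c d.
Qed.

Lemma window_step k i s :
  window k (step f (shift_instr k i) s) = step f i (window k s).
Proof.
have eqD (B : Type) (g : nat -> B) d b :
    (fun r => upd g (k + d)%N b (k + r)%N) = upd (fun r => g (k + r)%N) d b.
  by apply/funext => r; rewrite /upd eqn_add2l.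
by case: i => *; rewrite /window /= /set_ireg /set_rreg /set_iarr /set_rarr /= eqD.
Qed.

Lemma exec_shift k P s0 t s1 : exec f P s0 t s1 ->
  forall s, window k s = s0 ->
  exists2 s', exec f (shift_prog k P) s t s' & window k s' = s1.
Proof.
have shift_holds b s : holds (shift_test k b) s = holds b (window k s) by case: b.
elim=> {P s0 t s1}.
- move=> i s s' <-; exists (step f (shift_instr k i) s'); first by constructor.
  exact: window_step.
- move=> P Q s t s' u s'' _ IHP _ IHQ s1 /IHP[s2 ex2 /IHQ[s3 ex3 <-]].
  by exists s3 => //; apply: exec_seq ex2 ex3.
- move=> b P Q s t s' hb _ IHP s1 def_s1; have [s2 ex2 <-] := IHP _ def_s1.
  by exists s2 => //; apply: exec_if_true; rewrite // shift_holds def_s1.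
- move=> b P Q s t s' hb _ IHP s1 def_s1; have [s2 ex2 <-] := IHP _ def_s1.
  by exists s2 => //; apply: exec_if_false; rewrite // shift_holds def_s1.
- move=> b P s t s' u s'' hb _ IHP _ IHW s1 def_s1.
  have [s2 ex2 /IHW[s3 ex3 <-]] := IHP _ def_s1.
  by exists s3 => //; apply: exec_while_true ex2 ex3; rewrite shift_holds def_s1.
- move=> b P s hb s1 def_s1; exists s1 => //.
  by apply: exec_while_false; rewrite shift_holds def_s1.
Qed.

End Programs.

Lemma updE (A : eqType) (B : Type) (g : A -> B) a b a' :
  upd g a b a' = if a' == a then b else g a'.
Proof. by []. Qed.

Lemma upd2E (A : eqType) (B C : Type) (g : A -> B -> C) a b a' z :
  upd g a b a' z = if a' == a then b z else g a' z.
Proof. by rewrite /upd; case: ifP. Qed.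

Notation fI ag r := (agree_ireg ag (r := r) isT).
Notation fR ag r := (agree_rreg ag (r := r) isT).
Notation fIA ag A := (agree_iarr ag (A := A) isT).
Notation fRA ag A := (agree_rarr ag (A := A) isT).

(** * Filling an array and inner products *)

Section Routines.
Variables (R : realType) (f : R -> R).
Implicit Types (P Q : program R) (s : state R).
Local Notation runs := (@runs R f).

Definition Fill (A na nb : nat) (body : program R) : program R :=
  For 20 na (Seq (blk (IMul R 27 20 nb) [::])
    (For 24 nb (Seq body (blk (IAdd R 28 27 24) [:: RStore R A 28 20])))).

(** The body may assume that the cell it computes still has its initial content. This allows updates
    in place, used for the inverse and for accumulating estimates. *)
Lemma runs_fill (A na nb : nat) body (a b T : nat) s (F : nat -> nat -> R) :
  ireg s na = a%:Z -> ireg s nb = b%:Z -> na != 22%N ->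
  ~~ iwr (Fill A na nb body) nb ->
  [&& ~~ iwr body 20, ~~ iwr body 21, ~~ iwr body 24, ~~ iwr body 25,
      ~~ iwr body 27 & ~~ rawr body A] ->
  (forall (i j : nat) s', (i < a)%N -> (j < b)%N ->
     agree (Fill A na nb body) s s' -> ireg s' 20 = i%:Z -> ireg s' 24 = j%:Z ->
     rarr s' A (i * b + j)%N%:Z = rarr s A (i * b + j)%N%:Z ->
     runs body s' T (fun s'' => rreg s'' 20 = F i j)) ->
  runs (Fill A na nb body) s (4 + a * (b * (T + 5) + 8)) (fun s' =>
    forall i j : nat, (i < a)%N -> (j < b)%N ->
      rarr s' A (i * b + j)%N%:Z = F i j).
Proof.
move=> s_na s_nb na22 w_nb /and5P[w20 w21 w24 w25 /andP[w27 wA]] body_ok.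
pose F' z := F (z %/ b)%N (z %% b)%N.
have F'E i j : (j < b)%N -> F' (i * b + j)%N = F i j.
  by move=> jb; rewrite /F' modnMDl modn_small // divnMDl ?divn_small ?addn0 //; lia.
(* Both loops share this invariant on flat addresses, so the end of a row is no special case. *)
pose In k s' := forall z : nat, (z < a * b)%N ->
  rarr s' A z%:Z = if (z < k)%N then F' z else rarr s A z%:Z.
have lt_addr i j : (i < a)%N -> (j < b)%N -> (i * b + j < a * b)%N by move=> *; nia.
apply: (@runs_weaken _ _ _ _ (4 + a * ((1 + (4 + b * ((T + 2) + 3))) + 3)) _
   (fun s' => In (a * b)%N s')); first by nia.
  by move=> s' _ h i j ia jb; rewrite h ?lt_addr // F'E.
apply: (runs_for (Inv := fun k => In (k * b)%N)) => //.
- by rewrite /= !negb_or w20 /=.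
- by rewrite /= !negb_or w21 /=.
- move=> i s1 ia in1 ag1 s1_20.
  apply/runs_seq/runs_blk => //=.
  set s2 := set_ireg _ _ _.
  have s2_27 : ireg s2 27 = (i * b)%N%:Z.
    by rewrite /= /upd /= s1_20 (agree_ireg ag1) // s_nb.
  have ag2 : agree (Fill A na nb body) s1 s2.
    apply: agree_seqr; apply: (agree_sub (P := blk (IMul R 27 20 nb) [::])) => //.
      by move=> r /= /eqP->.
    exact: (exec_agree (exec_instr f _ s1)).
  have ag02 := agree_trans ag1 ag2.
  have -> : (i.+1 * b = i * b + b)%N by rewrite mulSn addnC.
  apply: (runs_for (Inv := fun k => In (i * b + k)%N)) => //.
  + by apply: contra w_nb => /eqP->; rewrite /= ?orbT.
  + by rewrite (agree_ireg ag02).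
  + by rewrite /= !negb_or w24.
  + by rewrite /= !negb_or w25.
  + by rewrite addn0.
  move=> j s3 jb in3 ag3 s3_24.
  have ag23 : agree (Fill A na nb body) s2 s3.
    apply: agree_seqr; apply: (agree_sub _ _ _ _ ag3) => r h; apply/orP; left;
      by apply/orP; right.
  have ag03 := agree_trans ag02 ag23.
  have s3_20 : ireg s3 20 = i.
    rewrite (agree_ireg ag3); first by rewrite /= /upd /= s1_20.
    by rewrite /= !negb_or w20.
  apply: runs_seq; apply: runs_weaken (body_ok i j s3 ia jb ag03 s3_20 s3_24 _) => //.
    2: by rewrite in3 ?lt_addr // ltnn.
  move=> s4 ag4 s4_20; apply: runs_blk => //= z zab.
  have s4_24 : ireg s4 24 = j by rewrite (agree_ireg ag4).
  have s4_27 : ireg s4 27 = (i * b)%N%:Z.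
    rewrite (agree_ireg ag4) // (agree_ireg ag3) //.
    by rewrite /= !negb_or w27.
  rewrite /= upd2E eqxx updE s4_24 s4_27 -PoszD eqz_nat addnS ltnS leq_eqVlt.
  case: eqP => [->|_] /=; first by rewrite s4_20 F'E.
  by rewrite (agree_rarr ag4) // in3.
Qed.

(** Offsets and strides are taken from registers 40 to 43, so that one routine reads rows, columns
    and transposes. *)
Definition Dot (A B : nat) : program R :=
  Seq (blk (RConst 40 0) [::])
    (For 45 44 (blk (IMul R 48 45 41) [:: IAdd R 48 48 40; RLoad R 41 A 48;
       IMul R 48 45 43; IAdd R 48 48 42; RLoad R 42 B 48; RMul R 41 41 42;
       RAdd R 40 40 41])).

Lemma runs_dot (A B a0 sa b0 sb K : nat) s :
  ireg s 40 = a0%:Z -> ireg s 41 = sa%:Z -> ireg s 42 = b0%:Z ->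
  ireg s 43 = sb%:Z -> ireg s 44 = K%:Z ->
  runs (Dot A B) s (11 * K + 5) (fun s' => rreg s' 40 =
    \sum_(k < K) rarr s A (a0 + k * sa)%N%:Z * rarr s B (b0 + k * sb)%N%:Z).
Proof.
move=> s40 s41 s42 s43 s44.
rewrite (_ : (11 * K + 5 = 1 + (4 + K * (8 + 3)))%N); last by lia.
apply/runs_seq/runs_blk => //=.
apply: (runs_for (Inv := fun k s' => rreg s' 40 = \sum_(i < k)
  rarr s A (a0 + i * sa)%N%:Z * rarr s B (b0 + i * sb)%N%:Z)) => //.
  by rewrite big_ord0.
move=> k s1 kK in1 ag1 s1_45; apply: runs_blk => //=.
have e40 : ireg s1 40 = a0 := etrans (fI ag1 40) s40.
have e41 : ireg s1 41 = sa := etrans (fI ag1 41) s41.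
have e42 : ireg s1 42 = b0 := etrans (fI ag1 42) s42.
have e43 : ireg s1 43 = sb := etrans (fI ag1 43) s43.
have eA : rarr s1 A = rarr s A := fRA ag1 A.
have eB : rarr s1 B = rarr s B := fRA ag1 B.
rewrite !updE /= in1 big_ord_recr /= eA eB e40 e41 e42 e43 s1_45.
by rewrite -!PoszM -!PoszD ![(_ + (k * _)%N)%N]addnC.
Qed.

End Routines.

(** * Inverse of a matrix by row corrections *)

Section RowActionInverse.
Variables (R : realType) (d : nat) (M : 'M[R]_d).
Hypothesis M_unit : M \in unitmx.

(* One step of the row-action method: X is corrected so that it satisfies the
   i-th row of M X = 1 without spoiling the earlier ones.  No pivoting is
   needed, since the residual 1 - X M stays an orthogonal projection. *)
Definition inv_step (X : 'M[R]_d) (i : 'I_d) : 'M[R]_d :=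
  let r := row i M in
  let p := r^T - X *m (M *m r^T) in
  let w := ((r *m p) 0 0)^-1 *: (delta_mx 0 i - r *m X) in
  X + p *m w.

(** The vanishing columns say that [X M] is built from the first [k] rows of [M] only; this is what
    keeps the next denominator nonzero. *)
Definition inv_invariant (k : nat) (X : 'M[R]_d) : Prop :=
  let H := 1%:M - X *m M in
  [/\ H^T = H, H *m H = H, (forall j : 'I_d, (j < k)%N -> row j M *m H = 0) &
      forall j : 'I_d, (k <= j)%N -> col j X = 0].

Lemma inv_invariant0 : inv_invariant 0 0.
Proof.
rewrite /inv_invariant mul0mx subr0; split=> // [||j _].
- by rewrite tr_scalar_mx.
- by rewrite mulmx1.
- by apply/matrixP => a b; rewrite !mxE.
Qed.

Lemma row_mul_self_eq0 (v : 'cV[R]_d) : (v^T *m v) 0 0 = 0 -> v = 0.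
Proof.
rewrite mxE => /eqP; rewrite psumr_eq0 => [/allP h|j _]; last first.
  by rewrite mxE -expr2 sqr_ge0.
apply/matrixP => a b; rewrite ord1 mxE; apply/eqP.
by have := h a (mem_index_enum _); rewrite mxE -expr2 sqrf_eq0.
Qed.

Lemma inv_invariantS (X : 'M[R]_d) (i : 'I_d) :
  inv_invariant i X -> inv_invariant i.+1 (inv_step X i).
Proof.
rewrite /inv_invariant /inv_step; set H := 1%:M - X *m M.
set r := row i M => -[Hsym Hid Hrow Xcol].
have -> : r^T - X *m (M *m r^T) = H *m r^T.
  by rewrite mulmxA mulmxBl mul1mx.
set p := H *m r^T; set den := (r *m p) 0 0; set w := _ *: _.
have pT : p^T = r *m H by rewrite trmx_mul trmxK Hsym.
have Hp : H *m p = p by rewrite mulmxA Hid.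
have pp : p^T *m p = r *m p by rewrite pT -mulmxA Hp.
(* Otherwise [p = 0], so [r H = 0] and [r = r X M]. Cancelling [M] gives [delta_mx 0 i = r X], which
   is impossible since column [i] of [X] is zero. *)
have den_neq0 : den != 0.
  apply/eqP => den0; have p0 : p = 0 by apply: row_mul_self_eq0; rewrite pp.
  have : r *m H = 0 by rewrite -pT p0 trmx0.
  rewrite mulmxBr mulmx1 mulmxA => /eqP; rewrite subr_eq0 => /eqP rX.
  have /rowP/(_ i) : delta_mx 0 i = r *m X.
    apply: (can_inj (mulmxK M_unit)).
    by rewrite -rX -rowE.
  rewrite !mxE !eqxx big1 => [/eqP|j _]; first by rewrite oner_eq0.
  have /colP/(_ j) := Xcol i (leqnn i).
  by rewrite !mxE => ->; rewrite mulr0.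
have den_mx : r *m p = den%:M by rewrite [LHS]mx11_scalar.
have wM : w *m M = den^-1 *: p^T.
  rewrite -scalemxAl mulmxBl -rowE -/r pT mulmxBr mulmx1.
  by rewrite mulmxA.
have -> : 1%:M - (X + p *m w) *m M = H - den^-1 *: (p *m p^T).
  by rewrite mulmxDl -mulmxA wM -scalemxAr opprD addrA.
clearbody H.
split.
- by rewrite linearB /= linearZ /= trmx_mul trmxK Hsym.
- have E1 : H *m (p *m p^T) = p *m p^T by rewrite mulmxA Hp.
  have E2 : p *m p^T *m H = p *m p^T by rewrite -mulmxA pT -[r *m H *m H]mulmxA Hid.
  have E3 : p *m p^T *m (p *m p^T) = den *: (p *m p^T).
    by rewrite mulmxA -[p *m p^T *m p]mulmxA pp den_mx mul_mx_scalar -scalemxAl.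
  rewrite mulmxBl !mulmxBr Hid -!scalemxAr -!scalemxAl E1 E2 E3.
  by rewrite [_ *: (den *: _)]scalerA mulVf // scale1r subrr subr0.
- move=> j; rewrite ltnS leq_eqVlt => /orP[/eqP/val_inj->|ltji].
    rewrite mulmxBr -/r -pT -scalemxAr mulmxA den_mx mul_scalar_mx.
    by rewrite scalerA mulVf // scale1r subrr.
  rewrite mulmxBr Hrow // -scalemxAr mulmxA [row j M *m p]mulmxA Hrow //.
  by rewrite !mul0mx scaler0 subr0.
- move=> j ltij; have Xj := Xcol j (ltnW ltij).
  have wj : w 0 j = 0.
    rewrite !mxE eqxx (_ : (j == i) = false) /=; last first.
      by apply/eqP => ji; rewrite ji ltnn in ltij.
    rewrite big1 ?subr0 ?mulr0 // => l _.
    by have /colP/(_ l) := Xj; rewrite !mxE => ->; rewrite mulr0.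
  apply/colP => a; have /colP/(_ a) := Xj; rewrite !mxE => ->; rewrite add0r.
  by rewrite big1 // => l _; rewrite ord1 wj mulr0.
Qed.

Lemma inv_invariant_end (X : 'M[R]_d) : inv_invariant d X -> X = invmx M.
Proof.
move=> [_ _ Hrow _]; apply: (can_inj (mulmxK M_unit)); rewrite mulVmx //.
apply/esym/eqP; rewrite -subr_eq0; apply/eqP.
apply: (can_inj (mulKmx M_unit)); rewrite mulmx0.
by apply/row_matrixP => j; rewrite row_mul Hrow // row0.
Qed.

End RowActionInverse.

(** * The quantity tau as a largest row sum *)

Section Tau.
Variables (R : realType) (d : nat).

Lemma linfnorm_ge (v : 'cV[R]_d) (i : 'I_d) : `|v i 0| <= linfnorm v.
Proof. exact: (le_bigmax _ (fun i => `|v i 0|) i). Qed.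

Lemma linfnorm_ge0 (v : 'cV[R]_d) : 0 <= linfnorm v.
Proof. exact: bigmax_ge_id. Qed.

Lemma linfnorm_le (v : 'cV[R]_d) (x : R) :
  0 <= x -> (forall i, `|v i 0| <= x) -> linfnorm v <= x.
Proof. by move=> x0 h; apply: bigmax_le. Qed.

Lemma linfnorm_gt0 (v : 'cV[R]_d) : v != 0 -> 0 < linfnorm v.
Proof.
move=> v0; rewrite lt0r linfnorm_ge0 andbT; apply: contra v0 => /eqP h.
apply/eqP/colP => i; rewrite mxE; apply/eqP; rewrite -normr_le0 -h.
exact: linfnorm_ge.
Qed.

Definition row_l1 (M : 'M[R]_d) (i : 'I_d) : R := \sum_(j < d) `|invmx M i j|.

Lemma row_l1_ge0 (M : 'M[R]_d) i : 0 <= row_l1 M i.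
Proof. by apply: sumr_ge0 => j _. Qed.

Lemma tauE (M : 'M[R]_d) : (0 < d)%N ->
  tau M = \big[Num.max/0]_(i < d) row_l1 M i.
Proof.
move=> d0; set rho := \big[_/_]_(_ < _) _; rewrite /tau.
set S := [set _ | _ in _].
have rho0 : 0 <= rho by apply: bigmax_ge_id.
have ubS : ubound S rho.
  move=> _ [b /linfnorm_gt0 b0 <-]; rewrite ler_pdivrMr //.
  apply: linfnorm_le => [|i]; first by rewrite mulr_ge0 // ltW.
  apply: le_trans (_ : row_l1 M i * linfnorm b <= _).
    rewrite mxE (le_trans (ler_norm_sum _ _ _)) // mulr_suml ler_sum // => j _.
    by rewrite normrM ler_wpM2l // linfnorm_ge.
  rewrite ler_wpM2r //; first exact: ltW.
  exact: (le_bigmax _ (row_l1 M) i).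
have [i0 rhoE] : exists i0, rho = row_l1 M i0.
  have [i _ h] := @eq_bigmax _ _ _ 0 (Ordinal d0) xpredT (row_l1 M) isT
     (fun i _ => row_l1_ge0 M i).
  by exists i.
(* The sign vector of the row with the largest sum attains the supremum. *)
pose b : 'cV[R]_d := \col_j (if 0 <= invmx M i0 j then 1 else -1).
have b0 : b != 0.
  apply/eqP => /colP/(_ i0)/eqP; rewrite !mxE; case: ifP => _.
    by rewrite oner_eq0.
  by rewrite oppr_eq0 oner_eq0.
have nb : linfnorm b <= 1.
  apply: linfnorm_le => // j; rewrite mxE; case: ifP => _; rewrite ?normrN normr1 //.
have Sb : S (linfnorm (invmx M *m b) / linfnorm b) by exists b.
apply/eqP; rewrite eq_le ge_sup //=; last by eexists; exact: Sb.
apply: le_trans (ub_le_sup _ Sb); last by exists rho.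
rewrite ler_pdivlMr ?linfnorm_gt0 //.
apply: le_trans (_ : rho <= _); first by rewrite ler_piMr.
apply: le_trans (linfnorm_ge _ i0); rewrite rhoE mxE.
rewrite (_ : \sum_j _ = row_l1 M i0) ?ler_norm //.
apply: eq_bigr => j _; rewrite mxE; case: ifP => h.
  by rewrite mulr1 ger0_norm.
by rewrite mulrN1 ltr0_norm // ltNge h.
Qed.

Lemma row_l1_le_tau (M : 'M[R]_d) i : row_l1 M i <= tau M.
Proof.
have d0 : (0 < d)%N by apply: leq_trans (ltn_ord i).
by rewrite tauE //; apply: (le_bigmax _ (row_l1 M) i).
Qed.

Lemma tau_gt0 (M : 'M[R]_d) : (0 < d)%N -> M \in unitmx -> 0 < tau M.
Proof.
move=> d0 uM; pose i := Ordinal d0; apply: lt_le_trans (row_l1_le_tau M i).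
rewrite lt0r row_l1_ge0 andbT; apply/eqP => /eqP.
rewrite psumr_eq0 // => /allP h.
have /rowP/(_ i) : row i (invmx M) *m M = delta_mx 0 i.
  by rewrite -row_mul mulVmx // row1.
rewrite !mxE !eqxx big1 => [/eqP|j _]; first by rewrite eq_sym oner_eq0.
by have := h j (mem_index_enum _); rewrite normr_eq0 !mxE => /eqP->; rewrite mul0r.
Qed.

End Tau.

(** * Stability of the family of tests *)

Section Stability.
Variables (R : realType) (D K o : nat) (M : 'M[R]_D) (F : 'I_D -> nat -> R).
Variables (up : 'I_D -> bool).
Hypothesis M_unit : M \in unitmx.
Hypothesis oKD : (o + 2 * K <= D)%N.
Hypothesis F_M : forall l (j : 'I_D), (o <= j < o + 2 * K)%N -> M l j = F l (j - o)%N.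

(** The value at level [q] minus the value at level [q + 1], levels being read upwards or downwards
    along the row. After summation by parts this is the coefficient of the number of points of level
    at most [q]. *)
Definition test_entry (l : 'I_D) (r q : nat) : R :=
  if up l then F l (r + q)%N - F l (r + q).+1
  else F l (r + K - q)%N - F l (r + K - q).-1.

Lemma test_stability (h : nat -> R) (delta : R) :
  (forall l (r : nat), (r < K)%N ->
     `|\sum_(q < K) test_entry l r q * h q| <= delta) ->
  forall q : nat, (q < K)%N -> `|h q| <= K%:R ^+ 2 * tau M * delta.
Proof.
move=> small q qK; have D0 : (0 < D)%N by lia.
have delta0 : 0 <= delta by apply: le_trans (small (Ordinal D0) q qK).
have tau0 : 0 < tau M by apply: tau_gt0.
have phiP (p : 'I_K) : (o + p < D)%N by have := ltn_ord p; lia.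
pose phi (p : 'I_K) : 'I_D := Ordinal (phiP p).
(* [lam M] is the indicator of the first [K] positions of the window, and each summand has absolute
   sum at most [tau M]. *)
pose lam : 'rV[R]_D := \sum_(p < K) row (phi p) (invmx M).
have lamF (p : nat) : (p < 2 * K)%N -> \sum_l lam 0 l * F l p = (p < K)%:R.
  move=> pK; have jP : (o + p < D)%N by lia.
  pose j : 'I_D := Ordinal jP.
  have -> : \sum_l lam 0 l * F l p = (lam *m M) 0 j.
    rewrite mxE; apply: eq_bigr => l _; rewrite F_M /=; last by lia.
    by rewrite addKn.
  rewrite mulmx_suml summxE.
  under eq_bigr => x _ do rewrite -row_mul mulVmx // !mxE.
  have [ltpK|leKp] := ltnP p K.
    rewrite (bigD1 (Ordinal ltpK)) //= [X in X + _](_ : _ = 1); last first.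
      by rewrite (_ : _ == _ = true) //; apply/eqP/val_inj.
    rewrite big1 ?addr0 // => x /eqP xp; rewrite (_ : _ == _ = false) //.
    by apply/eqP => /(congr1 val) /= /addnI e; apply: xp; apply: val_inj.
  rewrite big1 // => x _; rewrite (_ : _ == _ = false) //.
  by apply/eqP => /(congr1 val) /= /addnI e; have := ltn_ord x; lia.
have lam1 : \sum_l `|lam 0 l| <= K%:R * tau M.
  apply: le_trans (_ : \sum_l \sum_(p < K) `|invmx M (phi p) l| <= _).
    apply: ler_sum => l _; rewrite summxE (le_trans (ler_norm_sum _ _ _)) //.
    by apply: ler_sum => p _; rewrite mxE.
  rewrite exchange_big /= mulr_natl -[K in X in _ <= X]card_ord -sumr_const.
  by apply: ler_sum => p _; apply: row_l1_le_tau.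
pose S (g : nat -> R) := \sum_(r < K) \sum_(t < K)
   h r * h t * (g (K.-1 - r + t)%N - g (K - r + t)%N).
have [q0 q0max] : exists q0 : 'I_K, forall t : 'I_K, `|h t| <= `|h q0|.
  case: (arg_maxP (fun t : 'I_K => `|h t|) (isT : xpredT (Ordinal qK))) => q0 _ mx.
  by exists q0 => t; apply: mx.
suff : `|h q0| <= K%:R ^+ 2 * tau M * delta.
  by apply: le_trans; apply: (q0max (Ordinal qK)).
have sumh : \sum_(r < K) `|h r| <= K%:R * `|h q0|.
  rewrite (_ : K%:R * _ = \sum_(t < K) `|h q0|); first exact: ler_sum.
  by rewrite sumr_const card_ord mulr_natl.
have S_F l : `|S (F l)| <= K%:R * `|h q0| * delta.
  apply: le_trans (_ : (\sum_(r < K) `|h r|) * delta <= _); last first.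
    by rewrite ler_wpM2r.
  rewrite mulr_suml; case ul : (up l).
    apply: le_trans (ler_norm_sum _ _ _) _; apply: ler_sum => r _.
    under eq_bigr => t _ do rewrite -mulrA.
    rewrite -mulr_sumr normrM ler_wpM2l //.
    have rK := ltn_ord r.
    have kr : (K.-1 - r < K)%N by lia.
    apply: le_trans (small l _ kr); rewrite le_eqVlt; apply/orP; left; apply/eqP.
    congr (`|_|); apply: eq_bigr => t _; rewrite /test_entry ul mulrC.
    by congr ((_ - F l _) * _); lia.
  (* For a decreasing row the two indices exchange roles: with the second one fixed, the sum over
     the first is minus a test value. *)
  rewrite /S exchange_big /=.
  apply: le_trans (ler_norm_sum _ _ _) _; apply: ler_sum => r _.
  rewrite [X in `|X|](_ : _ = - (h r * \sum_(t < K) test_entry l r t * h t)).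
    by rewrite normrN normrM ler_wpM2l // small.
  rewrite mulr_sumr -sumrN; apply: eq_bigr => t _; rewrite /test_entry ul.
  have tK := ltn_ord t.
  have -> : (K.-1 - t + r = (r + K - t).-1)%N by lia.
  have -> : (K - t + r = r + K - t)%N by lia.
  by ring.
(* The first indicator holds when [t <= r] and the second when [t < r], so only [t = r]
   contributes. *)
have S_ind : S (fun p => (p < K)%:R) = \sum_(r < K) h r ^+ 2.
  apply: eq_bigr => r _; have rK := ltn_ord r.
  rewrite (bigD1 r) //= big1 ?addr0 => [|t /eqP tr].
    have -> : (K.-1 - r + r < K)%N by lia.
    have -> : (K - r + r < K)%N = false by lia.
    by rewrite subr0 mulr1 expr2.
  have -> : (K.-1 - r + t < K)%N = (K - r + t < K)%N.
    have : t <> r :> nat by move=> e; apply: tr; apply: val_inj.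
    by lia.
  by rewrite subrr mulr0.
have S_lam : S (fun p => (p < K)%:R) = \sum_l lam 0 l * S (F l).
  rewrite /S; under [RHS]eq_bigr => l _ do rewrite mulr_sumr.
  rewrite [RHS]exchange_big /=; apply: eq_bigr => r _.
  under [RHS]eq_bigr => l _ do rewrite mulr_sumr.
  rewrite [RHS]exchange_big /=; apply: eq_bigr => t _.
  have rK := ltn_ord r; have tK := ltn_ord t.
  rewrite -!lamF; [|lia|lia].
  rewrite -sumrB mulr_sumr; apply: eq_bigr => l _; ring.
have le2 : `|h q0| ^+ 2 <= K%:R * tau M * (K%:R * `|h q0| * delta).
  apply: le_trans (_ : \sum_(r < K) h r ^+ 2 <= _).
    rewrite (bigD1 q0) //= real_normK ?num_real // lerDl.
    by apply: sumr_ge0 => t _; apply: sqr_ge0.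
  rewrite -S_ind S_lam (le_trans (ler_norm _)) // (le_trans (ler_norm_sum _ _ _)) //.
  apply: le_trans (_ : (\sum_l `|lam 0 l|) * (K%:R * `|h q0| * delta) <= _).
    by rewrite mulr_suml; apply: ler_sum => l _; rewrite normrM ler_wpM2l.
  by rewrite ler_wpM2r // !mulr_ge0.
have [->|hq0] := eqVneq (h q0) 0; first by rewrite normr0 !mulr_ge0 // ltW.
have hq0' : 0 < `|h q0| by rewrite normr_gt0.
rewrite -(ler_pM2r hq0') -expr2 (le_trans le2) // le_eqVlt; apply/orP; left.
by apply/eqP; ring.
Qed.

End Stability.

(** * Least squares *)

Section LeastSquares.
Variables (R : realType) (T k : nat) (N : 'M[R]_(T, k)).
Hypothesis N_inj : forall h : 'cV[R]_k, N *m h = 0 -> h = 0.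

Lemma gram_unit : N^T *m N \in unitmx.
Proof.
rewrite -row_free_unit -kermx_eq0; apply/eqP/row_matrixP => i.
rewrite row0; set v := row i _.
have vG : v *m (N^T *m N) = 0 by apply/sub_kermxP; apply: row_sub.
apply: trmx_inj; rewrite trmx0; apply: N_inj; apply: row_mul_self_eq0.
by rewrite trmx_mul trmxK -mulmxA mulmxA mulmxA -[v *m _ *m _]mulmxA vG mul0mx mxE.
Qed.

(** [N h] is the orthogonal projection of the noise [e] onto the column space of [N], so its
    Euclidean norm is at most that of [e]. *)
Lemma least_squares_error (v : 'cV[R]_k) (e : 'cV[R]_T) (x : R) :
  (forall t, `|e t 0| <= x) ->
  let h := invmx (N^T *m N) *m N^T *m (N *m v + e) - v in
  forall t, ((N *m h) t 0) ^+ 2 <= T%:R * x ^+ 2.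
Proof.
move=> e_le h t; pose y := N *m h.
have WN : invmx (N^T *m N) *m N^T *m N = 1%:M.
  by rewrite -mulmxA mulVmx // gram_unit.
have hE : h = invmx (N^T *m N) *m N^T *m e.
  by rewrite /h mulmxDr mulmxA WN mul1mx addrAC subrr add0r.
have Gh : N^T *m y = N^T *m e.
  by rewrite /y hE mulmxA -[invmx _ *m _ *m e]mulmxA mulKVmx // gram_unit.
have yy : \sum_s y s 0 ^+ 2 = \sum_s y s 0 * e s 0.
  transitivity ((y^T *m y) 0 0); first by rewrite mxE; apply: eq_bigr => s _; rewrite !mxE expr2.
  transitivity ((y^T *m e) 0 0); last by rewrite mxE; apply: eq_bigr => s _; rewrite !mxE.
  by rewrite [in y^T]/y trmx_mul -!mulmxA Gh.
have ye : \sum_s y s 0 ^+ 2 <= \sum_s e s 0 ^+ 2.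
  have : \sum_s (2 * (y s 0 * e s 0)) <= \sum_s (y s 0 ^+ 2 + e s 0 ^+ 2).
    by apply: ler_sum => s _; have := sqr_ge0 (y s 0 - e s 0); nra.
  by rewrite -mulr_sumr -yy big_split /=; lra.
apply: le_trans (_ : \sum_s y s 0 ^+ 2 <= _).
  by rewrite (bigD1 t) //= lerDl; apply: sumr_ge0 => s _; apply: sqr_ge0.
apply: le_trans ye _; rewrite mulr_natl -[T in X in _ <= X]card_ord -sumr_const.
apply: ler_sum => s _; rewrite -real_normK ?num_real // lerXn2r ?nnegrE //.
exact: le_trans (e_le s).
Qed.

End LeastSquares.

(** * Sequences of subpolynomial growth *)

Section Subpolynomial.
Variable R : realType.

Lemma near_le_nat (A : R) : \forall k \near \oo, A <= k%:R.
Proof. by have /cvgryPge := @cvgr_idn R; apply. Qed.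

Lemma cvg_inv_ln : (ln (k%:R : R))^-1 @[k --> \oo] --> (0 : R).
Proof.
apply/gtr0_cvgV0.
  near=> k; apply: ln_gt0; apply: lt_le_trans (_ : 2 <= _); first by rewrite ltr1n.
  by near: k; apply: near_le_nat.
apply/cvgryPge => A; near=> k.
rewrite -[A]expRK ler_ln ?posrE ?expR_gt0 //.
  by near: k; apply: near_le_nat.
by apply: lt_le_trans (expR_gt0 A) _; near: k; apply: near_le_nat.
Unshelve. all: by end_near. Qed.

(** With exponent [ln (|C| + 1) / ln k] the power is eventually the constant [|C| + 1]. *)
Lemma subpolynomial_const (C : R) : subpolynomial (fun _ => C).
Proof.
have C1 : 0 < `|C| + 1 by rewrite ltr_wpDl.
exists (fun k => ln (`|C| + 1) * (ln k%:R)^-1).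
  by rewrite -[X in _ --> X](mulr0 (ln (`|C| + 1))); apply: cvgMr; apply: cvg_inv_ln.
near=> k; have k2 : 2 <= k%:R :> R by near: k; apply: near_le_nat.
have k0 : 0 < k%:R :> R by apply: lt_le_trans k2.
have lnk : 0 < ln (k%:R : R) by apply: ln_gt0; apply: lt_le_trans k2; rewrite ltr1n.
rewrite /powR gt_eqF // -mulrA mulVf ?gt_eqF // mulr1 lnK ?posrE //.
by apply: le_trans (ler_norm C) _; rewrite lerDl.
Unshelve. all: by end_near. Qed.

Lemma subpolynomialM (g h : nat -> R) : (forall k, 0 <= g k) -> (forall k, 0 <= h k) ->
  subpolynomial g -> subpolynomial h -> subpolynomial (fun k => g k * h k).
Proof.
move=> g0 h0 [e e0 ge] [e' e'0 he']; exists (fun k => e k + e' k).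
  by rewrite -[X in _ --> X](addr0 0); apply: cvgD.
near=> k; rewrite powRD; last first.
  apply/implyP => _; rewrite pnatr_eq0 -lt0n; near: k; exact: nbhs_infty_gt.
by apply: ler_pM => //; near: k.
Unshelve. all: by end_near. Qed.

Lemma subpolynomialX (g : nat -> R) (j : nat) : (forall k, 0 <= g k) ->
  subpolynomial g -> subpolynomial (fun k => g k ^+ j).
Proof.
move=> g0 gs; elim: j => [|j IHj].
  by have := subpolynomial_const 1; under [in X in X -> _]eq_fun do rewrite -(expr0 0).
under eq_fun do rewrite exprS.
by apply: subpolynomialM => // k; apply: exprn_ge0.
Qed.

(** The exponent may be negative. Its absolute value makes the power at least 1, so that adding 1
    costs at most a factor 2. *)
Lemma subpolynomial_succ (g : nat -> nat) :
  subpolynomial (fun k => (g k)%:R : R) -> subpolynomial (fun k => (g k).+1%:R : R).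
Proof.
move=> [e e0 ge].
have [e' e'0 he'] : subpolynomial (fun=> 2 : R) by apply: subpolynomial_const.
exists (fun k => e' k + `|e k|).
  by rewrite -[X in _ --> X](addr0 0); apply: cvgD => //; rewrite -(normr0 R); apply: cvg_norm.
near=> k; have k1 : 1 <= k%:R :> R by near: k; apply: near_le_nat.
rewrite powRD; last by apply/implyP => _; rewrite gt_eqF // (lt_le_trans _ k1).
have p1 : 1 <= k%:R `^ `|e k| by apply: le_trans (ler_powR k1 (normr_ge0 (e k))); rewrite powRr0.
have gk : (g k)%:R <= k%:R `^ `|e k|.
  apply: le_trans (_ : k%:R `^ e k <= _); first by near: k.
  by rewrite ler_powR // ler_norm.
apply: le_trans (_ : 2 * k%:R `^ `|e k| <= _).
  by rewrite -natr1; lra.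
by rewrite ler_wpM2r ?powR_ge0 //; near: k.
Unshelve. all: by end_near. Qed.

End Subpolynomial.

(** * Routines on matrices *)

Section Inverse.
Variables (R : realType) (f : R -> R).
Implicit Types (P Q : program R) (s : state R).
Local Notation runs := (@runs R f).

(* Register 15 holds 0 and register 11 holds 1.  The matrix is read from
   array 10, its dimension from register 10; the inverse is left in array 12. *)
Definition InvStep : program R :=
  Seq (Fill 13 11 10
    (Seq (blk (IMul R 40 24 10)
           [:: IConst R 41 1; IMul R 42 50 10; IConst R 43 1; IAdd R 44 10 15])
      (Seq (Dot R 10 10) (blk (RConst 41 0) [:: RAdd R 20 40 41]))))
 (Seq (Fill 14 11 10
    (Seq (blk (IMul R 40 24 10)
           [:: IConst R 41 1; IConst R 42 0; IConst R 43 1; IAdd R 44 10 15])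
      (Seq (Dot R 12 13)
        (blk (IMul R 48 50 10) [:: IAdd R 48 48 24; RLoad R 41 10 48; RSub R 20 41 40]))))
 (Seq (Seq (blk (IMul R 40 50 10)
           [:: IConst R 41 1; IConst R 42 0; IConst R 43 1; IAdd R 44 10 15])
      (Seq (Dot R 10 14) (blk (RConst 41 0) [:: RAdd R 50 40 41])))
 (Seq (Fill 15 11 10
    (Seq (blk (IMul R 40 50 10)
           [:: IConst R 41 1; IAdd R 42 24 15; IAdd R 43 10 15; IAdd R 44 10 15])
      (Seq (Dot R 10 12)
        (Seq (If (ILe 24 50)
               (If (ILe 50 24) (blk (RConst 41 1) [::]) (blk (RConst 41 0) [::]))
               (blk (RConst 41 0) [::]))
          (blk (RSub R 41 41 40) [:: RDiv R 20 41 50])))))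
 (Fill 12 10 10
    (blk (RLoad R 41 14 20) [:: RLoad R 42 15 24; RMul R 41 41 42; IMul R 48 20 10;
       IAdd R 48 48 24; RLoad R 42 12 48; RAdd R 20 42 41]))))).

Definition Inverse : program R :=
  Seq (Fill 12 10 10 (blk (RConst 20 0) [::])) (For 50 10 InvStep).

Section Step.
Variables (d : nat) (M X : 'M[R]_d) (i : 'I_d) (s0 : state R).
Hypotheses (s0_10 : ireg s0 10 = d%:Z) (s0_11 : ireg s0 11 = 1%:Z)
  (s0_15 : ireg s0 15 = 0%:Z) (s0_50 : ireg s0 50 = (i : nat)%:Z)
  (s0_M : stored_mx (rarr s0 10) M) (s0_X : stored_mx (rarr s0 12) X).

Let r := row i M.
Let p : 'cV[R]_d := r^T - X *m (M *m r^T).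
Let w : 'rV[R]_d := ((r *m p) 0 0)^-1 *: (delta_mx 0 i - r *m X).

Let cost := (4 + (d * (11 * d + 20 + 5) + 8))%N.

(** Forming [M r^T] before applying [X] keeps one step quadratic in [d], and the whole inversion
    cubic. *)
Lemma runs_inv_step :
  runs InvStep s0 (4 * cost + (4 + d * (d * (7 + 5) + 8)))%N
    (fun s' => stored_mx (rarr s' 12) (inv_step M X i)).
Proof.
have costE : (4 + 1 * (d * (11 * d + 20 + 5) + 8))%N = cost by rewrite mul1n.
rewrite (_ : (4 * cost + _ = cost + (cost + (cost + (cost +
  (4 + d * (d * (7 + 5) + 8))))))%N); last by lia.
apply: runs_seq; rewrite -{1}costE.
(* [G], [Pv], [den] and [W] are [M r^T], [p], [r p] and [w] in flat indices. They are left in array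
   13, array 14, real register 50 and array 15. *)
pose a (k : nat) := rarr s0 10 k%:Z; pose x (k : nat) := rarr s0 12 k%:Z.
pose G (j : nat) := \sum_(k < d) a (j * d + k)%N * a (i * d + k)%N.
pose Pv (j : nat) := a (i * d + j)%N - \sum_(l < d) x (j * d + l)%N * G l.
pose den := \sum_(k < d) a (i * d + k)%N * Pv k.
pose W (j : nat) := ((i == j :> nat)%:R - \sum_(k < d) a (i * d + k)%N * x (k * d + j)%N) / den.
apply: runs_weaken (runs_fill (F := fun _ j => G j) s0_11 s0_10 _ _ _ _) => //; last first.
  move=> i1 j s1 _ jd ag1 s1_20 s1_24 _.
  have e10 : ireg s1 10 = d := etrans (fI ag1 10) s0_10.
  have e15 : ireg s1 15 = 0 := etrans (fI ag1 15) s0_15.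
  have e50 : ireg s1 50 = i := etrans (fI ag1 50) s0_50.
  have eM : rarr s1 10 = rarr s0 10 := fRA ag1 10.
  rewrite (_ : (11 * d + 20 = 5 + (11 * d + 5 + 10))%N); last by lia.
  apply/runs_seq/runs_blk => //.
  apply: runs_seq; apply: runs_weaken (runs_dot f 10 10 (a0 := (j * d)%N) (sa := 1) (b0 := (i * d)%N) (sb := 1) (K := d) _ _ _ _ _) => //.
  - move=> s3 ag3 e; apply: runs_blk => //=; rewrite !updE /= e addr0.
    by apply: eq_bigr => k _; rewrite !muln1 eM.
  - by rewrite /= !updE /= s1_24 e10.
  - by rewrite /= !updE /= e50 e10.
  - by rewrite /= !updE /= e10 e15 addr0.
move=> s1 ag1 s1_13'; have s1_13 j : (j < d)%N -> rarr s1 13 j = G j.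
  by move=> jd; rewrite -(s1_13' 0%N j).
have e10 : ireg s1 10 = d := etrans (fI ag1 10) s0_10.
have e11 : ireg s1 11 = 1 := etrans (fI ag1 11) s0_11.
have e15 : ireg s1 15 = 0 := etrans (fI ag1 15) s0_15.
have e50 : ireg s1 50 = i := etrans (fI ag1 50) s0_50.
have eM : rarr s1 10 = rarr s0 10 := fRA ag1 10.
have eX : rarr s1 12 = rarr s0 12 := fRA ag1 12.
move=> {ag1 s1_13'}; apply: runs_seq; rewrite -{1}costE.
apply: runs_weaken (runs_fill (F := fun _ j => Pv j) e11 e10 _ _ _ _) => //; last first.
  move=> i1 j s2 _ jd ag2 s2_20 s2_24 _.
  have d10 : ireg s2 10 = d := etrans (fI ag2 10) e10.
  have d15 : ireg s2 15 = 0 := etrans (fI ag2 15) e15.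
  have d50 : ireg s2 50 = i := etrans (fI ag2 50) e50.
  have dM : rarr s2 10 = rarr s0 10 := etrans (fRA ag2 10) eM.
  have dX : rarr s2 12 = rarr s0 12 := etrans (fRA ag2 12) eX.
  have dG : rarr s2 13 = rarr s1 13 := fRA ag2 13.
  rewrite (_ : (11 * d + 20 = 5 + (11 * d + 5 + 10))%N); last by lia.
  apply/runs_seq/runs_blk => //; set s3 := foldl _ _ _.
  apply: runs_seq; apply: runs_weaken (runs_dot f 12 13 (a0 := (j * d)%N) (sa := 1) (b0 := 0) (sb := 1) (K := d) _ _ _ _ _) => //.
  - move=> s4 ag4 e; apply: runs_blk => //=.
    have c10 : ireg s4 10 = d := etrans (fI ag4 10) d10.
    have c24 : ireg s4 24 = j := etrans (fI ag4 24) s2_24.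
    have c50 : ireg s4 50 = i := etrans (fI ag4 50) d50.
    have cM : rarr s4 10 = rarr s0 10 := etrans (fRA ag4 10) dM.
    rewrite !updE /= e cM c50 c10 c24; congr (_ - _).
    apply: eq_bigr => k _; rewrite !muln1 dX dG.
    by rewrite [X in _ * X](s1_13 k (ltn_ord k)).
  - by rewrite /= !updE /= s2_24 d10.
  - by rewrite /= !updE /= d10 d15 addr0.
move=> s2 ag2 s2_14'; have s2_14 j : (j < d)%N -> rarr s2 14 j = Pv j.
  by move=> jd; rewrite -(s2_14' 0%N j).
have d10 : ireg s2 10 = d := etrans (fI ag2 10) e10.
have d11 : ireg s2 11 = 1 := etrans (fI ag2 11) e11.
have d15 : ireg s2 15 = 0 := etrans (fI ag2 15) e15.
have d50 : ireg s2 50 = i := etrans (fI ag2 50) e50.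
have dM : rarr s2 10 = rarr s0 10 := etrans (fRA ag2 10) eM.
have dX : rarr s2 12 = rarr s0 12 := etrans (fRA ag2 12) eX.
move=> {ag2 s2_14' e10 e11 e15 e50 eM eX s1_13}; apply: runs_seq.
apply: (@runs_weaken _ _ _ _ (5 + (11 * d + 5 + 2)) _ (fun s' => rreg s' 50 = den)); first by rewrite /cost; nia.
  2: { apply/runs_seq/runs_blk => //; set s3 := foldl _ _ _.
  apply: runs_seq; apply: runs_weaken (runs_dot f 10 14 (a0 := (i * d)%N) (sa := 1) (b0 := 0) (sb := 1) (K := d) _ _ _ _ _) => //.
  - move=> s4 ag4 e; apply: runs_blk => //=.
    rewrite !updE /= e addr0; apply: eq_bigr => k _; rewrite !muln1 dM.
    by rewrite [X in _ * X](s2_14 k (ltn_ord k)).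
  - by rewrite /= !updE /= d50 d10.
  - by rewrite /= !updE /= d10 d15 addr0. }
move=> s3 ag3 s3_50.
have c10 : ireg s3 10 = d := etrans (fI ag3 10) d10.
have c11 : ireg s3 11 = 1 := etrans (fI ag3 11) d11.
have c15 : ireg s3 15 = 0 := etrans (fI ag3 15) d15.
have c50 : ireg s3 50 = i := etrans (fI ag3 50) d50.
have cM : rarr s3 10 = rarr s0 10 := etrans (fRA ag3 10) dM.
have cX : rarr s3 12 = rarr s0 12 := etrans (fRA ag3 12) dX.
have s3_14 j : (j < d)%N -> rarr s3 14 j = Pv j.
  by move=> jd; rewrite (fRA ag3 14) s2_14.
move=> {ag3 d10 d11 d15 d50 dM dX s2_14}; apply: runs_seq; rewrite -{1}costE.
apply: runs_weaken (runs_fill (F := fun _ j => W j) c11 c10 _ _ _ _) => //; last first.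
  move=> i1 j s4 _ jd ag4 s4_20 s4_24 _.
  have d10 : ireg s4 10 = d := etrans (fI ag4 10) c10.
  have d15 : ireg s4 15 = 0 := etrans (fI ag4 15) c15.
  have d50 : ireg s4 50 = i := etrans (fI ag4 50) c50.
  have dM : rarr s4 10 = rarr s0 10 := etrans (fRA ag4 10) cM.
  have dX : rarr s4 12 = rarr s0 12 := etrans (fRA ag4 12) cX.
  have dden : rreg s4 50 = den := etrans (fR ag4 50) s3_50.
  rewrite (_ : (11 * d + 20 = 5 + (11 * d + 5 + (3 + 7)))%N); last by lia.
  apply/runs_seq/runs_blk => //; set s5 := foldl _ _ _.
  apply: runs_seq; apply: runs_weaken (runs_dot f 10 12 (a0 := (i * d)%N) (sa := 1) (b0 := j) (sb := d) (K := d) _ _ _ _ _) => //.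
  - move=> s6 ag6 e; apply: runs_seq.
    have b24 : ireg s6 24 = j := etrans (fI ag6 24) s4_24.
    have b50 : ireg s6 50 = i := etrans (fI ag6 50) d50.
    have bden : rreg s6 50 = den := etrans (fR ag6 50) dden.
    apply: (@runs_weaken _ _ _ _ _ _ (fun s' => rreg s' 41 = (i == j :> nat)%:R) _ (leqnn 3)); last first.
      apply: runs_if => [|h]; last first.
        apply: runs_blk => //=; rewrite !updE /=.
        by move: h; rewrite /= b24 b50 lez_nat => h; rewrite (_ : (_ == _) = false) //; apply/eqP; lia.
      move=> h; apply: runs_if => h'; apply: runs_blk => //=; rewrite !updE /=.
        move: h h'; rewrite /= b24 b50 !lez_nat => h h'.
        by rewrite (_ : (_ == _) = true) //; apply/eqP; lia.
      move: h h'; rewrite /= b24 b50 !lez_nat => h h'.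
      by rewrite (_ : (_ == _) = false) //; apply/eqP; lia.
    move=> s7 ag7 e7; apply: runs_blk => //=.
    rewrite !updE /= e7 (fR ag7 40) (fR ag7 50) e bden; congr ((_ - _) / _).
    by apply: eq_bigr => k _; rewrite muln1 dM dX addnC [in X in _ * X]addnC.
  - by rewrite /= !updE /= d50 d10.
  - by rewrite /= !updE /= s4_24 d15 addr0.
  - by rewrite /= !updE /= d10 d15 addr0.
  - by rewrite /= !updE /= d10 d15 addr0.
move=> s4 ag4 s4_15'; have s4_15 j : (j < d)%N -> rarr s4 15 j = W j.
  by move=> jd; rewrite -(s4_15' 0%N j).
have d10 : ireg s4 10 = d := etrans (fI ag4 10) c10.
have dX : rarr s4 12 = rarr s0 12 := etrans (fRA ag4 12) cX.
have dP j : (j < d)%N -> rarr s4 14 j = Pv j.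
  by move=> jd; rewrite (fRA ag4 14) s3_14.
move=> {ag4 s4_15' c10 c11 c15 c50 cM cX s3_14}.
apply: runs_weaken (runs_fill (F := fun k j => x (k * d + j)%N + Pv k * W j) d10 d10 _ _ _ _) => //; last first.
  move=> k j s5 kd jd ag5 s5_20 s5_24 s5_12; apply: runs_blk => //=.
  rewrite !updE /= (fI ag5 10) d10 s5_20 s5_24 s5_12 dX; congr (_ + _ * _).
    by rewrite (fRA ag5 14) dP.
  by rewrite (fRA ag5 15) s4_15.
move=> s5 _ s5_12 k j; rewrite s5_12 //.
have aE (k' j' : 'I_d) : a (k' * d + j')%N = M k' j' := s0_M k' j'.
have xE (k' j' : 'I_d) : x (k' * d + j')%N = X k' j' := s0_X k' j'.
have GE (j' : 'I_d) : G j' = (M *m r^T) j' 0.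
  by rewrite mxE; apply: eq_bigr => k' _; rewrite !mxE !aE.
have PE (j' : 'I_d) : Pv j' = p j' 0.
  rewrite /Pv aE !mxE; congr (_ - _); apply: eq_bigr => l _.
  by rewrite xE GE.
have denE : den = (r *m p) 0 0.
  by rewrite mxE; apply: eq_bigr => l _; rewrite PE aE !mxE.
rewrite /inv_step !mxE big_ord1 xE PE; congr (_ + _ * _).
rewrite /W denE !mxE mulrC eqxx /= [j == i]eq_sym; congr (_ * (_ - _)).
by apply: eq_bigr => l _; rewrite !mxE aE xE.
Qed.
End Step.

Lemma runs_inverse (d : nat) (M : 'M[R]_d) s :
  ireg s 10 = d%:Z -> ireg s 11 = 1%:Z -> ireg s 15 = 0%:Z ->
  stored_mx (rarr s 10) M -> M \in unitmx ->
  runs Inverse s (120 * d.+1 ^ 3) (fun s' => stored_mx (rarr s' 12) (invmx M)).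
Proof.
move=> s10 s11 s15 sM uM.
set c1 := (4 + d * (d * (1 + 5) + 8))%N.
set c2 := (4 * (4 + (d * (11 * d + 20 + 5) + 8)) + (4 + d * (d * (7 + 5) + 8)))%N.
apply: (@runs_weaken _ _ _ _ (c1 + (4 + d * (c2 + 3))) _
  (fun s' => stored_mx (rarr s' 12) (invmx M))) => //.
  by rewrite /c1 /c2 !expnS expn0; nia.
apply: runs_seq; rewrite /c1.
apply: runs_weaken (runs_fill (F := fun _ _ => 0) s10 s10 _ _ _ _) => //; last first.
  by move=> *; apply: runs_blk.
move=> s1 ag1 s1_12.
have e10 : ireg s1 10 = d := etrans (fI ag1 10) s10.
have e11 : ireg s1 11 = 1 := etrans (fI ag1 11) s11.
have e15 : ireg s1 15 = 0 := etrans (fI ag1 15) s15.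
have eM : rarr s1 10 = rarr s 10 := fRA ag1 10.
apply: (@runs_weaken _ _ _ _ (4 + d * (c2 + 3)) _ (fun s' =>
  exists2 X : 'M[R]_d, stored_mx (rarr s' 12) X & inv_invariant M d X)) => //.
  by move=> s2 _ [X sX /(inv_invariant_end uM) <-].
apply: (runs_for (Inv := fun k s' =>
  exists2 X : 'M[R]_d, stored_mx (rarr s' 12) X & inv_invariant M k X)) => //.
  exists 0; last exact: inv_invariant0.
  by move=> i j; rewrite s1_12 // mxE.
move=> k s2 kd [X sX invX] ag2 s2_50; pose i : 'I_d := Ordinal kd.
have [] := @runs_inv_step d M X i s2 (etrans (fI ag2 10) e10)
  (etrans (fI ag2 11) e11) (etrans (fI ag2 15) e15) s2_50 _ sX.
  by rewrite (fRA ag2 10) eM.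
move=> t [s3 [ex3 le3 sX3]]; exists t, s3; split=> //.
by exists (inv_step M X i) => //; apply: (inv_invariantS uM (i := i)).
Qed.

(** Absolute values come from square roots of squares. Array 16 holds the square roots of the
    absolute values, so the inner product of a row with itself is its absolute sum. *)
Definition Tau : program R :=
  Seq (Fill 16 10 10 (blk (IMul R 48 20 10) [:: IAdd R 48 48 24; RLoad R 41 12 48;
         RMul R 41 41 41; RSqrt R 41 41; RSqrt R 20 41]))
 (Seq (blk (RConst 1 0) [::])
 (For 54 10
   (Seq (Seq (blk (IMul R 40 54 10)
               [:: IConst R 41 1; IAdd R 42 40 15; IConst R 43 1; IAdd R 44 10 15])
           (Dot R 16 16))
     (If (RLe 1 40) (blk (RConst 41 0) [:: RAdd R 1 40 41]) (blk (RConst 41 0) [::]))))).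

Lemma runs_tau (d : nat) (M : 'M[R]_d) s : (0 < d)%N ->
  ireg s 10 = d%:Z -> ireg s 15 = 0%:Z -> stored_mx (rarr s 12) (invmx M) ->
  runs Tau s (60 * d.+1 ^ 2) (fun s' => rreg s' 1 = tau M).
Proof.
move=> d0 s10 s15 sX.
pose x (k : nat) := rarr s 12 k%:Z.
pose F (i : nat) := \sum_(k < d) `|x (i * d + k)%N|.
have F0 i : 0 <= F i by apply: sumr_ge0.
have FE (i : 'I_d) : F i = row_l1 M i by apply: eq_bigr => k _; rewrite -sX.
set c1 := (4 + d * (d * (6 + 5) + 8))%N.
apply: (@runs_weaken _ _ _ _ (c1 + (1 + (4 + d * ((5 + (11 * d + 5) + 3) + 3)))) _
  (fun s' => rreg s' 1 = tau M)) => //.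
  by rewrite /c1 !expnS expn0; nia.
apply: runs_seq; rewrite /c1.
apply: runs_weaken (runs_fill (F := fun i j => Num.sqrt `|x (i * d + j)%N|) s10 s10 _ _ _ _) => //; last first.
  move=> i j s1 id jd ag1 s1_20 s1_24 _; apply: runs_blk => //=.
  rewrite !updE /= (fI ag1 10) s10 s1_20 s1_24 -expr2 sqrtr_sqr.
  by rewrite (fRA ag1 12) -PoszM -PoszD.
move=> s1 ag1 s1_16.
have e10 : ireg s1 10 = d := etrans (fI ag1 10) s10.
have e15 : ireg s1 15 = 0 := etrans (fI ag1 15) s15.
apply/runs_seq/runs_blk => //=.
apply: (@runs_weaken _ _ _ _ (4 + d * ((5 + (11 * d + 5) + 3) + 3)) _ (fun s' =>
  (forall i, (i < d)%N -> F i <= rreg s' 1) /\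
  (rreg s' 1 = 0 \/ exists2 i : nat, (i < d)%N & rreg s' 1 = F i))) => //.
  move=> s2 _ [ub wit]; rewrite tauE //; apply/eqP; rewrite eq_le; apply/andP; split.
    case: wit => [->|[i id ->]]; first exact: bigmax_ge_id.
    by rewrite (FE (Ordinal id)); apply: (le_bigmax _ (row_l1 M)).
  apply: bigmax_le => [|i _]; last by rewrite -FE ub.
  by apply: le_trans (F0 0%N) (ub _ d0).
apply: (runs_for (Inv := fun k s' => (forall i, (i < k)%N -> F i <= rreg s' 1) /\
  (rreg s' 1 = 0 \/ exists2 i : nat, (i < k)%N & rreg s' 1 = F i))) => //.
  by split=> //; left.
move=> k s2 kd [ub wit] ag2 s2_54.
have e10' : ireg s2 10 = d := etrans (fI ag2 10) e10.
have e15' : ireg s2 15 = 0 := etrans (fI ag2 15) e15.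
apply: runs_seq; apply: (@runs_weaken _ _ _ _ _ _ (fun s' => rreg s' 40 = F k) _ (leqnn _)).
  move=> s3 ag3 e3; have e1 : rreg s3 1 = rreg s2 1 := fR ag3 1.
  apply: runs_if => /= h; apply: runs_blk => //=; rewrite !updE /= ?addr0.
    rewrite e3; split=> [i|]; last by right; exists k.
    rewrite ltnS leq_eqVlt => /orP[/eqP->//|/ub/le_trans]; apply.
    by rewrite -e1 -e3.
  rewrite e1; split=> [i|].
    rewrite ltnS leq_eqVlt => /orP[/eqP->|/ub//].
    by move: h; rewrite e1 e3 -ltNge => /ltW.
  by case: wit => [->|[i ik ->]]; [left | right; exists i => //; apply: ltnW].
apply/runs_seq/runs_blk => //.
apply: runs_weaken (runs_dot f 16 16 (a0 := (k * d)%N) (sa := 1) (b0 := (k * d)%N) (sb := 1) (K := d) _ _ _ _ _) => //.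
- move=> s3 _ ->; apply: eq_bigr => i _; rewrite muln1 /= (fRA ag2 16) s1_16 //.
  by rewrite -expr2 sqr_sqrtr.
- by rewrite /= !updE /= s2_54 e10'.
- by rewrite /= !updE /= s2_54 e10' e15' addr0.
- by rewrite /= !updE /= e10' e15' addr0.
Qed.

End Inverse.

(** * Distances and parities *)

Section Distances.
Variables (R : realType) (f : R -> R).
Implicit Types (P Q : program R) (s : state R).
Local Notation runs := (@runs R f).

Definition adist (m : nat) (X Y : int -> int) (i j : nat) : int :=
  \sum_(k < m) (X (i * m + k)%N%:Z - Y (j * m + k)%N%:Z) ^+ 2.

Definition ndist (m : nat) (X Y : int -> int) (i j : nat) : nat :=
  `|adist m X Y i j|%N.

Lemma adistE m X Y i j : adist m X Y i j = (ndist m X Y i j)%:Z.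
Proof. by rewrite /ndist gez0_abs // sumr_ge0 // => k _; apply: sqr_ge0. Qed.

(* The alternating sum of the four squared distances between x_0, x_i and
   y_0, y_j is even. *)
Lemma odd_ndist m X Y i j : odd (ndist m X Y i j) =
  odd (ndist m X Y i 0) (+) odd (ndist m X Y 0 j + ndist m X Y 0 0).
Proof.
have e : adist m X Y i j + adist m X Y 0 0 + 2 * (\sum_(k < m)
    (X (i * m + k)%N%:Z - X (0 * m + k)%N%:Z) * (Y (j * m + k)%N%:Z - Y (0 * m + k)%N%:Z))
    = adist m X Y i 0 + adist m X Y 0 j.
  by rewrite mulr_sumr -!big_split /=; apply: eq_bigr => k _; ring.
rewrite !adistE in e; set z := \sum_(_ < _) _ in e.
have : exists w : int, (ndist m X Y i j + ndist m X Y 0 0)%N%:Z + 2 * w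
    = (ndist m X Y i 0 + ndist m X Y 0 j)%N%:Z by exists z; rewrite !PoszD.
move=> [w ew].
have : odd (ndist m X Y i j + ndist m X Y 0 0) = odd (ndist m X Y i 0 + ndist m X Y 0 j).
  by lia.
by rewrite !oddD; do 4!case: odd.
Qed.

Definition Dist : program R :=
  Seq (blk (IConst R 32 0) [:: IMul R 34 30 1; IMul R 35 31 1])
    (For 36 1 (blk (IAdd R 33 34 36) [:: ILoad R 33 0 33; IAdd R 39 35 36;
       ILoad R 39 1 39; ISub R 33 33 39; IMul R 33 33 33; IAdd R 32 32 33])).

Lemma runs_dist (m i j : nat) s :
  ireg s 1 = m%:Z -> ireg s 30 = i%:Z -> ireg s 31 = j%:Z ->
  runs Dist s (10 * m.+1)
    (fun s' => ireg s' 32 = (ndist m (iarr s 0) (iarr s 1) i j)%:Z).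
Proof.
move=> s1 s30 s31; apply: (@runs_weaken _ _ _ _ (3 + (4 + m * (7 + 3))) _
  (fun s' => ireg s' 32 = adist m (iarr s 0) (iarr s 1) i j)); first by lia.
  by move=> s' _ ->; rewrite adistE.
apply/runs_seq/runs_blk => //.
apply: (runs_for (Inv := fun k s' => ireg s' 32 = \sum_(l < k)
  (iarr s 0 (i * m + l)%N%:Z - iarr s 1 (j * m + l)%N%:Z) ^+ 2)) => //.
- move=> k s' r x h; rewrite /= updE; case: eqP => // e; move: h; rewrite -e; lia.
- by rewrite big_ord0.
move=> k s2 km in2 ag2 s2_36; apply: runs_blk => //=.
have e34 : ireg s2 34 = (i * m)%N%:Z by rewrite (fI ag2 34) /= !updE /= s1 s30.
have e35 : ireg s2 35 = (j * m)%N%:Z by rewrite (fI ag2 35) /= !updE /= s1 s31.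
rewrite !updE /= in2 (fIA ag2 0%N) (fIA ag2 1%N) e34 e35 s2_36 big_ord_recr /= expr2.
by rewrite -!PoszD.
Qed.

(** Division by trying every quotient. Its cost is linear in the dividend, which is [n], [D] or a
    sum of at most two distances. *)
Definition Quot : program R :=
  Seq (blk (IConst R 73 1) [:: IAdd R 73 70 73; IConst R 72 0])
    (For 74 73 (Seq (blk (IMul R 77 74 71) [::])
      (If (ILe 77 70) (blk (IConst R 78 0) [:: IAdd R 72 74 78])
                      (blk (IConst R 78 0) [::])))).

Lemma runs_quot (a b : nat) s :
  ireg s 70 = a%:Z -> ireg s 71 = b%:Z -> (0 < b)%N ->
  runs Quot s (7 * a + 14) (fun s' => ireg s' 72 = (a %/ b)%N%:Z).
Proof.
move=> s70 s71 b0; rewrite (_ : (7 * a + 14 = 3 + (4 + a.+1 * (1 + 3 + 3)))%N); last by lia.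
apply/runs_seq/runs_blk => //.
apply: (@runs_weaken _ _ _ _ (4 + a.+1 * (1 + 3 + 3)) _
  (fun s' => ireg s' 72 = (minn a.+1.-1 (a %/ b))%:Z)) => //.
  by move=> s' _ ->; rewrite /= (minn_idPr (leq_div _ _)).
(* After [k] rounds the largest candidate tried is [k.-1]; the truncated predecessor also fits the
   initial value 0. *)
apply: (runs_for (Inv := fun k s' => ireg s' 72 = (minn k.-1 (a %/ b))%:Z)) => //.
- by rewrite /= !updE /= s70 -addn1.
- move=> k s' r x h; rewrite /= updE; case: eqP => // e; move: h; rewrite -e; lia.
- by rewrite /= !updE /= min0n.
move=> k s1 ka in1 ag1 s1_74; apply/runs_seq/runs_blk => //=.
have e70 : ireg s1 70 = a := etrans (fI ag1 70) s70.
have e71 : ireg s1 71 = b := etrans (fI ag1 71) s71.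
have cmp : (k * b <= a)%N = (k <= a %/ b)%N by rewrite leq_divRL.
apply: runs_if => /=; rewrite !updE /= s1_74 e70 e71 -PoszM lez_nat cmp => h;
  apply: runs_blk => //=; rewrite !updE /=.
  by rewrite s1_74 addr0 (minn_idPl h).
by rewrite in1; congr Posz; lia.
Qed.

Definition Parity : program R :=
  Seq (blk (IAdd R 70 32 15) [:: IConst R 71 2])
    (Seq Quot (blk (IMul R 72 72 71) [:: ISub R 72 70 72; ROfInt R 20 72])).

Lemma runs_parity (d : nat) s : ireg s 32 = d%:Z -> ireg s 15 = 0%:Z ->
  runs Parity s (7 * d + 20) (fun s' => rreg s' 20 = (odd d)%:R).
Proof.
move=> s32 s15; rewrite (_ : (7 * d + 20 = 2 + (7 * d + 14 + 4))%N); last by lia.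
apply/runs_seq/runs_blk => //.
apply: runs_seq; apply: runs_weaken (runs_quot (a := d) (b := 2) _ _ _) => //.
  move=> s1 ag1 e; apply: runs_blk => //=.
  rewrite !updE /= (fI ag1 70) (fI ag1 71) e /= !updE /= s32 s15 addr0.
  by rewrite (_ : _ - _ = (odd d)%:Z) // -modn2; have := divn_eq d 2; lia.
by rewrite /= !updE /= s32 s15 addr0.
Qed.

(** Parities of squared norms would serve as well, but norms are unbounded and the division is
    linear in its argument. Distances to the fixed points x_0 and y_0 are at most [D]. *)
Definition Parities : program R :=
  Seq (Fill 25 11 0 (Seq (blk (IAdd R 30 24 15) [:: IConst R 31 0]) (Seq Dist Parity)))
 (Seq (Seq (blk (IConst R 30 0) [:: IConst R 31 0]) (Seq Dist (blk (IAdd R 16 32 15) [::])))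
   (Fill 26 11 0 (Seq (blk (IConst R 30 0) [:: IAdd R 31 24 15])
      (Seq Dist (Seq (blk (IAdd R 32 32 16) [::]) Parity))))).

Lemma runs_parities (n m D : nat) s : (0 < n)%N ->
  let d := ndist m (iarr s 0) (iarr s 1) in
  ireg s 0 = n%:Z -> ireg s 1 = m%:Z -> ireg s 11 = 1%:Z -> ireg s 15 = 0%:Z ->
  (forall i j, (i < n)%N -> (j < n)%N -> (d i j <= D)%N) ->
  runs Parities s (200 * n * (m.+1 * D.+1)) (fun s' =>
    (forall i, (i < n)%N -> rarr s' 25 i%:Z = (odd (d i 0%N))%:R) /\
    (forall j, (j < n)%N -> rarr s' 26 j%:Z = (odd (d 0%N j + d 0%N 0%N))%:R)).
Proof.
move=> n0 d s0 s1 s11 s15 dD.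
set c1 := (2 + (10 * m.+1 + (7 * D + 20)))%N.
set c2 := (2 + (10 * m.+1 + 1))%N.
set c3 := (2 + (10 * m.+1 + (1 + (7 * (2 * D) + 20))))%N.
apply: (@runs_weaken _ _ _ _ ((4 + 1 * (n * (c1 + 5) + 8)) + (c2 +
  (4 + 1 * (n * (c3 + 5) + 8)))) _ (fun s' =>
  (forall i, (i < n)%N -> rarr s' 25 i%:Z = (odd (d i 0%N))%:R) /\
    (forall j, (j < n)%N -> rarr s' 26 j%:Z = (odd (d 0%N j + d 0%N 0%N))%:R))) => //.
  by rewrite /c1 /c2 /c3; nia.
apply: runs_seq.
apply: runs_weaken (runs_fill (F := fun _ j => (odd (d j 0%N))%:R) s11 s0 _ _ _ _) => //; last first.
  move=> i j t1 _ jn ag1 _ t1_24 _; rewrite /c1.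
  apply/runs_seq/runs_blk => //.
  have e1 : ireg t1 1 = m := etrans (fI ag1 1%N) s1.
  have e15 : ireg t1 15 = 0 := etrans (fI ag1 15) s15.
  apply: runs_seq; apply: runs_weaken (runs_dist (m := m) (i := j) (j := 0%N) _ _ _) => //.
    move=> t2 ag2 e2.
    have {}e2 : ireg t2 32 = (d j 0%N) by rewrite e2 /= (fIA ag1 0%N) (fIA ag1 1%N).
    apply: runs_weaken (runs_parity e2 _) => //.
      by have := dD j 0%N jn n0; lia.
    by rewrite (fI ag2 15).
  by rewrite /= !updE /= t1_24 e15 addr0.
move=> t1 ag1 t1_25.
have e0 : ireg t1 0 = n := etrans (fI ag1 0%N) s0.
have e1 : ireg t1 1 = m := etrans (fI ag1 1%N) s1.
have e11 : ireg t1 11 = 1 := etrans (fI ag1 11) s11.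
have e15 : ireg t1 15 = 0 := etrans (fI ag1 15) s15.
have eX : iarr t1 0 = iarr s 0 := fIA ag1 0%N.
have eY : iarr t1 1 = iarr s 1 := fIA ag1 1%N.
apply: runs_seq; apply: (@runs_weaken _ _ _ _ _ _ (fun s' => ireg s' 16 = (d 0%N 0%N)) _ (leqnn _)).
  2: { rewrite /c2; apply/runs_seq/runs_blk => //.
    apply: runs_seq; apply: runs_weaken (runs_dist (m := m) (i := 0%N) (j := 0%N) _ _ _) => //.
    move=> t2 ag2 e2; apply: runs_blk => //=; rewrite !updE /= e2 (fI ag2 15) /= !updE /= e15 addr0.
    by rewrite eX eY. }
move=> t2 ag2 t2_16.
have d0 : ireg t2 0 = n := etrans (fI ag2 0%N) e0.
have d11 : ireg t2 11 = 1 := etrans (fI ag2 11) e11.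
apply: runs_weaken (runs_fill (F := fun _ j => (odd (d 0%N j + d 0%N 0%N))%:R) d11 d0 _ _ _ _) => //; last first.
  move=> i j t3 _ jn ag3 _ t3_24 _; rewrite /c3.
  apply/runs_seq/runs_blk => //.
  have d1 : ireg t3 1 = m := etrans (fI ag3 1%N) (etrans (fI ag2 1%N) e1).
  have d15 : ireg t3 15 = 0 := etrans (fI ag3 15) (etrans (fI ag2 15) e15).
  have d16 : ireg t3 16 = (d 0%N 0%N) := etrans (fI ag3 16) t2_16.
  apply: runs_seq; apply: runs_weaken (runs_dist (m := m) (i := 0%N) (j := j) _ _ _) => //.
    move=> t4 ag4 e4.
    have {}e4 : ireg t4 32 = (d 0%N j).
      by rewrite e4 /= (fIA ag3 0%N) (fIA ag3 1%N) (fIA ag2 0%N) (fIA ag2 1%N) eX eY.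
    apply/runs_seq/runs_blk => //.
    apply: runs_weaken (runs_parity (d := (d 0%N j + d 0%N 0%N)%N) _ _) => //.
    - by have := dD 0%N j n0 jn; have := dD 0%N 0%N n0 n0; lia.
    - by rewrite /= !updE /= e4 (fI ag4 16) /= !updE /= d16 PoszD.
    - by rewrite /= !updE /= (fI ag4 15).
  by rewrite /= !updE /= t3_24 d15 addr0.
move=> t3 ag3 t3_26; split=> [i lin|j ljn]; last by rewrite -(t3_26 0%N j).
by rewrite (fRA ag3 25) (fRA ag2 25) -(t1_25 0%N i).
Qed.

Definition Brute : program R :=
  For 50 0 (For 54 0 (Seq (blk (IAdd R 30 50 15) [:: IAdd R 31 54 15])
    (Seq Dist (If (ILe 32 7) (blk (IConst R 39 0) [:: IAdd R 7 32 39])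
                             (blk (IConst R 39 0) [::]))))).

(** With [dmin] the true minimum, the two conclusions together say that register 7 ends equal to it.
    The search over blocks is specified in the same way. *)
Lemma runs_brute (n m : nat) (dmin : int) s :
  let d := ndist m (iarr s 0) (iarr s 1) in
  ireg s 0 = n%:Z -> ireg s 1 = m%:Z -> ireg s 15 = 0%:Z ->
  dmin <= ireg s 7 ->
  (forall i j, (i < n)%N -> (j < n)%N -> dmin <= (d i j)%:Z) ->
  runs Brute s (4 + n * ((4 + n * ((2 + (10 * m.+1 + 3)) + 3)) + 3)) (fun s' =>
    dmin <= ireg s' 7 /\
    (forall i j, (i < n)%N -> (j < n)%N -> ireg s' 7 <= (d i j)%:Z)).
Proof.
move=> d s0 s1 s15 s7 lb.
apply: (runs_for (Inv := fun k s' => dmin <= ireg s' 7 /\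
    (forall i j, (i < k)%N -> (j < n)%N -> ireg s' 7 <= (d i j)%:Z))) => //.
  move=> k s' r x h; rewrite /= updE; case: eqP => // e; move: h; rewrite -e; lia.
move=> i t1 lin [in1 in1'] ag1 t1_50.
apply: (@runs_weaken _ _ _ _ _ _ (fun s' => dmin <= ireg s' 7 /\
    (forall i' j, (i' < i)%N && (j < n)%N || (i' == i) && (j < n)%N -> ireg s' 7 <= (d i' j)%:Z)) _ (leqnn _)).
  move=> s' _ [h1 h2]; split=> // i' j; rewrite ltnS leq_eqVlt => i'i jn; apply: h2.
  by rewrite jn !andbT orbC.
apply: (runs_for (Inv := fun k s' => dmin <= ireg s' 7 /\
    (forall i' j, (i' < i)%N && (j < n)%N || (i' == i) && (j < k)%N -> ireg s' 7 <= (d i' j)%:Z))) => //.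
- by rewrite (fI ag1 0%N).
- move=> k s' r x h; rewrite /= updE; case: eqP => // e; move: h; rewrite -e; lia.
- by split=> // i' j; rewrite ltn0 andbF orbF => /andP[]; apply: in1'.
move=> j t2 ljn [in2 in2'] ag2 t2_54; apply/runs_seq/runs_blk => //.
have e1 : ireg t2 1 = m := etrans (fI ag2 1%N) (etrans (fI ag1 1%N) s1).
have e15 : ireg t2 15 = 0 := etrans (fI ag2 15) (etrans (fI ag1 15) s15).
have e50 : ireg t2 50 = i := etrans (fI ag2 50) t1_50.
have eX : iarr t2 0 = iarr s 0 := etrans (fIA ag2 0%N) (fIA ag1 0%N).
have eY : iarr t2 1 = iarr s 1 := etrans (fIA ag2 1%N) (fIA ag1 1%N).
apply: runs_seq; apply: runs_weaken (runs_dist (m := m) (i := i) (j := j) _ _ _) => //.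
- move=> t3 ag3 /=; rewrite eX eY -/d => e.
  have e7 : ireg t3 7 = ireg t2 7 := fI ag3 7.
  apply: runs_if => /= h; apply: runs_blk => //=; rewrite !updE /=.
    rewrite addr0 e; split=> [|i' j']; first exact: lb.
    rewrite ltnS => /orP[h'|/andP[/eqP-> ]].
      by apply: le_trans (in2' i' j' _); rewrite ?h' // -e -e7.
    rewrite leq_eqVlt => /orP[/eqP->//|h'].
    by apply: le_trans (in2' i j' _); rewrite ?h' ?eqxx ?orbT // -e -e7.
  rewrite e7; split=> // i' j'; rewrite ltnS => /orP[h'|/andP[/eqP-> ]].
    by apply: in2'; rewrite h'.
  rewrite leq_eqVlt => /orP[/eqP->|h'].
    by move: h; rewrite e7 e -ltNge => /ltW.
  by apply: in2'; rewrite h' eqxx orbT.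
- by rewrite /= !updE /= e50 e15 addr0.
- by rewrite /= !updE /= t2_54 e15 addr0.
Qed.

End Distances.

(** * Tests *)

Section TestData.
Variables (R : realType) (f : R -> R) (D : nat) (c : R) (al : nat -> R).

Definition halfD : nat := (D %/ 2)%N.
Definition parD : nat := (D - 2 * halfD)%N.
(** The windows use 2K positions, so for odd [D] one of the [D] positions is spare. Dropping the
    first one when [c] is negative leaves room for the half step by which odd distances fall below
    the base. *)
Definition pos0 : nat := if (1 <= parD)%N && (c < 0) then 2 else 1.

Definition tbase (l r : nat) : R :=
  c + al l * (if 0 <= al l then (pos0 + r)%N else (pos0 + r + halfD)%N)%:R.
Definition tpt (l r q : nat) : R := tbase l r + `|al l| * q%:R.

Definition fbase (t : nat) : R := tbase (t %/ halfD) (t %% halfD).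
Definition fstep (t : nat) : R := `|al (t %/ halfD)|.
Definition fpt (t q : nat) : R := tpt (t %/ halfD) (t %% halfD) q.
Definition fdiff (t q : nat) : R := f (fpt t q) - f (fpt t q.+1).
Definition test_mx : 'M[R]_(D * halfD, halfD) := \matrix_(t, q) fdiff t q.
Definition decode_mx : 'M[R]_(halfD, D * halfD) :=
  invmx (test_mx^T *m test_mx) *m test_mx^T.

(* The distance level seen by the tests: d / 2 rounded up if D is even and
   rounded down if D is odd. *)
Definition level (d : nat) : nat := ((d + (1 - parD)) %/ 2)%N.

Let K := halfD.

Lemma halfD_parD : (D = 2 * K + parD)%N /\ (parD <= 1)%N.
Proof. by rewrite /parD -/K /K /halfD; lia. Qed.

Lemma pos0_bounds : (1 <= pos0)%N /\ ((0 < K)%N -> (pos0 + 2 * K <= D.+1)%N).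
Proof.
have [DE e1] := halfD_parD; rewrite /pos0.
by case: ifP => [/andP[e0 _]|_]; lia.
Qed.

Lemma flat_index t : (t < D * K)%N -> (t %/ K < D)%N /\ (t %% K < K)%N.
Proof.
move=> tDK; have K0 : (0 < K)%N by case: (K) tDK => //; rewrite muln0.
by rewrite ltn_divLR // ltn_pmod.
Qed.

Lemma level_le d : (d <= D)%N -> (level d <= K)%N.
Proof. by have [DE e1] := halfD_parD; rewrite /level; lia. Qed.

Lemma levelE d : d%:R + (odd d)%:R * (1 - 2 * parD%:R) = 2 * (level d)%:R :> R.
Proof.
have [DE e1] := halfD_parD; rewrite /level.
have dE : (d = 2 * (d %/ 2) + odd d)%N by have := divn_eq d 2; rewrite modn2; lia.
case: parD e1 => [|[|//]] _ /=.
  rewrite subn0 mulr0 subr0 mulr1 -natrD -natrM; congr (_%:R).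
  by have := divn_eq (d + 1) 2; rewrite modn2 oddD /=; case: (odd d) dE => /= dE; lia.
rewrite addn0 {1}dE natrD natrM; ring.
Qed.

Lemma telescope_level (g : nat -> R) (Q : nat) : (Q <= K)%N ->
  g Q = g K + \sum_(q < K) (g q - g q.+1) * (Q <= q)%N%:R.
Proof.
move=> QK; rewrite (bigID (fun q : 'I_K => (Q <= q)%N)) /= [X in _ + (_ + X)]big1 ?addr0; last first.
  by move=> q /negPf->; rewrite mulr0.
rewrite -(big_mkord (fun q => (Q <= q)%N) (fun q => (g q - g q.+1) * (Q <= q)%N%:R)).
rewrite (big_cat_nat (n := Q)) //= [X in _ + (X + _)]big1_seq ?add0r; last first.
  by move=> q; rewrite mem_index_iota => /andP[Qq /andP[_ qQ]]; lia.
rewrite big_nat_cond; under eq_bigr => q do [case/andP=> _ Qq; rewrite Qq mulr1 -opprB].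
rewrite sumrN (eq_bigl (fun q => (Q <= q < K)%N)).
  by rewrite -big_nat telescope_sumr // opprB addrC subrK.
by move=> q /=; lia.
Qed.

(** Summation by parts over the levels. The boundary term at level [K] involves only the total
    weight, so it can be subtracted exactly. *)
Lemma kernel_sum (n : nat) (u : nat -> R) (d : nat -> nat) (t : nat) :
  (forall j, (j < n)%N -> (d j <= D)%N) ->
  \sum_(j < n) f (fpt t (level (d j))) * u j - (\sum_(j < n) u j) * f (fpt t K) =
  \sum_(q < K) fdiff t q * \sum_(j < n) (level (d j) <= q)%N%:R * u j.
Proof.
move=> dD; under [RHS]eq_bigr => q _ do rewrite mulr_sumr.
rewrite [RHS]exchange_big /= mulr_suml -sumrB; apply: eq_bigr => j _.
rewrite (telescope_level (fun q => f (fpt t q)) (level_le (dD j (ltn_ord j)))).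
rewrite mulrDl [u j * _]mulrC addrAC subrr add0r mulr_suml.
by apply: eq_bigr => q _; rewrite mulrA.
Qed.

Hypothesis D_gt0 : (0 < D)%N.
Hypothesis range01 :
  forall l p : nat, (l < D)%N -> (1 <= p <= D)%N -> 0 <= c + al l * p%:R <= 1.

Lemma tpt_point l r q : (l < D)%N -> (r < K)%N -> (q <= K)%N ->
  tpt l r q = c + al l * (pos0 + (if (0 <= al l)%R then r + q else r + K - q))%N%:R.
Proof.
move=> lD rK qK; rewrite /tpt /tbase; case: ifP => h.
  by rewrite ger0_norm // -addrA -mulrDr -natrD addnA.
rewrite ltr0_norm ?ltNge ?h // -/K.
have -> : (pos0 + r + K = (pos0 + (r + K - q)) + q)%N by lia.
by rewrite natrD; ring.
Qed.

Lemma tpt_range l r q : (l < D)%N -> (r < K)%N -> (q <= K)%N -> 0 <= tpt l r q <= 1.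
Proof.
move=> lD rK qK; rewrite tpt_point //; apply: range01 => //.
have [p1 /(_ (leq_ltn_trans (leq0n r) rK)) p2] := pos0_bounds.
by case: ifP => _; lia.
Qed.

(** This quantity must be a square in the embedding. For even [D] half a step is added and nothing
    can go wrong; for odd [D] half a step is taken away. *)
Lemma tbase_shift_ge0 l r : (l < D)%N -> (r < K)%N ->
  0 <= tbase l r + `|al l| * (2^-1 - parD%:R).
Proof.
move=> lD rK.
have := tpt_range (q := 0) lD rK (leq0n _); rewrite /tpt mulr0 addr0 => /andP[b0 _].
have [DE] := halfD_parD; case e : parD => [|[|//]] _.
  by rewrite subr0 addr_ge0 // mulr_ge0 // invr_ge0.
have /andP[c1 _] := range01 (p := 1) lD D_gt0.
have /andP[cD _] := range01 (p := D) lD (introT andP (conj D_gt0 (leqnn D))).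
rewrite /tbase /pos0 e /=; case: ifP => h.
  rewrite ger0_norm //; case: ifP => hc; rewrite natrD.
    have : 0 <= al l * r%:R by rewrite mulr_ge0.
    by rewrite mulr1 in c1; lra.
  have : 0 <= al l * r%:R by rewrite mulr_ge0.
  by move: hc; case: ltP => // ? _; lra.
(* For a negative slope, nonnegativity at position [D] forces [c >= 0], so [pos0] is 1. The half
   step then leads to position [1 + r + K + 1/2], still below [D]. *)
have hl : al l < 0 by rewrite ltNge h.
rewrite ltr0_norm //.
have hc : 0 <= c.
  have : al l * D%:R <= 0 by rewrite mulr_le0_ge0 // ltW.
  by lra.
rewrite ltNge hc /=.
have hr : (1 + r + K)%N%:R + 2^-1 <= D%:R :> R.
  have : (1 + r + K)%N.+1%:R <= D%:R :> R by rewrite ler_nat; lia.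
  by rewrite -natr1; lra.
have : al l * D%:R <= al l * ((1 + r + K)%N%:R + 2^-1) by rewrite ler_nM2l.
by lra.
Qed.

(* Both parities of the distance are handled by one extra coordinate: the
   points 0, s0, s0 + s1 and s1 of the line carry the four parity classes. *)
Definition ext_x (px s0 s1 : R) : R := px * (s0 + s1).
Definition ext_y (py s0 s1 : R) : R := s0 + py * (s1 - s0).

(** By [levelE], base plus step times level is [(step / 2) d] plus a term depending only on the
    parity of [d]. The scaled coordinates give the first part. The extra coordinates differ by [s0]
    for even [d] and by [s1] for odd [d], up to sign. *)
Lemma embedding_dist (d t : nat) (px py : bool) : (t < D * K)%N ->
  odd d = px (+) py ->
  let s0 := Num.sqrt (fbase t) in
  let s1 := Num.sqrt (fbase t + fstep t * (2^-1 - parD%:R)) in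
  Num.sqrt (fstep t / 2) ^+ 2 * d%:R + (ext_x px%:R s0 s1 - ext_y py%:R s0 s1) ^+ 2
    = fpt t (level d).
Proof.
move=> /flat_index[lD rK] dE s0 s1.
have b0 : 0 <= fbase t.
  by have := tpt_range (q := 0) lD rK (leq0n _); rewrite /tpt mulr0 addr0 => /andP[].
have b1 := tbase_shift_ge0 lD rK.
have s0E : s0 ^+ 2 = fbase t by rewrite sqr_sqrtr.
have s1E : s1 ^+ 2 = fbase t + fstep t * (2^-1 - parD%:R) by rewrite sqr_sqrtr.
have -> : Num.sqrt (fstep t / 2) ^+ 2 = fstep t / 2.
  by rewrite sqr_sqrtr // divr_ge0 // normr_ge0.
have -> : (ext_x px%:R s0 s1 - ext_y py%:R s0 s1) ^+ 2 =
    fbase t + (odd d)%:R * (fstep t * (2^-1 - parD%:R)).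
  by rewrite dE /ext_x /ext_y; case: px {dE}; case: py => /=;
    rewrite ?mul1r ?mul0r ?addr0; [rewrite -s0E|rewrite -s1E|rewrite -s1E|rewrite -s0E]; ring.
rewrite /fpt /tpt -/(fbase t) -/(fstep t).
have := levelE d; set x := (odd d)%:R; set y := parD%:R; set z := (level d)%:R => e.
have -> : z = (d%:R + x * (1 - 2 * y)) / 2 by rewrite e mulrAC divff ?mul1r // pnatr_eq0.
by field.
Qed.

Variable M : 'M[R]_D.
Hypothesis M_unit : M \in unitmx.
Hypothesis M_entry : forall l p : 'I_D, M l p = f (c + al l * p.+1%:R).

Lemma test_mx_stability (h : 'cV[R]_K) (delta : R) :
  (forall t, `|(test_mx *m h) t 0| <= delta) ->
  forall q, `|h q 0| <= K%:R ^+ 2 * tau M * delta.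
Proof.
move=> small q; have qK := ltn_ord q; have K0 : (0 < K)%N by lia.
pose F (l : 'I_D) (p : nat) := f (c + al l * (pos0 + p)%N%:R).
pose up (l : 'I_D) := 0 <= al l.
pose hn (k : nat) := if insub k is Some k0 then h k0 0 else 0.
have hnE (k : 'I_K) : hn k = h k 0 by rewrite /hn valK.
have [p1 /(_ K0) p2] := pos0_bounds.
(* Positions count from 1 but columns of [M] from 0, hence the predecessor. *)
rewrite -hnE; apply: (@test_stability _ D K pos0.-1 M F up) => //; first lia.
  by move=> l j hj; rewrite M_entry /F; congr (f (_ + _ * _%:R)); lia.
move=> l r rK.
have tP : (l * K + r < D * K)%N by have := ltn_ord l; nia.
have := small (Ordinal tP); rewrite mxE /=; congr (`|_| <= _); apply: eq_bigr => k _.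
rewrite mxE hnE; congr (_ * _); rewrite /fdiff /fpt /= -/K.
rewrite divnMDl // modnMDl divn_small // modn_small // addn0.
have kK := ltn_ord k.
rewrite !tpt_point //; last exact: ltnW.
rewrite /test_entry /up /F; case: ifP => _; first by rewrite addnS.
by congr (_ - f (c + _ * _%:R)); lia.
Qed.

Lemma test_mx_inj (h : 'cV[R]_K) : test_mx *m h = 0 -> h = 0.
Proof.
move=> h0; apply/colP => q; rewrite mxE; apply/eqP; rewrite -normr_le0.
rewrite (le_trans (test_mx_stability (delta := 0) _ q)) ?mulr0 // => t.
by rewrite h0 mxE normr0.
Qed.

(** Least squares over [D K <= D^2] tests turns an error [eta] per test into at most [D eta] on the
    test values of the decoding error; stability converts this into a bound on its entries. *)
Lemma decode_error (b v : nat -> R) (eta : R) :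
  (forall t, (t < D * K)%N -> `|b t - \sum_(q < K) fdiff t q * v q| <= eta) ->
  forall q : 'I_K, `|\sum_(t < D * K) decode_mx q t * b t - v q|
    <= K%:R ^+ 2 * tau M * (D%:R * eta).
Proof.
move=> small q.
pose vc : 'cV[R]_K := \col_k v k; pose bc : 'cV[R]_(D * K) := \col_t b t.
pose e := bc - test_mx *m vc.
have e_le t : `|e t 0| <= eta.
  have := small t (ltn_ord t); rewrite !mxE; congr (`|_ - _| <= _).
  by apply: eq_bigr => k _; rewrite !mxE.
have K0 : (0 < K)%N by apply: leq_ltn_trans (ltn_ord q).
have DK0 : (0 < D * K)%N by rewrite muln_gt0 D_gt0.
have eta0 : 0 <= eta by apply: le_trans (e_le (Ordinal DK0)).
pose h := decode_mx *m (test_mx *m vc + e) - vc.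
have -> : \sum_(t < D * K) decode_mx q t * b t - v q = h q 0.
  rewrite /h /e [test_mx *m vc + _]addrC subrK !mxE; congr (_ - _).
  by apply: eq_bigr => t _; rewrite !mxE.
apply: test_mx_stability => t.
have := least_squares_error test_mx_inj vc e_le t; rewrite -/decode_mx -/h => h2.
rewrite -(@ler_pXn2r _ 2) ?nnegrE ?mulr_ge0 // real_normK ?num_real //.
apply: le_trans h2 _; rewrite exprMn ler_wpM2r ?sqr_ge0 // natrM expr2.
by rewrite ler_wpM2l // ler_nat /K /halfD leq_div.
Qed.

End TestData.

(** Bounds the total weight of a group by the block length. The truncated difference in the proof is
    the number of indices of the block below [n], which makes the induction go through. *)
Lemma sum_window (R : realType) (n a B : nat) (w : nat -> bool) :
  \sum_(j < n) (w j && (a <= j < a + B)%N)%:R <= B%:R :> R.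
Proof.
apply: le_trans (_ : (minn n (a + B) - minn n a)%N%:R <= _); last by rewrite ler_nat; lia.
elim: n => [|n IHn]; first by rewrite big_ord0.
rewrite big_ord_recr /=; apply: le_trans (lerD IHn (lexx _)) _; rewrite -natrD ler_nat.
by case: (w n); case: (leqP a n) => h1; case: (ltnP n (a + B)) => h2 /=; lia.
Qed.

(** * Set-up phase *)

Section Setup.
Variables (R : realType) (f : R -> R) (n m D : nat) (c : R) (al : nat -> R).
Variables (X Y : int -> int) (M : 'M[R]_D).
Implicit Types (P Q : program R) (s : state R).
Local Notation runs := (@runs R f).
Local Notation K := (halfD D).
Local Notation eps := (3 * n%:R * tau M)^-1.

Hypothesis n_gt0 : (0 < n)%N.
Hypothesis D_gt0 : (0 < D)%N.
Hypothesis range01 :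
  forall l p : nat, (l < D)%N -> (1 <= p <= D)%N -> 0 <= c + al l * p%:R <= 1.
Hypothesis M_unit : M \in unitmx.
Hypothesis M_entry : forall l p : 'I_D, M l p = f (c + al l * p.+1%:R).

Record input s : Prop := Input {
  in0 : ireg s 0 = n%:Z; in1 : ireg s 1 = m%:Z; in2 : ireg s 2 = D%:Z;
  in7 : ireg s 7 = D%:Z; in8 : ireg s 8 = (D ^ 3)%N%:Z; in11 : ireg s 11 = 1%:Z;
  in12 : ireg s 12 = m.+1%:Z; in14 : ireg s 14 = 2%:Z; in15 : ireg s 15 = 0%:Z;
  inc : rreg s 0 = c;
  inal : forall l : nat, (l < D)%N -> rarr s 0 l%:Z = al l;
  inX : iarr s 0 = X; inY : iarr s 1 = Y }.

(** Of [M] only the precision is retained, so the arrays of the inversion are free for reuse. *)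
Record env s : Prop := Env {
  env0 : ireg s 0 = n%:Z; env1 : ireg s 1 = m%:Z; env2 : ireg s 2 = D%:Z;
  env3 : ireg s 3 = K%:Z; env4 : ireg s 4 = (parD D)%:Z; env5 : ireg s 5 = (pos0 D c)%:Z;
  env6 : ireg s 6 = (D * K)%N%:Z; env9 : ireg s 9 = (n %/ D ^ 3)%N%:Z;
  env11 : ireg s 11 = 1%:Z; env12 : ireg s 12 = m.+1%:Z; env13 : ireg s 13 = K.+1%:Z;
  env14 : ireg s 14 = 2%:Z; env15 : ireg s 15 = 0%:Z; env17 : ireg s 17 = (2 * D ^ 3)%N%:Z;
  envc : rreg s 0 = c; enveps : rreg s 2 = eps;
  enval : forall l : nat, (l < D)%N -> rarr s 0 l%:Z = al l;
  envX : iarr s 0 = X; envY : iarr s 1 = Y }.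

Definition keeps_env P : bool :=
  [&& all (fun r => ~~ iwr P r) [:: 0; 1; 2; 3; 4; 5; 6; 9; 11; 12; 13; 14; 15; 17]%N,
      ~~ rwr P 0, ~~ rwr P 2, ~~ rawr P 0 & ~~ iawr P 0 && ~~ iawr P 1].

Lemma env_agree P s s' : keeps_env P -> agree P s s' -> env s -> env s'.
Proof.
case/and5P => /= /and4P[w0 w1 w2 /and4P[w3 w4 w5 /and4P[w6 w9 w11]]].
move=> /and5P[w12 w13 w14 w15 /andP[w17 _]] r0 r2 ra /andP[i0 i1] ag [] *.
by split; rewrite ?(agree_ireg ag) ?(agree_rreg ag) ?(agree_iarr ag) ?(agree_rarr ag).
Qed.

(** The machine has neither a move nor a skip instruction: adding register 15, which holds 0, copies
    an integer, and writing a scratch register such as 49 stands for doing nothing. *)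
Definition Consts : program R :=
  Seq (blk (IAdd R 70 2 15) [:: IConst R 71 2]) (Seq (Quot R)
 (Seq (blk (IAdd R 3 72 15) [:: IMul R 4 3 14; ISub R 4 2 4; IMul R 6 2 3;
        IAdd R 13 3 11; IConst R 5 1; IMul R 17 14 8; IAdd R 70 0 15; IAdd R 71 8 15])
 (Seq (Quot R) (Seq (blk (IAdd R 9 72 15) [:: RConst 3 0])
   (If (ILe 11 4) (If (RLe 3 0) (blk (IConst R 49 0) [::]) (blk (IConst R 5 2) [::]))
                  (blk (IConst R 49 0) [::])))))).

Definition Matrix : program R :=
  Seq (blk (IAdd R 10 2 15) [::])
    (Fill 10 2 2 (blk (IAdd R 48 24 11) [:: ROfInt R 41 48; RLoad R 42 0 20;
       RMul R 41 42 41; RAdd R 41 0 41; REval R 20 41])).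

Definition Precision : program R :=
  Seq (Inverse R) (Seq (Tau R)
    (blk (ROfInt R 41 0) [:: RConst 42 3; RMul R 41 42 41; RMul R 41 41 1; RConst 42 1;
       RDiv R 2 42 41])).

Lemma runs_precision s : input s ->
  runs (Seq Consts (Seq Matrix Precision)) s (14 * n + 300 * D.+1 ^ 3) env.
Proof.
move=> [s0 s1 s2 s7 s8 s11 s12 s14 s15 sc sal sX sY].
set c1 := (2 + (7 * D + 14 + (9 + (7 * n + 14 + (2 + 3)))))%N.
set c2 := (1 + (4 + D * (D * (6 + 5) + 8)))%N.
set c3 := (120 * D.+1 ^ 3 + (60 * D.+1 ^ 2 + 6))%N.
apply: (@runs_weaken _ _ _ _ (c1 + (c2 + c3)) _ env) => //.
  by rewrite /c1 /c2 /c3 !expnS expn0; nia.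
apply: runs_seq; apply: (@runs_weaken _ _ _ _ _ _ (fun s' =>
  [/\ ireg s' 3 = K, ireg s' 4 = parD D, ireg s' 5 = pos0 D c,
      ireg s' 6 = (D * K)%N & ireg s' 9 = (n %/ D ^ 3)%N /\
      (ireg s' 13 = K.+1 /\ ireg s' 17 = (2 * D ^ 3)%N)]) _ (leqnn _)).
  2: { rewrite /c1; apply/runs_seq/runs_blk => //.
    apply: runs_seq; apply: runs_weaken (runs_quot f (a := D) (b := 2) _ _ _) => //; last first.
      by rewrite /= !updE /= s2 s15 addr0.
    move=> t1 ag1 t1_72; apply/runs_seq/runs_blk => //.
    have h0 : ireg t1 0 = n := etrans (fI ag1 0%N) s0.
    have h2 : ireg t1 2 = D := etrans (fI ag1 2) s2.
    have h8 : ireg t1 8 = (D ^ 3)%N := etrans (fI ag1 8) s8.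
    have h11 : ireg t1 11 = 1 := etrans (fI ag1 11) s11.
    have h14 : ireg t1 14 = 2 := etrans (fI ag1 14) s14.
    have h15 : ireg t1 15 = 0 := etrans (fI ag1 15) s15.
    apply: runs_seq; apply: runs_weaken (runs_quot f (a := n) (b := (D ^ 3)%N) _ _ _) => //; last first.
    - by rewrite expn_gt0 D_gt0.
    - by rewrite -[LHS]/(ireg t1 8 + ireg t1 15) h8 h15 addr0.
    - by rewrite -[LHS]/(ireg t1 0 + ireg t1 15) h0 h15 addr0.
    move=> t2 ag2 t2_72; apply/runs_seq/runs_blk => //.
    set t3 := foldl _ _ _.
    have [DE e1] := halfD_parD D.
    have k3 : ireg t1 72 + ireg t1 15 = K by rewrite t1_72 h15 addr0.
    have g3 : ireg t3 3 = K by rewrite -k3; apply: (fI ag2 3).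
    have g4 : ireg t3 4 = parD D.
      transitivity (ireg t1 2 - (ireg t1 72 + ireg t1 15) * ireg t1 14); first exact: (fI ag2 4).
      by rewrite k3 h14 h2; lia.
    have g5 : ireg t3 5 = 1 := fI ag2 5.
    have g6 : ireg t3 6 = (D * K)%N.
      transitivity (ireg t1 2 * (ireg t1 72 + ireg t1 15)); first exact: (fI ag2 6).
      by rewrite k3 h2 PoszM.
    have g9 : ireg t3 9 = (n %/ D ^ 3)%N.
      by rewrite -[LHS]/(ireg t2 72 + ireg t2 15) t2_72 (fI ag2 15) -[ireg _ 15]/(ireg t1 15) h15 addr0.
    have g11 : ireg t3 11 = 1 := etrans (fI ag2 11) h11.
    have g13 : ireg t3 13 = K.+1.
      transitivity ((ireg t1 72 + ireg t1 15) + ireg t1 11); first exact: (fI ag2 13).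
      by rewrite k3 h11 -addn1 PoszD.
    have g17 : ireg t3 17 = (2 * D ^ 3)%N.
      transitivity (ireg t1 14 * ireg t1 8); first exact: (fI ag2 17).
      by rewrite h14 h8 PoszM.
    have gr : rreg t3 3 = 0 by [].
    have gr0 : rreg t3 0 = c.
      by rewrite -sc -(fR ag1 0%N); apply: (fR ag2 0%N).
    clearbody t3; apply: runs_if => /=; rewrite g11 g4 lez_nat => h.
      apply: runs_if => /=; rewrite gr gr0 => h'; apply: runs_blk => //=; rewrite !updE /=;
        by split=> //; rewrite ?g5 /pos0 h /= ltNge ?h' ?(negPf h').
    apply: runs_blk => //=; rewrite !updE /=; split=> //.
    by rewrite g5 /pos0 (negPf h). }
move=> t1 ag1 [t3 t4 t5 t6 [t9 [t13 t17]]].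
have h0 : ireg t1 0 = n := etrans (fI ag1 0%N) s0.
have h1 : ireg t1 1 = m := etrans (fI ag1 1%N) s1.
have h2 : ireg t1 2 = D := etrans (fI ag1 2) s2.
have h11 : ireg t1 11 = 1 := etrans (fI ag1 11) s11.
have h12 : ireg t1 12 = m.+1 := etrans (fI ag1 12) s12.
have h14 : ireg t1 14 = 2 := etrans (fI ag1 14) s14.
have h15 : ireg t1 15 = 0 := etrans (fI ag1 15) s15.
have hc : rreg t1 0 = c := etrans (fR ag1 0%N) sc.
have hal : forall l : nat, (l < D)%N -> rarr t1 0 l = al l.
  by move=> l lD; rewrite (fRA ag1 0%N) sal.
have hX : iarr t1 0 = X := etrans (fIA ag1 0%N) sX.
have hY : iarr t1 1 = Y := etrans (fIA ag1 1%N) sY.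
apply: runs_seq; apply: (@runs_weaken _ _ _ _ _ _ (fun s' =>
  stored_mx (rarr s' 10) M /\ ireg s' 10 = D) _ (leqnn _)).
  2: { rewrite /c2; apply/runs_seq/runs_blk => //.
    have e2 : ireg (foldl (fun s' => (step f)^~ s') (step f (IAdd R 10 2 15) t1) [::]) 2 = D by [].
    apply: runs_weaken (runs_fill (F := fun l p => f (c + al l * p.+1%:R)) e2 e2 _ _ _ _) => //.
      move=> t2 ag2 t2_10; split=> [i j|]; last by rewrite (fI ag2 10) /= !updE /= h2 h15 addr0.
      by rewrite t2_10 // M_entry.
    move=> l p t2 lD pD ag2 t2_20 t2_24 _; apply: runs_blk => //=; rewrite !updE /=.
    rewrite t2_24 t2_20 (fI ag2 11) (fR ag2 0%N) (fRA ag2 0%N) /= !updE /= h11 hc hal //.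
    by rewrite -PoszD addn1 -[(_ : int)%:~R]/(p.+1%:R) range01. }
move=> t2 ag2 [t2_10 d10].
apply: runs_seq; apply: runs_weaken (runs_inverse f (M := M) d10 _ _ t2_10 _) => //; last first.
- by rewrite (fI ag2 15).
- by rewrite (fI ag2 11).
move=> t4' ag4 t4_12.
apply: runs_seq; apply: runs_weaken (runs_tau f (M := M) D_gt0 _ _ t4_12) => //; last first.
- by rewrite (fI ag4 15) (fI ag2 15).
- by rewrite (fI ag4 10).
move=> t5' ag5 t5_1; apply: runs_blk => //=.
have fr r : ~~ iwr Matrix r -> ~~ iwr (Inverse R) r -> ~~ iwr (Tau R) r -> ireg t5' r = ireg t1 r.
  by move=> w1 w2 w3; rewrite (agree_ireg ag5) // (agree_ireg ag4) // (agree_ireg ag2).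
split; rewrite /= ?updE /= ?fr //.
- by rewrite (fR ag5 0%N) (fR ag4 0%N) (fR ag2 0%N).
- by rewrite t5_1 h0 div1r.
- by move=> l lD; rewrite (fRA ag5 0%N) (fRA ag4 0%N) (fRA ag2 0%N) hal.
- by rewrite (fIA ag5 0%N) (fIA ag4 0%N) (fIA ag2 0%N).
- by rewrite (fIA ag5 1%N) (fIA ag4 1%N) (fIA ag2 1%N).
Qed.


Record tables s : Prop := Tables {
  tab_base : forall t : nat, (t < D * K)%N -> rarr s 20 t%:Z = fbase D c al t;
  tab_step : forall t : nat, (t < D * K)%N -> rarr s 21 t%:Z = fstep D al t;
  tab_last : forall t : nat, (t < D * K)%N -> rarr s 23 t%:Z = f (fpt D c al t K);
  tab_decode : forall (q : 'I_K) (t : 'I_(D * K)),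
    rarr s 24 (q * (D * K) + t)%N%:Z = decode_mx f D c al q t }.

Definition BaseTable : program R :=
  Fill 20 2 3 (Seq (blk (RLoad R 41 0 20) [:: IAdd R 48 5 24; RConst 42 0])
    (Seq (If (RLe 42 41) (blk (IConst R 49 0) [::]) (blk (IAdd R 48 48 3) [::]))
         (blk (ROfInt R 42 48) [:: RMul R 42 41 42; RAdd R 20 0 42]))).

Definition StepTable : program R :=
  Fill 21 2 3 (blk (RLoad R 41 0 20) [:: RMul R 41 41 41; RSqrt R 20 41]).

Definition DiffTable : program R :=
  Fill 22 6 3 (blk (RLoad R 41 20 20) [:: RLoad R 42 21 20; ROfInt R 43 24;
    RMul R 43 42 43; RAdd R 43 41 43; REval R 44 43; IAdd R 48 24 11; ROfInt R 43 48;
    RMul R 43 42 43; RAdd R 43 41 43; REval R 43 43; RSub R 20 44 43]).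

Definition LastTable : program R :=
  Fill 23 11 6 (blk (RLoad R 41 20 24) [:: RLoad R 42 21 24; ROfInt R 43 3;
    RMul R 43 42 43; RAdd R 43 41 43; REval R 20 43]).

Definition GramTable : program R :=
  Fill 10 3 3 (Seq (blk (IAdd R 40 20 15)
      [:: IAdd R 41 3 15; IAdd R 42 24 15; IAdd R 43 3 15; IAdd R 44 6 15])
    (Seq (Dot R 22 22) (blk (RConst 41 0) [:: RAdd R 20 40 41]))).

Definition DecodeTable : program R :=
  Fill 24 3 6 (Seq (blk (IMul R 40 20 3)
      [:: IConst R 41 1; IMul R 42 24 3; IConst R 43 1; IAdd R 44 3 15])
    (Seq (Dot R 12 22) (blk (RConst 41 0) [:: RAdd R 20 40 41]))).

(** The inversion routine is used a second time, on the [K] by [K] Gram matrix of the tests, with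
    register 10 reset to the new dimension. *)
Definition TestTables : program R :=
  Seq BaseTable (Seq StepTable (Seq DiffTable (Seq LastTable
    (Seq (blk (IAdd R 10 3 15) [::]) (Seq GramTable (Seq (Inverse R) DecodeTable)))))).

Lemma flatE t : (t = t %/ K * K + t %% K)%N.
Proof. exact: divn_eq. Qed.

Let tables_cost (k : nat) : nat :=
  (4 + D * (k * (3 + (2 + 3) + 5) + 8) + (4 + D * (k * (3 + 5) + 8) +
   (4 + D * k * (k * (12 + 5) + 8) + (4 + 1 * (D * k * (6 + 5) + 8) +
   (1 + (4 + k * (k * (5 + (11 * (D * k) + 5 + 2) + 5) + 8) + (120 * k.+1 ^ 3 +
   (4 + k * (D * k * (5 + (11 * k + 5 + 2) + 5) + 8)))))))))%N.

Lemma tables_cost_le : (tables_cost K <= 400 * D.+1 ^ 4)%N.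
Proof.
have KD : (K <= D)%N by apply: leq_div.
(* Monotonicity replaces [K] by [D], leaving an inequality in one variable. *)
apply: (@leq_trans (tables_cost D)).
  by rewrite /tables_cost; repeat (apply: leq_add || apply: leq_mul ||
    rewrite leq_exp2r || exact: KD || exact: leqnn).
rewrite /tables_cost !expnS expn0; move: (D) => d; nia.
Qed.

Lemma runs_tables s : env s ->
  runs TestTables s (400 * D.+1 ^ 4) (fun s' => env s' /\ tables s').
Proof.
move=> e0.
apply: (runs_weaken tables_cost_le (fun _ _ => id)); rewrite /tables_cost.
apply: runs_seq.
apply: runs_weaken (runs_fill (F := fun l r => tbase D c al l r) (env2 e0) (env3 e0) _ _ _ _) => //; last first.
  move=> l r t1 lD rK ag1 t1_20 t1_24 _.
  have e1 := env_agree (isT : keeps_env BaseTable) ag1 e0.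
  apply/runs_seq/runs_blk => //.
  set t2 := foldl _ _ _.
  have g41 : rreg t2 41 = al l.
    by rewrite -[LHS]/(rarr t1 0 (ireg t1 20)) t1_20 (enval e1).
  have g48 : ireg t2 48 = (pos0 D c + r)%N.
    by rewrite -[LHS]/(ireg t1 5 + ireg t1 24) t1_24 (env5 e1) PoszD.
  have g42 : rreg t2 42 = 0 by [].
  have g3 : ireg t2 3 = K := env3 e1.
  have g0 : rreg t2 0 = c := envc e1.
  clearbody t2; apply: runs_seq; apply: (@runs_weaken _ _ _ _ _ _ (fun s' => ireg s' 48 =
    (if (0 <= al l)%R then pos0 D c + r else pos0 D c + r + K)%N%:Z) _ (leqnn _)).
    move=> t3 ag3 t3_48; apply: runs_blk => //.
    rewrite -[LHS]/(rreg t3 0 + rreg t3 41 * (ireg t3 48)%:~R) (fR ag3 0%N) (fR ag3 41).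
    by rewrite t3_48 g0 g41.
  apply: runs_if => /=; rewrite g41 g42 => h; apply: runs_blk => //=; rewrite !updE /=.
    by rewrite h.
  by rewrite (negPf h) g48 g3 PoszD.
move=> s1 ag1 tb20.
have {ag1} e1 := env_agree (isT : keeps_env BaseTable) ag1 e0.
have {tb20} tb20 t : (t < D * K)%N -> rarr s1 20 t%:Z = fbase D c al t.
  by move=> tT; have [lD rK] := flat_index tT; rewrite {1}(flatE t) tb20.
apply: runs_seq.
apply: runs_weaken (runs_fill (F := fun l r => `|al l|) (env2 e1) (env3 e1) _ _ _ _) => //; last first.
  move=> l r t1 lD rK ag1 t1_20 t1_24 _; apply: runs_blk => //.
  have e1' := env_agree (isT : keeps_env StepTable) ag1 e1.
  rewrite -[LHS]/(Num.sqrt (rarr t1 0 (ireg t1 20) * rarr t1 0 (ireg t1 20))) t1_20.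
  by rewrite (enval e1') // -expr2 sqrtr_sqr.
move=> s2 ag2 tb21.
have {tb21} tb21 t : (t < D * K)%N -> rarr s2 21 t%:Z = fstep D al t.
  by move=> tT; have [lD rK] := flat_index tT; rewrite {1}(flatE t) tb21.
have e2 := env_agree (isT : keeps_env StepTable) ag2 e1.
have {ag2} tb20 t : (t < D * K)%N -> rarr s2 20 t%:Z = fbase D c al t.
  by move=> tT; rewrite (fRA ag2 20) tb20.
have pt01 t q : (t < D * K)%N -> (q <= K)%N -> 0 <= fpt D c al t q <= 1.
  by move=> tT qK; have [lD rK] := flat_index tT; apply: tpt_range.
apply: runs_seq.
apply: runs_weaken (runs_fill (F := fun t q => fdiff f D c al t q) (env6 e2) (env3 e2) _ _ _ _) => //; last first.
  move=> t q t1 tT qK ag1 t1_20 t1_24 _; apply: runs_blk => //.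
  have e1' := env_agree (isT : keeps_env DiffTable) ag1 e2.
  pose b := rarr t1 20 (ireg t1 20); pose a := rarr t1 21 (ireg t1 20).
  pose ev z := if 0 <= z <= 1 then f z else 0.
  rewrite -[LHS]/(ev (b + a * (ireg t1 24)%:~R) - ev (b + a * (ireg t1 24 + ireg t1 11)%:~R)).
  rewrite t1_24 (env11 e1') /b /a t1_20 (fRA ag1 20) (fRA ag1 21) tb20 // tb21 //.
  by rewrite -PoszD addn1 /ev -!/(fpt D c al t _) !pt01 // ltnW.
move=> s3 ag3 tb22.
have e3 := env_agree (isT : keeps_env DiffTable) ag3 e2.
have {}tb20 t : (t < D * K)%N -> rarr s3 20 t%:Z = fbase D c al t.
  by move=> tT; rewrite (fRA ag3 20) tb20.
have {ag3} tb21 t : (t < D * K)%N -> rarr s3 21 t%:Z = fstep D al t.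
  by move=> tT; rewrite (fRA ag3 21) tb21.
apply: runs_seq.
apply: runs_weaken (runs_fill (F := fun _ t => f (fpt D c al t K)) (env11 e3) (env6 e3) _ _ _ _) => //; last first.
  move=> i t t1 _ tT ag1 t1_20 t1_24 _; apply: runs_blk => //.
  have e1' := env_agree (isT : keeps_env LastTable) ag1 e3.
  pose b := rarr t1 20 (ireg t1 24); pose a := rarr t1 21 (ireg t1 24).
  pose ev z := if 0 <= z <= 1 then f z else 0.
  rewrite -[LHS]/(ev (b + a * (ireg t1 3)%:~R)).
  rewrite (env3 e1') /b /a t1_24 (fRA ag1 20) (fRA ag1 21) tb20 // tb21 //.
  by rewrite /ev -!/(fpt D c al t _) pt01.
move=> s4 ag4 tb23.
have e4 := env_agree (isT : keeps_env LastTable) ag4 e3.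
have {tb23} tb23 t : (t < D * K)%N -> rarr s4 23 t%:Z = f (fpt D c al t K).
  by move=> tT; rewrite -(tb23 0%N t).
have {}tb22 t q : (t < D * K)%N -> (q < K)%N -> rarr s4 22 (t * K + q)%N%:Z = fdiff f D c al t q.
  by move=> tT qK; rewrite (fRA ag4 22) tb22.
have {}tb20 t : (t < D * K)%N -> rarr s4 20 t%:Z = fbase D c al t.
  by move=> tT; rewrite (fRA ag4 20) tb20.
have {ag4} tb21 t : (t < D * K)%N -> rarr s4 21 t%:Z = fstep D al t.
  by move=> tT; rewrite (fRA ag4 21) tb21.
apply/runs_seq/runs_blk => //; set s5 := foldl _ _ _.
have ag5 : agree (blk (IAdd R 10 3 15) [::]) s4 s5 := exec_agree (exec_instr f _ s4).
have e5 := env_agree (isT : keeps_env (blk (IAdd R 10 3 15) [::])) ag5 e4.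
have s5_10 : ireg s5 10 = K.
  by rewrite -[LHS]/(ireg s4 3 + ireg s4 15) (env3 e4) (env15 e4) addr0.
have a5 : rarr s5 = rarr s4 by [].
clearbody s5; move=> {ag5}.
set T := test_mx f D c al.
apply: runs_seq.
apply: runs_weaken (runs_fill (F := fun q r => \sum_(t < D * K) fdiff f D c al t q * fdiff f D c al t r)
  (env3 e5) (env3 e5) _ _ _ _) => //; last first.
  move=> q r t1 qK rK ag1 t1_20 t1_24 _.
  have e1' := env_agree (isT : keeps_env GramTable) ag1 e5.
  apply/runs_seq/runs_blk => //.
  apply: runs_seq; apply: runs_weaken (runs_dot f 22 22 (a0 := q) (sa := K) (b0 := r) (sb := K) (K := (D * K)%N) _ _ _ _ _) => //.
  - move=> t2 ag2 t2_40; apply: runs_blk => //; rewrite -[LHS]/(rreg t2 40 + 0) addr0 t2_40.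
    apply: eq_bigr => t _; rewrite -[rarr (foldl _ _ _)]/(rarr t1) (fRA ag1 22) a5.
    by rewrite ![(_ + t * K)%N]addnC !tb22.
  - by rewrite -[LHS]/(ireg t1 20 + ireg t1 15) t1_20 (env15 e1') addr0.
  - by rewrite -[LHS]/(ireg t1 3 + ireg t1 15) (env3 e1') (env15 e1') addr0.
  - by rewrite -[LHS]/(ireg t1 24 + ireg t1 15) t1_24 (env15 e1') addr0.
  - by rewrite -[LHS]/(ireg t1 3 + ireg t1 15) (env3 e1') (env15 e1') addr0.
  - by rewrite -[LHS]/(ireg t1 6 + ireg t1 15) (env6 e1') (env15 e1') addr0.
move=> s6 ag6 tG.
have e6 := env_agree (isT : keeps_env GramTable) ag6 e5.
have {tG} tG : stored_mx (rarr s6 10) (T^T *m T).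
  move=> q r; rewrite tG // mxE; apply: eq_bigr => t _; by rewrite !mxE.
have s6_10 : ireg s6 10 = K := etrans (fI ag6 10) s5_10.
have uG : T^T *m T \in unitmx by apply: gram_unit => h; apply: (test_mx_inj D_gt0 M_unit M_entry).
apply: runs_seq; apply: runs_weaken (runs_inverse f s6_10 (env11 e6) (env15 e6) tG uG) => //.
move=> s7 ag7 tI.
have e7 := env_agree (isT : keeps_env (Inverse R)) ag7 e6.
have a7 A : ~~ rawr GramTable A -> ~~ rawr (Inverse R) A -> rarr s7 A = rarr s4 A.
  by move=> w1 w2; rewrite (agree_rarr ag7) // (agree_rarr ag6) // a5.
apply: runs_weaken (runs_fill (F := fun q t => \sum_(p < K) rarr s7 12 (q * K + p)%N%:Z * fdiff f D c al t p)
  (env3 e7) (env6 e7) _ _ _ _) => //; last first.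
  move=> q t t1 qK tT ag1 t1_20 t1_24 _.
  have e1' := env_agree (isT : keeps_env DecodeTable) ag1 e7.
  apply/runs_seq/runs_blk => //.
  apply: runs_seq; apply: runs_weaken (runs_dot f 12 22 (a0 := (q * K)%N) (sa := 1) (b0 := (t * K)%N) (sb := 1) (K := K) _ _ _ _ _) => //.
  - move=> t2 ag2 t2_40; apply: runs_blk => //; rewrite -[LHS]/(rreg t2 40 + 0) addr0 t2_40.
    apply: eq_bigr => p _; rewrite -[rarr (foldl _ _ _)]/(rarr t1) (fRA ag1 12) (fRA ag1 22).
    by rewrite !muln1 (a7 22) // tb22.
  - by rewrite -[LHS]/(ireg t1 20 * ireg t1 3) t1_20 (env3 e1') -PoszM.
  - by rewrite -[LHS]/(ireg t1 24 * ireg t1 3) t1_24 (env3 e1') -PoszM.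
  - by rewrite -[LHS]/(ireg t1 3 + ireg t1 15) (env3 e1') (env15 e1') addr0.
move=> s8 ag8 tW.
split; first exact: env_agree (isT : keeps_env DecodeTable) ag8 e7.
split=> [t tT|t tT|t tT|q t].
- by rewrite (fRA ag8 20) (a7 20) ?tb20.
- by rewrite (fRA ag8 21) (a7 21) ?tb21.
- by rewrite (fRA ag8 23) (a7 23) ?tb23.
by rewrite tW // mxE; apply: eq_bigr => p _; rewrite (tI q p) !mxE.
Qed.

End Setup.

(** * Calls of the KDE program *)

Section Keep.
Variables (R : realType).
Implicit Types (P Q : program R).

(** The write sets of a program containing the abstract KDE program do not compute, so preservation
    is established compositionally, for explicit lists of cells. *)
Definition keep (Li Lr Lia Lra : seq nat) P : bool :=
  [&& all (fun r => ~~ iwr P r) Li, all (fun r => ~~ rwr P r) Lr,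
      all (fun r => ~~ iawr P r) Lia & all (fun r => ~~ rawr P r) Lra].

Lemma keep_seq Li Lr Lia Lra P Q : keep Li Lr Lia Lra P -> keep Li Lr Lia Lra Q ->
  keep Li Lr Lia Lra (Seq P Q).
Proof.
move=> /and4P[/allP a /allP b /allP c /allP d] /and4P[/allP a' /allP b' /allP c' /allP d'].
by apply/and4P; split; apply/allP => r h; rewrite /= negb_or;
  [rewrite a ?a'|rewrite b ?b'|rewrite c ?c'|rewrite d ?d'].
Qed.

Lemma keep_for Li Lr Lia Lra v N P :
  keep Li Lr Lia Lra (blk (IConst R v.+2 1) [:: ISub R v.+1 N v.+2; IConst R v 0]) ->
  keep Li Lr Lia Lra P -> keep Li Lr Lia Lra (For v N P).
Proof.
move=> h hP; apply: keep_seq => //.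
suff : keep Li Lr Lia Lra (Seq P (blk (IConst R v.+2 1) [:: IAdd R v v v.+2])) by [].
apply: keep_seq => //; move: h => /and4P[/allP a b c d].
apply/and4P; split=> //; apply/allP => r /a /=; rewrite !negb_or => /andP[/andP[-> _] ->] //.
Qed.

Lemma keep_sub Li Lr Lia Lra Li' Lr' Lia' Lra' P :
  [&& all (fun r => r \in Li) Li', all (fun r => r \in Lr) Lr',
      all (fun r => r \in Lia) Lia' & all (fun r => r \in Lra) Lra'] ->
  keep Li Lr Lia Lra P -> keep Li' Lr' Lia' Lra' P.
Proof.
move=> /and4P[/allP a /allP b /allP c /allP d] /and4P[/allP a' /allP b' /allP c' /allP d'].
by apply/and4P; split; apply/allP => r h;
  [exact/a'/a|exact/b'/b|exact/c'/c|exact/d'/d].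
Qed.

Lemma keep_shift Li Lr Lia Lra k P :
  all (fun r => (r < k)%N) (Li ++ Lr ++ Lia ++ Lra) -> keep Li Lr Lia Lra (shift_prog k P).
Proof.
rewrite !all_cat => /and4P[/allP a /allP b /allP c /allP d].
by apply/and4P; split; apply/allP => r h;
  [have [-> ]:= shift_writes P (a _ h)|have [_ -> ]:= shift_writes P (b _ h)
  |have [_ _ -> ]:= shift_writes P (c _ h)|have [_ _ _ -> ]:= shift_writes P (d _ h)].
Qed.

Lemma keep_ireg Li Lr Lia Lra P s s' r : keep Li Lr Lia Lra P -> agree P s s' ->
  r \in Li -> ireg s' r = ireg s r.
Proof. by move=> /and4P[/allP a _ _ _] ag h; rewrite (agree_ireg ag) ?a. Qed.

Lemma keep_rreg Li Lr Lia Lra P s s' r : keep Li Lr Lia Lra P -> agree P s s' ->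
  r \in Lr -> rreg s' r = rreg s r.
Proof. by move=> /and4P[_ /allP a _ _] ag h; rewrite (agree_rreg ag) ?a. Qed.

Lemma keep_rarr Li Lr Lia Lra P s s' r : keep Li Lr Lia Lra P -> agree P s s' ->
  r \in Lra -> rarr s' r = rarr s r.
Proof. by move=> /and4P[_ _ _ /allP a] ag h; rewrite (agree_rarr ag) ?a. Qed.

End Keep.

Lemma blk_agree (R : realType) (f : R -> R) i l (s : state R) :
  agree (blk i l) s (foldl (fun s' j => step f j s') (step f i s) l).
Proof.
set s1 := foldl _ _ _.
have [t [s' [ex _ <-]]] := runs_blk (Post := fun z => z = s1) (ltnSn (size l)) erefl.
exact: exec_agree ex.
Qed.

(** * From a single test to the search over all blocks *)

Section Loop.
Variables (R : realType) (f : R -> R) (n m D : nat) (c : R) (al : nat -> R).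
Variables (X Y : int -> int) (M : 'M[R]_D).
Variables (Pk : program R) (TT : nat).
Implicit Types (P Q : program R) (s : state R).
Local Notation runs := (@runs R f).
Local Notation K := (halfD D).
Local Notation eps := (3 * n%:R * tau M)^-1.
Local Notation d := (ndist m X Y).
Local Notation env := (env n m c al X Y M).
Local Notation tables := (tables f D c al).
Local Notation fpt := (fpt D c al).

Hypothesis n_gt0 : (0 < n)%N.
Hypothesis D_gt0 : (0 < D)%N.
Hypothesis range01 :
  forall l p : nat, (l < D)%N -> (1 <= p <= D)%N -> 0 <= c + al l * p%:R <= 1.
Hypothesis M_unit : M \in unitmx.
Hypothesis M_entry : forall l p : 'I_D, M l p = f (c + al l * p.+1%:R).
Hypothesis dist_le : forall i j, (i < n)%N -> (j < n)%N -> (d i j <= D)%N.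
Hypothesis kde_ok : forall (x y : 'M[R]_(n, m.+1)) (u : 'cV[R]_n) s,
  (forall i j : 'I_n, sqnorm (row i x - row j y) <= 1) ->
  KDE_input eps x y u s ->
  exists (t : nat) (s' : state R) (v : 'cV[R]_n),
    [/\ exec f Pk s t s', (t <= TT)%N, stored_cv (rarr s' 3) v &
        KDE_solution f eps x y u v].

Definition parx (i : nat) : bool := odd (d i 0).
Definition pary (j : nat) : bool := odd (d 0 j + d 0 0).

Record ready s : Prop := Ready {
  ready_env : env s; ready_tables : tables s;
  ready_x : forall i, (i < n)%N -> rarr s 25 i%:Z = (parx i)%:R;
  ready_y : forall j, (j < n)%N -> rarr s 26 j%:Z = (pary j)%:R }.

Definition ready_iregs := [:: 0; 1; 2; 3; 4; 5; 6; 9; 11; 12; 13; 14; 15; 17]%N.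
Definition ready_rarrs := [:: 0; 20; 21; 23; 24; 25; 26]%N.
Local Notation keep_ready li lr lra :=
  (keep (ready_iregs ++ li) ([:: 0; 2]%N ++ lr) [:: 0; 1]%N (ready_rarrs ++ lra)).

Lemma ready_agree li lr lra P s s' :
  keep_ready li lr lra P -> agree P s s' -> ready s -> ready s'.
Proof.
move=> kP ag [e [tb ts tl td] rx ry]; split.
- apply: (env_agree _ ag) e; move: kP => /and4P[/allP kI /allP kR /allP kIA /allP kRA].
  apply/and5P; split; [|exact: kR|exact: kR|exact: kRA|by rewrite !kIA].
  by apply/allP => r hr; apply: kI; rewrite mem_cat hr.
- by split=> *; rewrite (keep_rarr kP ag) ?mem_cat ?tb ?ts ?tl ?td.
- by move=> *; rewrite (keep_rarr kP ag) ?mem_cat ?rx.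
- by move=> *; rewrite (keep_rarr kP ag) ?mem_cat ?ry.
Qed.

(* The KDE program runs in the registers and arrays numbered from 100, so its
   input arrays 0, 1, 2 are 100, 101, 102 here and its output array is 103. *)
Definition Coefficients : program R :=
  blk (RLoad R 41 20 62) [:: RLoad R 42 21 62; RConst 43 2; RDiv R 43 42 43; RSqrt R 6 43;
    RSqrt R 7 41; ROfInt R 44 4; RConst 43 2^-1; RSub R 43 43 44; RMul R 43 42 43;
    RAdd R 43 41 43; RSqrt R 8 43; RLoad R 9 23 62].

Definition PointsX : program R :=
  Fill 100 0 12 (Seq (blk (IAdd R 82 24 11) [::])
    (If (ILe 82 1)
      (blk (IMul R 83 20 1) [:: IAdd R 83 83 24; ILoad R 83 0 83; ROfInt R 41 83;
         RMul R 20 6 41])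
      (blk (RLoad R 41 25 20) [:: RAdd R 42 7 8; RMul R 20 41 42]))).

Definition PointsY : program R :=
  Fill 101 0 12 (Seq (blk (IAdd R 82 24 11) [::])
    (If (ILe 82 1)
      (blk (IMul R 83 20 1) [:: IAdd R 83 83 24; ILoad R 83 1 83; ROfInt R 41 83;
         RMul R 20 6 41])
      (blk (RLoad R 41 26 20) [:: RSub R 42 8 7; RMul R 41 41 42; RAdd R 20 7 41]))).

Definition Weights : program R := Fill 102 11 0 (blk (RLoad R 20 27 24) [::]).

Definition Update : program R :=
  Fill 28 0 3 (blk (IMul R 83 24 6) [:: IAdd R 83 83 62; RLoad R 41 24 83;
    RLoad R 42 103 20; RMul R 43 5 9; RSub R 42 42 43; RMul R 41 41 42; IMul R 83 20 3;
    IAdd R 83 83 24; RLoad R 42 28 83; RAdd R 20 42 41]).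

Definition Test : program R :=
  Seq Coefficients (Seq PointsX (Seq PointsY (Seq Weights
    (Seq (blk (IAdd R 100 0 15) [:: IAdd R 101 12 15; RConst 41 0; RAdd R 100 2 41])
      (Seq (shift_prog 100 Pk) Update))))).

Definition emb (sq : R) (ext : nat -> R) (Z : int -> int) (i k : nat) : R :=
  if (k < m)%N then sq * (Z (i * m + k)%N%:Z)%:~R else ext i.

Lemma emb_sqnorm (t : nat) (i j : 'I_n) : (t < D * K)%N ->
  let sq := Num.sqrt (fstep D al t / 2) in
  let s0 := Num.sqrt (fbase D c al t) in
  let s1 := Num.sqrt (fbase D c al t + fstep D al t * (2^-1 - (parD D)%:R)) in
  let x := \matrix_(i < n, k < m.+1) emb sq (fun i => ext_x (parx i)%:R s0 s1) X i k in
  let y := \matrix_(i < n, k < m.+1) emb sq (fun i => ext_y (pary i)%:R s0 s1) Y i k in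
  sqnorm (row i x - row j y) = fpt t (level D (d i j)).
Proof.
move=> tT sq s0 s1 x y.
rewrite -(embedding_dist D_gt0 range01 tT (odd_ndist m X Y i j)) -/sq -/s0 -/s1.
rewrite /sqnorm big_ord_recr /= !mxE /emb ltnn; congr (_ + _).
rewrite -[(d i j)%:R]/((d i j)%:Z%:~R) -adistE /adist rmorph_sum mulr_sumr.
apply: eq_bigr => k _; rewrite !mxE /emb /= ltn_ord rmorphXn rmorphB /=; ring.
Qed.

(** The answer of a test, less its exact boundary term, is added at once to the estimates with its
    decoding coefficient, so the answers of different tests need not be stored. *)
Lemma runs_test (u : nat -> R) (t : nat) s :
  ready s -> (t < D * K)%N -> ireg s 62 = t%:Z -> (forall j, (j < n)%N -> 0 <= u j) ->
  (forall j, (j < n)%N -> rarr s 27 j%:Z = u j) ->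
  rreg s 5 = \sum_(j < n) u j ->
  runs Test s (TT + 100 * n * (m.+1 + K.+1)) (fun s' => exists v : nat -> R,
    (forall i, (i < n)%N ->
      `|v i - \sum_(j < n) f (fpt t (level D (d i j))) * u j| <= eps * \sum_(j < n) u j) /\
    (forall i q, (i < n)%N -> (q < K)%N -> rarr s' 28 (i * K + q)%N%:Z =
       rarr s 28 (i * K + q)%N%:Z + rarr s 24 (q * (D * K) + t)%N%:Z *
         (v i - (\sum_(j < n) u j) * f (fpt t K)))).
Proof.
move=> rs tT s62 u0 s27 s5.
set sq := Num.sqrt (fstep D al t / 2).
set s0 := Num.sqrt (fbase D c al t).
set s1 := Num.sqrt (fbase D c al t + fstep D al t * (2^-1 - (parD D)%:R)).
set x := \matrix_(i < n, k < m.+1) emb sq (fun i => ext_x (parx i)%:R s0 s1) X i k.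
set y := \matrix_(i < n, k < m.+1) emb sq (fun i => ext_y (pary i)%:R s0 s1) Y i k.
have dE (i j : 'I_n) : sqnorm (row i x - row j y) = fpt t (level D (d i j)).
  exact: emb_sqnorm.
apply: (@runs_weaken _ _ _ _ (13 + ((4 + n * (m.+1 * ((1 + 6) + 5) + 8)) +
  ((4 + n * (m.+1 * ((1 + 6) + 5) + 8)) + ((4 + 1 * (n * (1 + 5) + 8)) + (4 +
  (TT + (4 + n * (K * (11 + 5) + 8)))))))) _ _ _ _ (fun _ _ => id)); first by nia.
apply/runs_seq/runs_blk => //; set t1 := foldl _ _ _.
have ag1 : agree Coefficients s t1 := blk_agree f _ _ s.
have r1 : ready t1 := ready_agree (isT : keep_ready [::] [::] [::] Coefficients) ag1 rs.
have [eb [tb ts tl td] _ _] := rs.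
have t1_6 : rreg t1 6 = sq.
  by rewrite -[LHS]/(Num.sqrt (rarr s 21 (ireg s 62) / 2)) s62 ts.
have t1_7 : rreg t1 7 = s0.
  by rewrite -[LHS]/(Num.sqrt (rarr s 20 (ireg s 62))) s62 tb.
have t1_8 : rreg t1 8 = s1.
  rewrite -[LHS]/(Num.sqrt (rarr s 20 (ireg s 62) + rarr s 21 (ireg s 62) *
     (2^-1 - (ireg s 4)%:~R))) s62 tb // ts // (env4 eb) //.
have t1_9 : rreg t1 9 = f (fpt t K).
  by rewrite -[LHS]/(rarr s 23 (ireg s 62)) s62 tl.
have t1_5 : rreg t1 5 = \sum_(j < n) u j := etrans (fR ag1 5) s5.
have t1_62 : ireg t1 62 = t := etrans (fI ag1 62) s62.
have a1 : rarr t1 = rarr s by [].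
clearbody t1; move=> {eb tb ts tl td ag1}.
apply: runs_seq.
apply: runs_weaken (runs_fill (F := emb sq (fun i => ext_x (parx i)%:R s0 s1) X)
  (env0 (ready_env r1)) (env12 (ready_env r1)) _ _ _ _) => //; last first.
  move=> i k z1 lin km ag z1_20 z1_24 _.
  have r2 : ready z1 := ready_agree (isT : keep_ready [::] [::] [::] PointsX) ag r1.
  have e2 := ready_env r2.
  apply/runs_seq/runs_blk => //; set z2 := foldl _ _ _.
  have z82 : ireg z2 82 = k.+1.
    by rewrite -[LHS]/(ireg z1 24 + ireg z1 11) z1_24 (env11 e2) -PoszD addn1.
  have z2_1 : ireg z2 1 = m := env1 e2.
  have hE : holds (ILe 82 1) z2 = (k < m)%N.
    by rewrite -[LHS]/(ireg z2 82 <= ireg z2 1) z82 z2_1.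
  apply: runs_if; rewrite hE => h; apply: runs_blk => //.
    rewrite -[LHS]/(rreg z1 6 * (iarr z1 0 (ireg z1 20 * ireg z1 1 + ireg z1 24))%:~R).
    by rewrite (fR ag 6) t1_6 z1_20 z1_24 (env1 e2) (envX e2) -PoszM -PoszD /emb h.
  rewrite -[LHS]/(rarr z1 25 (ireg z1 20) * (rreg z1 7 + rreg z1 8)).
  by rewrite (fR ag 7) (fR ag 8) t1_7 t1_8 z1_20 (ready_x r2) // /emb (negPf h).
move=> t2 ag2 t2_100.
have r2 : ready t2 := ready_agree (isT : keep_ready [::] [::] [::] PointsX) ag2 r1.
apply: runs_seq.
apply: runs_weaken (runs_fill (F := emb sq (fun i => ext_y (pary i)%:R s0 s1) Y)
  (env0 (ready_env r2)) (env12 (ready_env r2)) _ _ _ _) => //; last first.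
  move=> i k z1 lin km ag z1_20 z1_24 _.
  have r3 : ready z1 := ready_agree (isT : keep_ready [::] [::] [::] PointsY) ag r2.
  have e3 := ready_env r3.
  apply/runs_seq/runs_blk => //; set z2 := foldl _ _ _.
  have z82 : ireg z2 82 = k.+1.
    by rewrite -[LHS]/(ireg z1 24 + ireg z1 11) z1_24 (env11 e3) -PoszD addn1.
  have z2_1 : ireg z2 1 = m := env1 e3.
  have hE : holds (ILe 82 1) z2 = (k < m)%N.
    by rewrite -[LHS]/(ireg z2 82 <= ireg z2 1) z82 z2_1.
  apply: runs_if; rewrite hE => h; apply: runs_blk => //.
    rewrite -[LHS]/(rreg z1 6 * (iarr z1 1 (ireg z1 20 * ireg z1 1 + ireg z1 24))%:~R).
    rewrite (fR ag 6) (fR ag2 6) t1_6 z1_20 z1_24 (env1 e3) (envY e3) -PoszM -PoszD.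
    by rewrite /emb h.
  rewrite -[LHS]/(rreg z1 7 + rarr z1 26 (ireg z1 20) * (rreg z1 8 - rreg z1 7)).
  rewrite (fR ag 7) (fR ag 8) (fR ag2 7) (fR ag2 8) t1_7 t1_8 z1_20 (ready_y r3) //.
  by rewrite /emb (negPf h).
move=> t3 ag3 t3_101.
have r3 : ready t3 := ready_agree (isT : keep_ready [::] [::] [::] PointsY) ag3 r2.
apply: runs_seq.
apply: runs_weaken (runs_fill (F := fun _ j => u j) (env11 (ready_env r3))
  (env0 (ready_env r3)) _ _ _ _) => //; last first.
  move=> i j z1 _ jn ag _ z1_24 _; apply: runs_blk => //.
  rewrite -[LHS]/(rarr z1 27 (ireg z1 24)) z1_24 (fRA ag 27) (fRA ag3 27) (fRA ag2 27).
  by rewrite a1 s27.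
move=> t4 ag4 t4_102.
have r4 : ready t4 := ready_agree (isT : keep_ready [::] [::] [::] Weights) ag4 r3.
apply/runs_seq/runs_blk => //; set t5 := foldl _ _ _.
have ag5 : agree (blk (IAdd R 100 0 15) [:: IAdd R 101 12 15; RConst 41 0; RAdd R 100 2 41]) t4 t5
  := blk_agree f _ _ t4.
have r5 : ready t5 := ready_agree (isT : keep_ready [::] [::] [::]
  (blk (IAdd R 100 0 15) [:: IAdd R 101 12 15; RConst 41 0; RAdd R 100 2 41])) ag5 r4.
have [tk [s6w [v [ex6 le6 v6 sol6]]]] : exists (tk : nat) (s' : state R) (v : 'cV[R]_n),
    [/\ exec f Pk (window 100 t5) tk s', (tk <= TT)%N, stored_cv (rarr s' 3) v &
        KDE_solution f eps x y (\col_j u j) v].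
  apply: kde_ok => [i j|].
    rewrite dE; have [lD rK] := flat_index tT.
    by have /andP[] := tpt_range D_gt0 range01 lD rK (level_le (dist_le (ltn_ord i) (ltn_ord j))).
  split; split.
  - by rewrite -[LHS]/(ireg t4 0 + ireg t4 15) (env0 (ready_env r4)) (env15 (ready_env r4)) addr0.
  - by rewrite -[LHS]/(ireg t4 12 + ireg t4 15) (env12 (ready_env r4)) (env15 (ready_env r4)) addr0.
  - by rewrite -[LHS]/(rreg t4 2 + 0) (enveps (ready_env r4)) addr0.
  - move=> i k; rewrite -[LHS]/(rarr t4 100 (i * m.+1 + k)%N%:Z) mxE.
    by rewrite (fRA ag4 100) (fRA ag3 100) t2_100.
  - move=> i k; rewrite -[LHS]/(rarr t4 101 (i * m.+1 + k)%N%:Z) mxE.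
    by rewrite (fRA ag4 101) t3_101.
  - by move=> j; rewrite -[LHS]/(rarr t4 102 (j : nat)%:Z) mxE -(t4_102 0%N j).
have [t6 ex6' w6] := exec_shift ex6 erefl.
apply: runs_seq; exists tk, t6; split=> //.
have ag6 := exec_agree ex6'.
(* All cells to be preserved are numbered below 100, so nothing about [Pk] is needed. *)
have k6 : keep_ready [:: 62]%N [:: 5; 9]%N [:: 28]%N (shift_prog 100 Pk) by apply: keep_shift.
have r6 : ready t6 := ready_agree k6 ag6 r5.
have t6_103 (i : 'I_n) : rarr t6 103 (i : nat)%:Z = v i 0.
  by rewrite -v6 -w6.
have t6_28 : rarr t6 28 = rarr s 28.
  by rewrite (keep_rarr k6 ag6) // (fRA ag5 28) (fRA ag4 28) (fRA ag3 28) (fRA ag2 28) a1.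
have t6_24 : rarr t6 24 = rarr s 24.
  by rewrite (keep_rarr k6 ag6) // (fRA ag5 24) (fRA ag4 24) (fRA ag3 24) (fRA ag2 24) a1.
have t6_5 : rreg t6 5 = \sum_(j < n) u j.
  by rewrite (keep_rreg k6 ag6) // (fR ag5 5) (fR ag4 5) (fR ag3 5) (fR ag2 5).
have t6_9 : rreg t6 9 = f (fpt t K).
  by rewrite (keep_rreg k6 ag6) // (fR ag5 9) (fR ag4 9) (fR ag3 9) (fR ag2 9).
have t6_62 : ireg t6 62 = t.
  by rewrite (keep_ireg k6 ag6) // (fI ag5 62) (fI ag4 62) (fI ag3 62) (fI ag2 62).
pose vn (i : nat) := rarr t6 103 i%:Z.
apply: runs_weaken (runs_fill (F := fun i q => rarr s 28 (i * K + q)%N%:Z +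
    rarr s 24 (q * (D * K) + t)%N%:Z * (vn i - (\sum_(j < n) u j) * f (fpt t K)))
  (env0 (ready_env r6)) (env3 (ready_env r6)) _ _ _ _) => //; last first.
  move=> i q z1 lin qK ag z1_20 z1_24 z1_28; apply: runs_blk => //.
  have r7 : ready z1 := ready_agree (isT : keep_ready [::] [::] [::] Update) ag r6.
  have e7 := ready_env r7.
  rewrite -[LHS]/(rarr z1 28 (ireg z1 20 * ireg z1 3 + ireg z1 24) +
    rarr z1 24 (ireg z1 24 * ireg z1 6 + ireg z1 62) *
    (rarr z1 103 (ireg z1 20) - rreg z1 5 * rreg z1 9)).
  rewrite z1_20 z1_24 (env3 e7) (env6 e7) (fI ag 62) t6_62 -!PoszM -!PoszD z1_28.
  by rewrite t6_28 (fRA ag 24) t6_24 (fRA ag 103) (fR ag 5) (fR ag 9) t6_5 t6_9.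
move=> t7 _ t7_28; exists vn; split=> [i lin|i q lin qK]; last exact: t7_28.
have := le_trans (linfnorm_ge _ (Ordinal lin)) sol6.
rewrite !mxE -t6_103; congr (_ <= _).
  congr (`|_ - _|); apply: eq_bigr => j _; rewrite !mxE; congr (f _ * _).
  exact: (dE (Ordinal lin) j).
congr (_ * _); apply: eq_bigr => j _; rewrite mxE ger0_norm //; exact: u0.
Qed.

Local Notation B := (n %/ D ^ 3)%N.

(** Within a group the parity of [d i j] depends on [i] alone, so the level determines the distance;
    the index block limits the total weight. *)
Definition grp (p b j : nat) : bool :=
  (pary j == p :> nat) && (b * B <= j < b * B + B)%N.

Definition Group : program R :=
  Fill 27 11 0
    (Seq (blk (IMul R 80 58 9) [:: IAdd R 81 80 9; IAdd R 82 24 11; RLoad R 41 26 24;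
           ROfInt R 42 54; RSub R 41 41 42; RMul R 41 41 41; RConst 42 0; RConst 20 0])
      (If (ILe 80 24)
        (If (ILe 82 81)
          (If (RLe 41 42) (blk (RConst 20 1) [::]) (blk (IConst R 92 0) [::]))
          (blk (IConst R 92 0) [::]))
        (blk (IConst R 92 0) [::]))).

(** The weights are 0 or 1, so their sum is their inner product with themselves. *)
Definition GroupSize : program R :=
  Seq (blk (IConst R 40 0) [:: IConst R 41 1; IConst R 42 0; IConst R 43 1; IAdd R 44 0 15])
    (Seq (Dot R 27 27) (blk (RConst 41 0) [:: RAdd R 5 40 41])).

Definition Estimates : program R :=
  Seq (Fill 28 0 3 (blk (RConst 20 0) [::])) (For 62 6 Test).

Definition Candidate : program R :=
  Seq (If (ILe 3 88) (blk (RConst 41 0) [:: RAdd R 42 5 41])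
          (blk (IMul R 83 84 3) [:: IAdd R 83 83 88; RLoad R 42 28 83]))
   (Seq (blk (RConst 41 2^-1) [:: RLoad R 43 25 84; ROfInt R 44 54; RSub R 43 43 44;
           RMul R 43 43 43; RConst 44 0; IMul R 80 14 88; IMul R 81 14 4; ISub R 81 81 11])
   (Seq (If (RLe 43 44) (blk (IConst R 92 0) [::]) (blk (IAdd R 80 80 81) [::]))
     (If (RLe 41 42) (If (ILe 80 7) (blk (IAdd R 7 80 15) [::]) (blk (IConst R 92 0) [::]))
        (blk (IConst R 92 0) [::])))).

Definition Candidates : program R := For 84 0 (For 88 13 Candidate).

(** Tests are non-strict comparisons, so equality is checked as nonpositivity of a square. *)
Lemma eq_bool_nat_sqr (b : bool) (p : nat) :
  (((b%:R : R) - p%:~R) * (b%:R - p%:~R) <= 0) = (b == p :> nat).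
Proof.
rewrite -expr2 -[p%:~R]/(p%:R) le_eqVlt ltNge sqr_ge0 orbF sqrf_eq0.
by rewrite subr_eq0 eqr_nat.
Qed.

Lemma runs_group (p b : nat) s : ready s -> ireg s 54 = p%:Z -> ireg s 58 = b%:Z ->
  runs Group s (30 * n + 12) (fun s' =>
    forall j, (j < n)%N -> rarr s' 27 j%:Z = (grp p b j)%:R).
Proof.
move=> rs s54 s58; rewrite (_ : 30 * n + 12 = 4 + 1 * (n * (25 + 5) + 8))%N; last by lia.
apply: runs_weaken (runs_fill (F := fun _ j => (grp p b j)%:R) (env11 (ready_env rs))
  (env0 (ready_env rs)) _ _ _ _) => //.
  by move=> s' _ h j jn; rewrite -(h 0%N j).
move=> i j z _ jn ag _ z24 _.
have rz : ready z := ready_agree (isT : keep_ready [::] [::] [::] Group) ag rs.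
have ez := ready_env rz.
have z58 : ireg z 58 = b := etrans (fI ag 58) s58.
have z54 : ireg z 54 = p := etrans (fI ag 54) s54.
rewrite (_ : 25 = 9 + 16)%N //.
apply/runs_seq/runs_blk => //; set z2 := foldl _ _ _.
have g80 : ireg z2 80 = (b * B)%N.
  by rewrite -[LHS]/(ireg z 58 * ireg z 9) z58 (env9 ez) -PoszM.
have g81 : ireg z2 81 = (b * B + B)%N.
  by rewrite -[LHS]/(ireg z 58 * ireg z 9 + ireg z 9) z58 (env9 ez) -PoszM -PoszD.
have g82 : ireg z2 82 = j.+1.
  by rewrite -[LHS]/(ireg z 24 + ireg z 11) z24 (env11 ez) -PoszD addn1.
have g24 : ireg z2 24 = j := z24.
have g41 : (rreg z2 41 <= rreg z2 42) = (pary j == p :> nat).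
  rewrite -eq_bool_nat_sqr -(ready_y rz jn) -z24 -z54.
  by [].
have g20 : rreg z2 20 = 0 by [].
clearbody z2.
apply: (runs_weaken (t := 4) _ (fun _ _ => id)) => //.
apply: runs_if => /=; rewrite g80 g24 lez_nat => h1; last first.
  by apply: runs_blk => //=; rewrite g20 /grp (negPf h1) andbF.
apply: runs_if => /=; rewrite g81 g82 lez_nat => h2; last first.
  by apply: runs_blk => //=; rewrite g20 /grp (negPf h2) !andbF.
apply: runs_if => /=; rewrite g41 => h3; apply: runs_blk => //=.
  by rewrite /grp h1 h2 h3.
by rewrite g20 /grp (negPf h3).
Qed.

Lemma runs_group_size (u : nat -> bool) s : ready s ->
  (forall j, (j < n)%N -> rarr s 27 j%:Z = (u j)%:R) ->
  runs GroupSize s (11 * n + 12) (fun s' => rreg s' 5 = \sum_(j < n) (u j)%:R).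
Proof.
move=> rs s27; rewrite (_ : 11 * n + 12 = 5 + (11 * n + 5 + 2))%N; last by lia.
have es := ready_env rs.
apply/runs_seq/runs_blk => //.
apply: runs_seq; apply: runs_weaken (runs_dot f 27 27 (a0 := 0%N) (sa := 1) (b0 := 0%N) (sb := 1) (K := n) _ _ _ _ _) => //.
  move=> z ag z40; apply: runs_blk => //; rewrite -[LHS]/(rreg z 40 + 0) addr0 z40.
  apply: eq_bigr => j _; rewrite muln1 add0n -[rarr (foldl _ _ _)]/(rarr s) s27 //.
  by case: (u j); rewrite ?mulr1 ?mulr0.
by rewrite -[LHS]/(ireg s 0 + ireg s 15) (env0 es) (env15 es) addr0.
Qed.

Lemma keep_test : keep_ready [:: 54; 58; 62; 63; 7; 55; 59]%N [:: 5]%N [:: 27]%N Test.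
Proof.
do 5!(apply: keep_seq; first by []); apply: keep_seq => //.
by apply: keep_shift.
Qed.

Lemma keep_estimates : keep_ready [:: 54; 58; 7; 55; 59]%N [:: 5]%N [:: 27]%N Estimates.
Proof.
apply: keep_seq => //; apply: keep_for => //.
by apply: (fun h => keep_sub h keep_test).
Qed.

Definition count_le (u : nat -> bool) (i q : nat) : R :=
  \sum_(j < n) (level D (d i j) <= q)%N%:R * (u j)%:R.

Lemma runs_estimates (u : nat -> bool) s : ready s ->
  (forall j, (j < n)%N -> rarr s 27 j%:Z = (u j)%:R) ->
  rreg s 5 = \sum_(j < n) (u j)%:R ->
  (\sum_(j < n) (u j)%:R <= (n %/ D ^ 3)%N%:R :> R) -> (D ^ 3 <= n)%N ->
  runs Estimates s ((D * K) * (TT + 110 * n * (m.+1 + K.+1)) + 30 * n * K.+1)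
    (fun s' => forall i q : nat, (i < n)%N -> (q < K)%N ->
       `|rarr s' 28 (i * K + q)%N%:Z - count_le u i q| < 2^-1).
Proof.
move=> rs s27 s5 uB Dn.
apply: (@runs_weaken _ _ _ _ ((4 + n * (K * (1 + 5) + 8)) +
  (4 + (D * K) * ((TT + 100 * n * (m.+1 + K.+1)) + 3)))%N _ (fun s' =>
  exists V : nat -> nat -> R,
    (forall t i, (t < D * K)%N -> (i < n)%N ->
      `|V t i - \sum_(j < n) f (fpt t (level D (d i j))) * (u j)%:R|
        <= eps * \sum_(j < n) (u j)%:R) /\
    (forall i q, (i < n)%N -> (q < K)%N -> rarr s' 28 (i * K + q)%N%:Z =
       \sum_(t < D * K) rarr s 24 (q * (D * K) + t)%N%:Z *
         (V t i - (\sum_(j < n) (u j)%:R) * f (fpt t K))))).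
- by nia.
- move=> s' _ [V [Vok s'28]] i q lin qK; rewrite s'28 //.
  pose qo : 'I_K := Ordinal qK; set ng := \sum_(j < n) (u j)%:R in uB Vok s'28 *.
  have ng0 : 0 <= ng by apply: sumr_ge0.
  have tau0 : 0 < tau M by apply: tau_gt0.
  have n0 : 0 < n%:R :> R by rewrite ltr0n.
  have h : forall t : nat, (t < D * K)%N ->
     `|V t i - ng * f (fpt t K) - \sum_(q < K) fdiff f D c al t q * count_le u i q| <= eps * ng.
    move=> t tT; rewrite -(kernel_sum f c al (fun j => (u j)%:R)); last first.
      by move=> j jn; apply: dist_le.
    rewrite -/ng; have := Vok t i tT lin; set S := \sum_(j < n) _ * _.
    by congr (`|_| <= _); ring.
  have dec := @decode_error R f D c al D_gt0 M M_unit M_entry (fun t => V t i - ng * f (fpt t K))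
     (count_le u i) _ h qo.
  rewrite (_ : \sum_(t < _) _ = \sum_(t < D * K)
      decode_mx f D c al qo t * (V t i - ng * f (fpt t K))); last first.
    by apply: eq_bigr => t _; rewrite -(tab_decode (ready_tables rs) qo t).
  apply: le_lt_trans dec _.
  (* Here [tau M] cancels against the precision. The rest follows from [4 K^2 D <= D^3] and
     [ng D^3 <= n]. *)
  have -> : K%:R ^+ 2 * tau M * (D%:R * (eps * ng)) = K%:R ^+ 2 * D%:R * ng / (3 * n%:R).
    by field; rewrite !lt0r_neq0.
  rewrite ltr_pdivrMr ?mulr_gt0 //.
  have K2 : (2 * K <= D)%N by have [DE _] := halfD_parD D; lia.
  have KD : K%:R ^+ 2 * D%:R * 4 <= D%:R ^+ 3 :> R.
    rewrite -!natrX -!natrM ler_nat !expnS !expn0 !muln1.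
    by have := leq_mul (leq_mul K2 K2) (leqnn D); lia.
  have ngn : ng * D%:R ^+ 3 <= n%:R.
    apply: le_trans (_ : (n %/ D ^ 3)%N%:R * D%:R ^+ 3 <= _).
      by rewrite ler_wpM2r // exprn_ge0.
    by rewrite -natrX -natrM ler_nat leq_trunc_div.
  have : K%:R ^+ 2 * D%:R * 4 * ng <= D%:R ^+ 3 * ng by rewrite ler_wpM2r.
  by lra.
apply: runs_seq.
apply: runs_weaken (runs_fill (F := fun _ _ => 0) (env0 (ready_env rs))
  (env3 (ready_env rs)) _ _ _ _) => //; last by move=> *; apply: runs_blk.
move=> s1 ag1 s1_28; set P1 := Fill _ _ _ _ in ag1.
have r1 : ready s1 := ready_agree (isT : keep_ready [::] [::] [::] P1) ag1 rs.
have w1 : rarr s1 24 = rarr s 24 := fRA ag1 24.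
apply: (runs_for (Inv := fun k s' => exists V : nat -> nat -> R,
    (forall t i, (t < k)%N -> (i < n)%N ->
      `|V t i - \sum_(j < n) f (fpt t (level D (d i j))) * (u j)%:R|
        <= eps * \sum_(j < n) (u j)%:R) /\
    (forall i q, (i < n)%N -> (q < K)%N -> rarr s' 28 (i * K + q)%N%:Z =
       \sum_(t < k) rarr s 24 (q * (D * K) + t)%N%:Z *
         (V t i - (\sum_(j < n) (u j)%:R) * f (fpt t K))))) => //.
- exact: (env6 (ready_env r1)).
- by have /and4P[/allP -> //] := keep_test.
- by have /and4P[/allP -> //] := keep_test.
- by exists (fun _ _ => 0); split=> // i q lin qK; rewrite big_ord0 s1_28.
move=> k s2 kT [V [Vok s2_28]] ag2 s2_62.
have k2 : keep_ready [:: 54]%N [:: 5]%N [:: 27]%N (For 62 6 Test).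
  by apply: keep_for => //; apply: (fun h => keep_sub h keep_test).
have r2 : ready s2 := ready_agree k2 ag2 r1.
have [||t [s3 [ex3 le3 [v [vok s3_28]]]]] := @runs_test (fun j => (u j)%:R) k s2 r2 kT s2_62 (fun j _ => ler0n _ _).
- by move=> j jn; rewrite (keep_rarr k2 ag2) // (fRA ag1 27) s27.
- by rewrite (keep_rreg k2 ag2) // (fR ag1 5).
exists t, s3; split=> //; exists (fun t i => if t == k then v i else V t i); split.
  move=> t' i; rewrite ltnS leq_eqVlt; case: eqP => [->|_] //= h lin.
    exact: vok.
  exact: Vok.
move=> i q lin qK; rewrite s3_28 // s2_28 // big_ord_recr /= eqxx; congr (_ + _).
  by apply: eq_bigr => t' _; rewrite ltn_eqF.
by rewrite (keep_rarr k2 ag2) // w1.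
Qed.

Lemma level_int (k : nat) :
  k%:Z = 2 * (level D k)%:Z + (odd k)%:Z * (2 * (parD D)%:Z - 1).
Proof.
have [DE e1] := halfD_parD D; rewrite /level.
have kE : (k = 2 * (k %/ 2) + odd k)%N by have := divn_eq k 2; rewrite modn2; lia.
by case: (parD D) e1 => [|[|//]] _ /=; case: (odd k) kE => /= kE; lia.
Qed.

Definition near_level (p b i q : nat) : bool :=
  [exists j : 'I_n, grp p b j && (level D (d i j) <= q)%N].

(** This gap between 0 and 1 is what an estimate with error below 1/2 can resolve. *)
Lemma count_near (p b i q : nat) :
  if near_level p b i q then is_true (1 <= count_le (grp p b) i q) else count_le (grp p b) i q = 0.
Proof.
case: (boolP (near_level p b i q)) => [/existsP[j /andP[gj lj]]|/existsPn h].
  rewrite /count_le (bigD1 j) //= gj lj mulr1 lerDl.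
  by apply: sumr_ge0 => k _; rewrite mulr_ge0.
rewrite /count_le big1 // => j _; have := h j.
by case: (grp p b j) => //=; rewrite ?mulr0 // => /negPf->; rewrite mul0r.
Qed.

Definition cand (p i q : nat) : int :=
  2 * q%:Z + (parx i != p :> nat)%:Z * (2 * (parD D)%:Z - 1).

Lemma cand_level (p b i j : nat) : grp p b j ->
  (d i j)%:Z = cand p i (level D (d i j)).
Proof.
move=> /andP[/eqP pj _]; rewrite {1}(level_int (d i j)) /cand; congr (_ + _%:Z * _).
rewrite odd_ndist -/(parx i) -/(pary j) -pj.
by case: (parx i); case: (pary j).
Qed.

(** There is no estimate for [q = K]; every level is at most [K], so the group size in real register
    5 is the exact count. *)
Lemma runs_candidate (p b i q : nat) s : ready s -> (i < n)%N -> (q <= K)%N ->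
  ireg s 54 = p%:Z -> ireg s 84 = i%:Z -> ireg s 88 = q%:Z ->
  rreg s 5 = \sum_(j < n) (grp p b j)%:R ->
  ((q < K)%N -> `|rarr s 28 (i * K + q)%N%:Z - count_le (grp p b) i q| < 2^-1) ->
  runs Candidate s 18 (fun s' => ireg s' 7 =
    if near_level p b i q then Num.min (cand p i q) (ireg s 7) else ireg s 7).
Proof.
move=> rs lin qK s54 s84 s88 s5 s28; have es := ready_env rs.
rewrite (_ : 18 = 4 + (9 + (2 + 3)))%N //.
apply: runs_seq; apply: (@runs_weaken _ _ _ _ _ _ (fun s' =>
  (2^-1 <= rreg s' 42) = near_level p b i q) _ (leqnn _)); last first.
  have holdsE : holds (ILe 3 88) s = (K <= q)%N.
    by rewrite -[LHS]/(ireg s 3 <= ireg s 88) s88 (env3 es).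
  have cn := count_near p b i q.
  apply: runs_if; rewrite holdsE => h; apply: runs_blk => //.
    rewrite -[rreg _ 42]/(rreg s 5 + 0) addr0 s5.
    have cE : count_le (grp p b) i q = \sum_(j < n) (grp p b j)%:R.
      apply: eq_bigr => j _; rewrite (leq_trans (level_le (dist_le lin (ltn_ord j)))) //.
      by rewrite mul1r.
    move: cn; rewrite cE; case: (near_level _ _ _ _) => [h1|->].
      by apply: le_trans h1; lra.
    by apply/negbTE; rewrite -ltNge; lra.
  rewrite -[rreg _ 42]/(rarr s 28 (ireg s 84 * ireg s 3 + ireg s 88)).
  rewrite s84 s88 (env3 es) -PoszM -PoszD.
  have := s28; rewrite ltnNge h => /(_ isT); rewrite ltr_norml => /andP[h1 h2].
  move: cn; case: (near_level _ _ _ _) => [h3|h3]; first by lra.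
  by apply/negbTE; rewrite -ltNge; rewrite h3 in h2; lra.
move=> s1 ag1 s1_42; set P1 := If _ _ _ in ag1.
have r1 : ready s1 := ready_agree (isT : keep_ready [::] [::] [::] P1) ag1 rs.
have e1 := ready_env r1.
apply/runs_seq/runs_blk => //; set s2 := foldl _ _ _.
have g7 : ireg s2 7 = ireg s 7 := fI ag1 7.
have g15 : ireg s2 15 = 0 := env15 e1.
have g41 : (rreg s2 41 <= rreg s2 42) = near_level p b i q by rewrite -s1_42.
have g43 : (rreg s2 43 <= rreg s2 44) = (parx i == p :> nat).
  rewrite -eq_bool_nat_sqr -(ready_x r1 lin) -s84 -(fI ag1 84) -s54 -(fI ag1 54).
  by [].
have g80 : ireg s2 80 = 2 * q%:Z.
  by rewrite -[LHS]/(ireg s1 14 * ireg s1 88) (env14 e1) (fI ag1 88) s88.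
have g81 : ireg s2 81 = 2 * (parD D)%:Z - 1.
  by rewrite -[LHS]/(ireg s1 14 * ireg s1 4 - ireg s1 11) (env14 e1) (env4 e1) (env11 e1).
clearbody s2.
apply: runs_seq; apply: (@runs_weaken _ _ _ _ _ _ (fun s' => ireg s' 80 = cand p i q) _ (leqnn _)); last first.
  apply: runs_if => /=; rewrite g43 => h; apply: runs_blk => //=; rewrite !updE /=.
    by rewrite g80 /cand h mul0r addr0.
  by rewrite g80 g81 /cand h mul1r.
move=> s3 ag3 s3_80.
have f7 : ireg s3 7 = ireg s 7 := etrans (fI ag3 7) g7.
have f41 : holds (RLe 41 42) s3 = near_level p b i q.
  by rewrite -[LHS]/(rreg s3 41 <= rreg s3 42) (fR ag3 41) (fR ag3 42).
apply: runs_if; rewrite f41 => h; last first.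
  by apply: runs_blk => //; rewrite -[LHS]/(ireg s3 7) (negPf h).
rewrite h; apply: runs_if => /=; rewrite s3_80 f7 => h'; apply: runs_blk => //=; rewrite !updE /=.
  by rewrite s3_80 (fI ag3 15) g15 addr0 (min_idPl h').
by rewrite f7; apply/esym/min_idPr; rewrite ltW // ltNge.
Qed.

Lemma runs_candidates (p b : nat) (dmin : int) s : ready s -> ireg s 54 = p%:Z ->
  rreg s 5 = \sum_(j < n) (grp p b j)%:R ->
  (forall i q : nat, (i < n)%N -> (q < K)%N ->
     `|rarr s 28 (i * K + q)%N%:Z - count_le (grp p b) i q| < 2^-1) ->
  (forall i j, (i < n)%N -> (j < n)%N -> dmin <= (d i j)%:Z) -> dmin <= ireg s 7 ->
  runs Candidates s (40 * n * K.+1) (fun s' =>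
    [/\ dmin <= ireg s' 7, ireg s' 7 <= ireg s 7 & forall i j, (i < n)%N -> (j < n)%N ->
      grp p b j -> ireg s' 7 <= (d i j)%:Z]).
Proof.
move=> rs s54 s5 s28 lb s7.
apply: (@runs_weaken _ _ _ _ (4 + n * ((4 + K.+1 * (18 + 3)) + 3)) _ _ _ _ (fun _ _ => id)).
  by nia.
apply: (runs_for (Inv := fun k s' =>
    [/\ dmin <= ireg s' 7, ireg s' 7 <= ireg s 7 & forall i j, (i < k)%N -> (j < n)%N ->
      grp p b j -> ireg s' 7 <= (d i j)%:Z])) => //.
- exact: env0 (ready_env rs).
- by move=> k s' r x h; rewrite /= updE; case: eqP => // e; move: h; rewrite -e; lia.
move=> i s1 lin [a1 b1 c1] ag1 s1_84.
have r1 : ready s1 := ready_agree (isT : keep_ready [::] [::] [::] Candidates) ag1 rs.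
apply: (@runs_weaken _ _ _ _ _ _ (fun s' =>
    [/\ dmin <= ireg s' 7, ireg s' 7 <= ireg s1 7 & forall j, (j < n)%N ->
      grp p b j -> (level D (d i j) < K.+1)%N -> ireg s' 7 <= (d i j)%:Z]) _ (leqnn _)).
  move=> s' _ [a2 b2 c2]; split=> //; first exact: le_trans b2 b1.
  move=> i' j; rewrite ltnS leq_eqVlt => /orP[/eqP->|i'i] jn gj.
    by apply: c2 => //; rewrite ltnS; apply/level_le/dist_le.
  exact: le_trans b2 (c1 _ _ i'i jn gj).
apply: (runs_for (Inv := fun k s' =>
    [/\ dmin <= ireg s' 7, ireg s' 7 <= ireg s1 7 & forall j, (j < n)%N ->
      grp p b j -> (level D (d i j) < k)%N -> ireg s' 7 <= (d i j)%:Z])) => //.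
- exact: env13 (ready_env r1).
- by move=> k s' r x h; rewrite /= updE; case: eqP => // e; move: h; rewrite -e; lia.
move=> q s2 qK [a2 b2 c2] ag2 s2_88; set P2 := For _ _ _ in ag2.
have r2 : ready s2 := ready_agree (isT : keep_ready [::] [::] [::] P2) ag2 r1.
have g54 : ireg s2 54 = p := etrans (fI ag2 54) (etrans (fI ag1 54) s54).
have g84 : ireg s2 84 = i := etrans (fI ag2 84) s1_84.
have g5 : rreg s2 5 = \sum_(j < n) (grp p b j)%:R := etrans (fR ag2 5) (etrans (fR ag1 5) s5).
have g28 : (q < K)%N -> `|rarr s2 28 (i * K + q)%N%:Z - count_le (grp p b) i q| < 2^-1.
  by move=> h; rewrite (fRA ag2 28) (fRA ag1 28) s28.
apply: runs_weaken (runs_candidate r2 lin qK g54 g84 s2_88 g5 g28) => // s3 _ ->.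
(* A candidate may be accepted although no point has level exactly [q]. Then some [j] has a smaller
   level, so the candidate exceeds [d i j] and stays above [dmin]. *)
case: (boolP (near_level p b i q)) => [/existsP[j /andP[gj lj]]|/existsPn nn].
  split.
  - rewrite le_min a2 andbT; apply: le_trans (lb i j lin (ltn_ord j)) _.
    by rewrite (cand_level i gj) /cand; lia.
  - by rewrite ge_min b2 orbT.
  move=> j' j'n gj'; rewrite ltnS leq_eqVlt => /orP[/eqP lE|lt]; rewrite ge_min.
    by rewrite -lE -(cand_level i gj') lexx.
  by rewrite (c2 j') ?orbT.
split=> // j' j'n gj'; rewrite ltnS leq_eqVlt => /orP[/eqP lE|lt]; last exact: c2.
by have := nn (Ordinal j'n); rewrite /= gj' lE leqnn.
Qed.

Definition Block : program R :=
  Seq Group (Seq GroupSize (Seq Estimates Candidates)).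

Lemma keep_block : keep_ready [:: 54; 58; 55; 59]%N [::] [::] Block.
Proof.
do 2!(apply: keep_seq; first by []); apply: keep_seq => //.
by apply: (fun h => keep_sub h keep_estimates).
Qed.

Lemma runs_block (p b : nat) (dmin : int) s : ready s -> (D ^ 3 <= n)%N ->
  ireg s 54 = p%:Z -> ireg s 58 = b%:Z ->
  (forall i j, (i < n)%N -> (j < n)%N -> dmin <= (d i j)%:Z) -> dmin <= ireg s 7 ->
  runs Block s ((D * K) * (TT + 110 * n * (m.+1 + K.+1)) + 200 * n * K.+1) (fun s' =>
    [/\ dmin <= ireg s' 7, ireg s' 7 <= ireg s 7 & forall i j, (i < n)%N -> (j < n)%N ->
      grp p b j -> ireg s' 7 <= (d i j)%:Z]).
Proof.
move=> rs Dn s54 s58 lb s7.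
apply: (@runs_weaken _ _ _ _ ((30 * n + 12) + ((11 * n + 12) +
  (((D * K) * (TT + 110 * n * (m.+1 + K.+1)) + 30 * n * K.+1) + 40 * n * K.+1))) _ _ _ _ (fun _ _ => id)).
  set z := ((D * K) * _)%N; nia.
apply: runs_seq; apply: runs_weaken (runs_group rs s54 s58) => // s1 ag1 s1_27.
have r1 : ready s1 := ready_agree (isT : keep_ready [::] [::] [::] Group) ag1 rs.
apply: runs_seq; apply: runs_weaken (runs_group_size r1 s1_27) => // s2 ag2 s2_5.
have r2 : ready s2 := ready_agree (isT : keep_ready [::] [::] [::] GroupSize) ag2 r1.
have s2_27 : forall j, (j < n)%N -> rarr s2 27 j = (grp p b j)%:R.
  by move=> j jn; rewrite (fRA ag2 27) s1_27.
apply: runs_seq; apply: runs_weaken (runs_estimates r2 s2_27 s2_5 _ Dn) => //; last first.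
  exact: (sum_window _ n (b * B) B (fun j => pary j == p :> nat)).
move=> s3 ag3 s3_28; have k3 := keep_estimates.
have r3 : ready s3 := ready_agree k3 ag3 r2.
have s3_7 : ireg s3 7 = ireg s 7.
  by rewrite (keep_ireg k3 ag3) // (fI ag2 7) (fI ag1 7).
have s3_54 : ireg s3 54 = p.
  by rewrite (keep_ireg k3 ag3) // (fI ag2 54) (fI ag1 54).
have s3_5 : rreg s3 5 = \sum_(j < n) (grp p b j)%:R by rewrite (keep_rreg k3 ag3).
apply: runs_weaken (runs_candidates r3 s3_54 s3_5 s3_28 lb _) => //; rewrite s3_7 //.
Qed.

Definition Search : program R := For 54 14 (For 58 17 Block).

Lemma keep_blocks : keep_ready [:: 54; 55]%N [::] [::] (For 58 17 Block).
Proof. by apply: keep_for => //; apply: (fun h => keep_sub h keep_block). Qed.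

Lemma keep_search : keep_ready [::] [::] [::] Search.
Proof. by apply: keep_for => //; apply: (fun h => keep_sub h keep_blocks). Qed.

Lemma runs_search (dmin : int) s : ready s -> (D ^ 3 <= n)%N ->
  (forall i j, (i < n)%N -> (j < n)%N -> dmin <= (d i j)%:Z) -> dmin <= ireg s 7 ->
  runs Search s (4 + 2 * ((4 + 2 * D ^ 3 *
      (((D * K) * (TT + 110 * n * (m.+1 + K.+1)) + 200 * n * K.+1) + 3)) + 3)) (fun s' =>
    dmin <= ireg s' 7 /\ forall i j, (i < n)%N -> (j < n)%N -> ireg s' 7 <= (d i j)%:Z).
Proof.
move=> rs Dn lb s7.
have D3 : (0 < D ^ 3)%N by rewrite expn_gt0 D_gt0.
have B0 : (0 < B)%N by rewrite divn_gt0.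
(* Since [B >= 1], [n < (B + 1) D^3 <= 2 B D^3]: doubling the number of blocks makes up for the
   rounding of their length. *)
have nB : (n < 2 * D ^ 3 * B)%N.
  have := divn_eq n (D ^ 3); have := ltn_pmod n D3; nia.
have kb := keep_block.
have kf := keep_blocks.
have ks := keep_search.
have wf r : r \in [:: 54; 55]%N -> ~~ iwr (For 58 17 Block) r.
  by move=> hr; have /and4P[/allP a _ _ _] := kf; apply: a; rewrite mem_cat hr orbT.
have wb r : r \in [:: 58; 59]%N -> ~~ iwr Block r.
  move=> hr; have /and4P[/allP a _ _ _] := kb; apply: a; rewrite mem_cat.
  by apply/orP; right; move: hr; rewrite !inE => /orP[] ->; rewrite ?orbT.
apply: (@runs_weaken _ _ _ _ _ _ (fun s' => dmin <= ireg s' 7 /\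
  forall i j, (i < n)%N -> (j < n)%N -> (pary j < 2)%N -> ireg s' 7 <= (d i j)%:Z) _ (leqnn _)).
  by move=> s' _ [h1 h2]; split=> // i j lin ljn; apply: h2 => //; case: (pary j).
apply: (runs_for (Inv := fun k s' => dmin <= ireg s' 7 /\
  forall i j, (i < n)%N -> (j < n)%N -> (pary j < k)%N -> ireg s' 7 <= (d i j)%:Z)) => //.
- exact: env14 (ready_env rs).
- exact: wf.
- exact: wf.
- by move=> k s' r x h; rewrite /= updE; case: eqP => // e; move: h; rewrite -e; lia.
move=> p s1 _ [a1 b1] ag1 s1_54.
have r1 : ready s1 := ready_agree ks ag1 rs.
apply: (@runs_weaken _ _ _ _ _ _ (fun s' => [/\ dmin <= ireg s' 7, ireg s' 7 <= ireg s1 7 &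
  forall i j, (i < n)%N -> (j < n)%N -> pary j = p :> nat -> (j %/ B < 2 * D ^ 3)%N ->
    ireg s' 7 <= (d i j)%:Z]) _ (leqnn _)).
  move=> s' _ [a2 b2 c2]; split=> // i j lin ljn; rewrite ltnS leq_eqVlt => /orP[/eqP h|h].
    by apply: c2 => //; rewrite ltn_divLR // (leq_trans ljn) // ltnW.
  exact: le_trans b2 (b1 _ _ lin ljn h).
apply: (runs_for (Inv := fun k s' => [/\ dmin <= ireg s' 7, ireg s' 7 <= ireg s1 7 &
  forall i j, (i < n)%N -> (j < n)%N -> pary j = p :> nat -> (j %/ B < k)%N ->
    ireg s' 7 <= (d i j)%:Z])) => //.
- exact: env17 (ready_env r1).
- exact: wb.
- exact: wb.
- by move=> k s' r x h; rewrite /= updE; case: eqP => // e; move: h; rewrite -e; lia.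
move=> b s2 _ [a2 b2 c2] ag2 s2_58.
have r2 : ready s2 := ready_agree kf ag2 r1.
have s2_54 : ireg s2 54 = p by rewrite (keep_ireg kf ag2).
apply: runs_weaken (runs_block r2 Dn s2_54 s2_58 lb a2) => // s3 _ [a3 b3 c3].
split=> //; first exact: le_trans b3 b2.
move=> i j lin ljn pj; rewrite ltnS leq_eqVlt => /orP[/eqP jb|jb].
  apply: c3 => //; rewrite /grp pj eqxx -jb /=; have := divn_eq j B; have := ltn_pmod j B0; lia.
exact: le_trans b3 (c2 _ _ lin ljn pj jb).
Qed.
End Loop.

(** * The reduction *)

Section ClosestPair.
Variables (R : realType) (f : R -> R) (Pk : program R).
Implicit Types (s : state R).

(** Register 7 starts at [D], an upper bound for all distances. Below [D^3] points the block length
    would be 0, which is why that case is separate. *)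
Definition ClosestPair : program R :=
  Seq (blk (IConst R 11 1) [:: IConst R 15 0; IConst R 14 2; IAdd R 7 2 15; IMul R 8 2 2;
         IMul R 8 8 2; IAdd R 12 1 11])
 (Seq (If (ILe 8 0)
        (Seq (Seq (Consts R) (Seq (Matrix R) (Precision R)))
          (Seq (TestTables R) (Seq (Parities R) (Search Pk))))
        (Brute R))
   (blk (IAdd R 0 7 15) [::])).

Variables (n m D TT : nat) (c : R) (alpha : 'rV[R]_D) (x y : 'M[int]_(n, m)).
Let M := counting_mx f c alpha (idvec R D).
Local Notation eps := (3 * n%:R * tau M)^-1.

Hypothesis n_gt0 : (0 < n)%N.
Hypothesis D_gt0 : (0 < D)%N.
Hypothesis range01 : forall l p : 'I_D, 0 <= c + alpha 0 l * idvec R D 0 p <= 1.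
Hypothesis M_unit : M \in unitmx.
Hypothesis dist_le : forall i j : 'I_n, sqnorm (row i x - row j y) <= D%:Z.
Hypothesis kde_ok : forall (x y : 'M[R]_(n, m.+1)) (u : 'cV[R]_n) s,
  (forall i j : 'I_n, sqnorm (row i x - row j y) <= 1) ->
  KDE_input eps x y u s ->
  exists (t : nat) (s' : state R) (v : 'cV[R]_n),
    [/\ exec f Pk s t s', (t <= TT)%N, stored_cv (rarr s' 3) v &
        KDE_solution f eps x y u v].

Let search_cost : nat :=
  (14 * n + 300 * D.+1 ^ 3 + (400 * D.+1 ^ 4 + (200 * n * (m.+1 * D.+1) +
   (4 + 2 * ((4 + 2 * D ^ 3 *
      (((D * halfD D) * (TT + 110 * n * (m.+1 + (halfD D).+1)) + 200 * n * (halfD D).+1) + 3)) + 3)))))%N.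
Let brute_cost : nat :=
  (4 + n * ((4 + n * ((2 + (10 * m.+1 + 3)) + 3)) + 3))%N.

(** Apart from the KDE calls, every term is at most a constant times [Z = (D+1)^6 (m+1) n]. The
    number of calls is at most [4 D^4 K]. *)
Lemma search_cost_le :
  (search_cost + 9 <= 4 * D.+1 ^ 5 * TT + 4000 * D.+1 ^ 6 * m.+1 * n)%N.
Proof.
have kD : (halfD D <= D)%N by apply: leq_div.
rewrite /search_cost; move: (halfD D) kD => k kD.
set xx := D.+1; set yy := m.+1; set Z := (xx ^ 6 * yy * n)%N.
have x0 : (0 < xx)%N by [].
have y0 : (0 < yy)%N by [].
have xle a : (a <= 6)%N -> (xx ^ a <= xx ^ 6)%N by move=> h; rewrite leq_pexp2l.
have leZ a b e : (a <= 6)%N -> (b <= yy)%N -> (e <= n)%N -> (xx ^ a * b * e <= Z)%N.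
  by move=> ha hb he; rewrite !leq_mul ?xle.
have Dx : (D <= xx)%N by rewrite /xx.
have D3 : (D ^ 3 <= xx ^ 3)%N by rewrite leq_exp2r.
pose a := (D ^ 3 * (D * k))%N.
have ax : (a <= xx ^ 5)%N.
  rewrite (_ : xx ^ 5 = xx ^ 3 * (xx * xx))%N; last by rewrite !expnS expn0 !muln1 !mulnA.
  by rewrite !leq_mul // (leq_trans kD).
have w1 : (a * TT <= xx ^ 5 * TT)%N by rewrite leq_mul.
have w2 : (a * n * (yy + k.+1) <= 2 * Z)%N.
  apply: (@leq_trans (xx ^ 5 * n * (2 * (xx * yy)))%N); last first.
    by rewrite /Z (expnS xx 5); lia.
  apply: leq_mul; first exact: leq_mul.
  by have := leq_pmull yy x0; have := leq_pmulr xx y0; lia.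
have w3 : (D ^ 3 * n * k.+1 <= Z)%N.
  apply: (@leq_trans (xx ^ 4 * 1 * n)%N); last exact: leZ.
  by rewrite muln1 (expnSr xx 3) mulnAC leq_mul // leq_mul // /xx.
have w4 : (D ^ 3 <= Z)%N by apply: leq_trans D3 _; have := leZ 3%N 1%N 1%N isT y0 n_gt0; lia.
have w5 : (xx ^ 3 <= Z)%N by have := leZ 3%N 1%N 1%N isT y0 n_gt0; lia.
have w6 : (xx ^ 4 <= Z)%N by have := leZ 4%N 1%N 1%N isT y0 n_gt0; lia.
have w7 : (n <= Z)%N by have := leZ 0%N 1%N n isT y0 (leqnn n); rewrite expn0; lia.
have w8 : (n * (yy * xx) <= Z)%N by have := leZ 1%N yy n isT (leqnn yy) (leqnn n); rewrite expn1; lia.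
have w9 : (1 <= Z)%N by apply: leq_trans w7.
have e : (2 * D ^ 3 * (D * k * (TT + 110 * n * (yy + k.+1)) + 200 * n * k.+1 + 3) =
   2 * (a * TT) + 220 * (a * n * (yy + k.+1)) + 400 * (D ^ 3 * n * k.+1) + 6 * D ^ 3)%N.
  by rewrite /a; lia.
have e2 : (4000 * xx ^ 6 * yy * n = 4000 * Z)%N by rewrite /Z !mulnA.
rewrite e e2 -(mulnA 200 n) -(mulnA 4 (xx ^ 5)%N).
move: w1 w2 w3 w4 w5 w6 w7 w8 w9; clear.
move: {Z}(Z) (xx ^ 3)%N (xx ^ 4)%N (D ^ 3)%N (n * (yy * xx))%N (D ^ 3 * n * _)%N
  (a * n * _)%N (a * TT)%N (xx ^ 5 * TT)%N; lia.
Qed.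

Lemma runs_closest_pair s : BCP_input c alpha x y s ->
  exists (t : nat) s', [/\ exec f ClosestPair s t s', BCP_solution x y (ireg s' 0) &
    (D ^ 3 <= n)%N -> (t <= 4 * D.+1 ^ 5 * TT + 4000 * D.+1 ^ 6 * m.+1 * n)%N].
Proof.
move=> [[s0 s1 s2] [sx sy sc sal]].
pose X := iarr s 0; pose Y := iarr s 1; pose al (l : nat) := rarr s 0 l%:Z.
have alE (l : 'I_D) : al l = alpha 0 l := sal l.
have range01' (l p : nat) : (l < D)%N -> (1 <= p <= D)%N -> 0 <= c + al l * p%:R <= 1.
  move=> lD pD; have pP : (p.-1 < D)%N by lia.
  have := range01 (Ordinal lD) (Ordinal pP); rewrite -alE mxE /= prednK //; lia.
have M_entry (l p : 'I_D) : M l p = f (c + al l * p.+1%:R) by rewrite !mxE alE.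
have dE (i j : 'I_n) : sqnorm (row i x - row j y) = (ndist m X Y i j)%:Z.
  by rewrite -adistE; apply: eq_bigr => k _; rewrite !mxE -sx -sy.
have dD (i j : nat) : (i < n)%N -> (j < n)%N -> (ndist m X Y i j <= D)%N.
  by move=> lin ljn; have := dist_le (Ordinal lin) (Ordinal ljn); rewrite dE lez_nat.
pose p0 : 'I_n * 'I_n := (Ordinal n_gt0, Ordinal n_gt0).
have [[i0 j0] dmin] : exists p : 'I_n * 'I_n, forall i j : 'I_n,
    (ndist m X Y p.1 p.2 <= ndist m X Y i j)%N.
  case: (arg_minnP (fun p : 'I_n * 'I_n => ndist m X Y p.1 p.2) (isT : xpredT p0)) => p _ h.
  by exists p => i j; apply: (h (i, j)).
pose dm : int := (ndist m X Y i0 j0)%:Z.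
have lb (i j : nat) : (i < n)%N -> (j < n)%N -> dm <= (ndist m X Y i j)%:Z.
  by move=> lin ljn; rewrite lez_nat; apply: (dmin (Ordinal lin) (Ordinal ljn)).
have dmD : dm <= D by rewrite lez_nat dD.
pose z := foldl (fun s' j => step f j s') (step f (IConst R 11 1) s)
  [:: IConst R 15 0; IConst R 14 2; IAdd R 7 2 15; IMul R 8 2 2; IMul R 8 8 2; IAdd R 12 1 11].
have zin : input n m D c al X Y z.
  split=> //.
  - by rewrite -[LHS]/(ireg s 2 + 0) s2 addr0.
  - by rewrite -[LHS]/(ireg s 2 * ireg s 2 * ireg s 2) s2 -!PoszM !expnS expn0 muln1 mulnA.
  - by rewrite -[LHS]/(ireg s 1 + 1) s1 -PoszD addn1.
have z7 : ireg z 7 = D := in7 zin.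
have zh : holds (ILe 8 0) z = (D ^ 3 <= n)%N.
  by rewrite -[LHS]/(ireg z 8 <= ireg z 0) (in8 zin) (in0 zin).
pose cost := if (D ^ 3 <= n)%N then search_cost else brute_cost.
suff [t [s' [ex le_t post]]] : runs f ClosestPair s (7 + (cost.+1 + 1)) (fun s' => ireg s' 0 = dm).
  exists t, s'; split=> // [|Dn].
    rewrite post; split=> [|i j]; first by exists i0, j0; rewrite dE.
    by rewrite dE lb.
  apply: leq_trans le_t _; apply: leq_trans search_cost_le.
  by rewrite /cost Dn; lia.
apply/runs_seq/runs_blk => //; rewrite -/z.
apply: runs_seq; apply: (@runs_weaken _ _ _ _ _ _ (fun s' => ireg s' 15 = 0 /\
  (dm <= ireg s' 7 /\ forall i j, (i < n)%N -> (j < n)%N ->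
     ireg s' 7 <= (ndist m X Y i j)%:Z)) _ (leqnn _)).
  move=> s' _ [s'15 [h1 h2]]; apply: runs_blk => //.
  rewrite -[LHS]/(ireg s' 7 + ireg s' 15) s'15 addr0.
  by apply/eqP; rewrite eq_le h1 andbT h2.
apply: runs_if; rewrite zh /cost => h; last first.
  rewrite (negPf h).
  apply: runs_weaken (runs_brute f (in0 zin) (in1 zin) (in15 zin) _ lb) => //; last by rewrite z7.
  by move=> s' ag post; split=> //; rewrite (fI ag 15) (in15 zin).
rewrite h /search_cost.
apply: runs_seq; apply: runs_weaken (runs_precision n_gt0 D_gt0 range01' M_unit M_entry zin) => //.
move=> s3 ag3 e3.
have s3_7 : ireg s3 7 = D := etrans (fI ag3 7) z7.
apply: runs_seq; apply: runs_weaken (runs_tables n_gt0 D_gt0 range01' M_unit M_entry e3) => //.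
move=> s4 ag4 [e4 t4].
have s4_7 : ireg s4 7 = D := etrans (fI ag4 7) s3_7.
apply: runs_seq; apply: runs_weaken (runs_parities f n_gt0 (env0 e4) (env1 e4) (env11 e4) (env15 e4) _) => //.
  2: by rewrite (envX e4) (envY e4).
move=> s5 ag5; rewrite (envX e4) (envY e4) => -[px py].
have e5 : env n m c al X Y M s5 := env_agree (isT : keeps_env (Parities R)) ag5 e4.
have r5 : ready f n m c al X Y M s5.
  split=> //; case: t4 => tb ts tl td.
  by split=> *; [rewrite (fRA ag5 20)|rewrite (fRA ag5 21)|rewrite (fRA ag5 23)|rewrite (fRA ag5 24)];
    rewrite ?tb ?ts ?tl ?td.
have s5_7 : dm <= ireg s5 7 by rewrite (fI ag5 7) s4_7.
apply: runs_weaken (runs_search n_gt0 D_gt0 range01' M_unit M_entry dD kde_ok r5 h lb s5_7) => //.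
move=> s6 ag6 post; split=> //.
have ks := keep_search Pk.
by rewrite (keep_ireg ks ag6) // (env15 e5).
Qed.

End ClosestPair.

Theorem theorem10 (R : realType) (f : R -> R) (m D : nat -> nat)
    (alpha : forall n : nat, 'rV[R]_(D n)) (c : nat -> R)
    (T : nat -> nat -> R -> R)
    (D_ge1 : forall n : nat, (1 <= D n)%N)
    (range01 : forall (n : nat) (l p : 'I_(D n)),
       0 <= c n + alpha n 0 l * idvec R (D n) 0 p <= 1)
    (M_unit : forall n : nat,
       counting_mx f (c n) (alpha n) (idvec R (D n)) \in unitmx)
    (m_small : subpolynomial (fun n : nat => (m n)%:R : R))
    (D_small : subpolynomial (fun n : nat => (D n)%:R : R))
    (KDE_T : KDE_solvable_in f T) :
  exists e1 e2 : nat -> R,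
    [/\ e1 @ \oo --> (0 : R), e2 @ \oo --> (0 : R) &
        BCP_solvable_in f m c alpha
          (fun n : nat =>
             T n (m n).+1
               (3 * n%:R *
                tau (counting_mx f (c n) (alpha n) (idvec R (D n))))^-1
               * n%:R `^ e1 n
             + n%:R `^ (1 + e2 n))].
Proof.
have [Pk kde] := KDE_T.
pose M n := counting_mx f (c n) (alpha n) (idvec R (D n)).
pose eps n := (3 * n%:R * tau (M n))^-1.
have eps_gt0 n : (0 < n)%N -> 0 < eps n.
  by move=> n0; rewrite invr_gt0 !mulr_gt0 ?ltr0n // tau_gt0.
(* [T] bounds the number of steps on the all-zero instance, hence is nonnegative. *)
have T_ge0 n : (0 < n)%N -> 0 <= T n (m n).+1 (eps n).
  move=> n0; pose s := State (fun r => if r == 0%N then n%:Z else (m n).+1%:Z)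
    (fun=> eps n) (fun _ _ => 0) (fun _ _ => 0 : R).
  have [||t [s' [v [_ tT _ _]]]] := kde n (m n).+1 (eps n) 0 0 0 s n0 isT (eps_gt0 n n0).
  - by move=> i j; rewrite /sqnorm big1 // => k _; rewrite !mxE subrr expr0n.
  - by split; split=> // i; rewrite ?mxE // => k; rewrite mxE.
  exact: le_trans tT.
have D1 := subpolynomial_succ D_small; have m1 := subpolynomial_succ m_small.
have Dpow k := subpolynomialX k (fun n => ler0n R (D n).+1) D1.
have Dpow0 k n : 0 <= (D n).+1%:R ^+ k :> R by apply: exprn_ge0.
(* The constant is abstracted to keep the unary numeral out of unification. *)
have [A AE] : exists A, A = 4000%N by exists 4000%N.
have powM (C k : nat) : subpolynomial (fun n => C%:R * (D n).+1%:R ^+ k : R).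
  by apply: subpolynomialM (subpolynomial_const _) (Dpow k).
(* [e1] absorbs the number of KDE calls, [e2] the remaining cost per point. *)
have [e1 e10 le1] := powM 4 5.
have [e2 e20 le2] : subpolynomial (fun n => A%:R * (D n).+1%:R ^+ 6 * (m n).+1%:R : R).
  by apply: subpolynomialM (powM A 6) m1 => // n; rewrite mulr_ge0.
have [e3 e30 le3] : subpolynomial (fun n => (D n)%:R ^+ 3 : R) by apply: subpolynomialX.
(* Eventually [D^3 <= n^(e3 n) <= n], so the brute-force case disappears for large [n]. *)
have le_e3 : \forall n \near \oo, e3 n <= 1.
  by apply: cvgr_le e30 _ _; rewrite ltr01.
have [N _ largeN] : \forall n \near \oo,
  [/\ 4 * (D n).+1%:R ^+ 5 <= n%:R `^ e1 n,
      A%:R * (D n).+1%:R ^+ 6 * (m n).+1%:R <= n%:R `^ e2 n &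
      (D n)%:R ^+ 3 <= (n%:R : R)].
  near=> n; split; [by near: n|by near: n|].
  have n1 : 1 <= n%:R :> R by near: n; apply: near_le_nat.
  apply: le_trans (_ : n%:R `^ e3 n <= _); first by near: n.
  rewrite -[leRHS]powRr1 //; apply: ler_powR => //; by near: n.
exists e1, e2; split=> //; exists (ClosestPair Pk), N => n x y s n0 dD sin.
(* Step counts are integers, so the real bound [T] may be replaced by its integer part. *)
have [|t [s' [ex sol le_t]]] := @runs_closest_pair R f Pk n (m n) (D n)
   (Num.truncn (T n (m n).+1 (eps n))) (c n) (alpha n) x y n0 (D_ge1 n) (range01 n)
   (M_unit n) dD _ s sin.
  move=> x' y' u z xy zin.
  have [t [s' [v [ex tT sv sol]]]] := kde n (m n).+1 (eps n) x' y' u z n0 isT (eps_gt0 n n0) xy zin.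
  by exists t, s', v; split=> //; rewrite truncn_ge_nat // T_ge0.
rewrite -AE in le_t; exists t, s'; split=> // Nn.
have [h1 h2 h3] := largeN n Nn.
have Dn : (D n ^ 3 <= n)%N by rewrite -(ler_nat R) natrX.
have n0' : (0 : R) < n%:R by rewrite ltr0n.
apply: le_trans (_ : (4 * (D n).+1 ^ 5 * Num.truncn (T n (m n).+1 (eps n)) +
  A * (D n).+1 ^ 6 * (m n).+1 * n)%N%:R <= _); first by rewrite ler_nat le_t.
rewrite !(natrD, natrX, natrM); apply: lerD.
  rewrite mulrC ler_pM ?T_ge0 ?mulr_ge0 ?exprn_ge0 //.
  by rewrite -truncn_ge_nat ?T_ge0.
rewrite powRD; last by apply/implyP => _; rewrite gt_eqF.
by rewrite powRr1 // [leRHS]mulrC; apply: ler_wpM2r.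
Unshelve. all: by end_near.
Qed.
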